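(* Let $\Gamma$ be a set, $m\ge1$, and let $(G_{\underline{\gamma}})_{\underline{\gamma}\in\mathcal{J}_\Gamma}$ be a family of real functions such that for each $\underline{\gamma}=(\gamma_1,\dots,\gamma_n)\in\mathcal{J}_\Gamma$, $G_{\underline{\gamma}}:\mathbb{S}(n\times m)\to\mathbb{R}$ is monotone and sublinear: $G_{\underline{\gamma}}(Q+\bar Q)\le G_{\underline{\gamma}}(Q)+G_{\underline{\gamma}}(\bar Q)$, $G_{\underline{\gamma}}(\lambda Q)=\lambda G_{\underline{\gamma}}(Q)$ for $\lambda\ge0$, and $G_{\underline{\gamma}}(Q)\ge G_{\underline{\gamma}}(\bar Q)$ if $Q\ge\bar Q$. Assume: (1) (Compatibility) for every $(\gamma_1,\dots,\gamma_n,\gamma_{n+1})\in\mathcal{J}_\Gamma$ and $Q\in\mathbb{S}(n\times m)$, $G_{\gamma_1,\dots,\gamma_n,\gamma_{n+1}}(\bar Q)=G_{\gamma_1,\dots,\gamma_n}(Q)$, where $\bar Q=\begin{pmatrix}Q&0\\0&0\end{pmatrix}\in\mathbb{S}((n+1)\times m)$; (2) (Symmetry) for every $(\gamma_1,\dots,\gamma_n)\in\mathcal{J}_\Gamma$, every permutation $\pi$ of $\{1,\dots,n\}$ and every $Q\in\mathbb{S}(n\times m)$, $G_{\gamma_{\pi(1)},\dots,\gamma_{\pi(n)}}(Q)=G_{\gamma_1,\dots,\gamma_n}(\pi^{-1}(Q))$, where, writing $Q=(Q_{ij})_{i,j=1}^n$ in $m\times m$ blocks, $\pi^{-1}(Q)$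 is the matrix whose $(i,j)$ block is $Q_{\pi^{-1}(i)\pi^{-1}(j)}$. Then there exists an $m$-dimensional $G$-Gaussian random field $(W_\gamma)_{\gamma\in\Gamma}$ on a sublinear expectation space $(\Omega,\mathcal{H},\hat{\mathbb{E}})$ such that for each $\underline{\gamma}=(\gamma_1,\dots,\gamma_n)\in\mathcal{J}_\Gamma$ the vector $W_{\underline{\gamma}}=(W_{\gamma_1},\dots,W_{\gamma_n})$ is $G$-normally distributed with $$\tfrac12\hat{\mathbb{E}}[\langle QW_{\underline{\gamma}},W_{\underline{\gamma}}\rangle]=G_{\underline{\gamma}}(Q)\quad\text{for all }Q\in\mathbb{S}(n\times m).$$ Furthermore, if $(\bar W_\gamma)_{\gamma\in\Gamma}$ is another $G$-Gaussian random field indexed by $\Gamma$ on a sublinear expectation space $(\bar\Omega,\bar{\mathcal{H}},\bar{\mathbb{E}})$ such that for each $\underline{\gamma}\in\mathcal{J}_\Gamma$, $\bar W_{\underline{\gamma}}$ is $G$-normally distributed with $\tfrac12\bar{\mathbb{E}}[\langle Q\bar W_{\underline{\gamma}},\bar W_{\underline{\gamma}}\rangle]=G_{\underline{\gamma}}(Q)$ for all $Q\in\mathbb{S}(n\times m)$, then $W\overset{d}{=}\bar W$.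
   Context: $C_{l.Lip}(\mathbb{R}^k)$ is the space of $\varphi:\mathbb{R}^k\to\mathbb{R}$ with $|\varphi(x)-\varphi(y)|\le C(1+|x|^q+|y|^q)|x-y|$ for some $C>0,q\in\mathbb{N}$. A sublinear expectation space $(\Omega,\mathcal{H},\hat{\mathbb{E}})$: $\Omega$ a nonempty set, $\mathcal{H}$ a linear space of real functions on $\Omega$ with $\varphi(X_1,\dots,X_k)\in\mathcal{H}$ whenever $X_i\in\mathcal{H}$ and $\varphi\in C_{l.Lip}(\mathbb{R}^k)$, and $\hat{\mathbb{E}}:\mathcal{H}\to\mathbb{R}$ monotone, constant preserving, sub-additive and positively homogeneous. Random vectors $X_1,X_2$ (possibly on different spaces) are identically distributed, $X_1\overset{d}{=}X_2$, if $\hat{\mathbb{E}}_1[\varphi(X_1)]=\hat{\mathbb{E}}_2[\varphi(X_2)]$ for all $\varphi\in C_{l.Lip}$. $Y$ is independent from $X$ if $\hat{\mathbb{E}}[\varphi(X,Y)]=\hat{\mathbb{E}}[\hat{\mathbb{E}}[\varphi(x,Y)]_{x=X}]$ for all $\varphi\in C_{l.Lip}$. $\bar X$ is an independent copy of $X$ if $\bar X\overset{d}{=}X$ and $\bar X$ is independent from $X$ (realised, if necessary, on a larger sublinear expectation space). A random vector $X$ is $G$-normally distributed if $aX+b\bar X\overset{d}{=}\sqrt{a^2+b^2}\,X$ for all $a,b\ge0$, with $\bar X$ an independent copy of $X$. $\mathcal{J}_\Gamma$ is the set of finite tuples of pairwise distinct elements of $\Gamma$. $\mathbb{S}(n\times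 m)$ is the set of symmetric $(nm)\times(nm)$ real matrices. An $m$-dimensional random field is a family $(W_\gamma)_{\gamma\in\Gamma}$ with $W_\gamma\in\mathcal{H}^m$; it is a $G$-Gaussian random field if for each $\underline{\gamma}=(\gamma_1,\dots,\gamma_n)\in\mathcal{J}_\Gamma$ the $nm$-dimensional vector $W_{\underline{\gamma}}=(W_{\gamma_1},\dots,W_{\gamma_n})$ is $G$-normally distributed. Two random fields satisfy $W\overset{d}{=}\bar W$ if $W_{\underline{\gamma}}\overset{d}{=}\bar W_{\underline{\gamma}}$ for every $\underline{\gamma}\in\mathcal{J}_\Gamma$. *)

(* Defs.v *)
From HB Require Import structures.
From mathcomp Require Import all_boot all_order all_algebra all_fingroup.
From mathcomp Require Import sesquilinear.
From mathcomp Require Import reals.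

Set Implicit Arguments.
Unset Strict Implicit.
Unset Printing Implicit Defensive.

Import Order.TTheory GRing.Theory Num.Theory.
Local Open Scope ring_scope.

Section EuclideanSpace.
Variables (R : realType) (k : nat).
Implicit Types (x y : 'cV[R]_k) (Q : 'M[R]_k).

Definition dotv x y : R := \sum_i x i 0 * y i 0.

(* The norm that matrices carry in MathComp-Analysis is the sup norm, hence
   this definition of the Euclidean one. *)
Definition enorm x : R := Num.sqrt (dotv x x).

Definition C_lLip (phi : 'cV[R]_k -> R) : Prop :=
  exists (C : R) (q : nat), 0 < C /\
    forall x y,
      `|phi x - phi y| <= C * (1 + enorm x ^+ q + enorm y ^+ q) * enorm (x - y).

Definition possemidef Q : Prop := forall x, 0 <= dotv (Q *m x) x.

Definition loewner_le Q Q' : Prop := possemidef (Q' - Q).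

(* Only the restriction of G to symmetric matrices is constrained. *)
Definition monotone_sublinear (G : 'M[R]_k -> R) : Prop :=
  [/\ forall Q Q', Q \is symmetricmx -> Q' \is symmetricmx ->
        G (Q + Q') <= G Q + G Q',
      forall (lambda : R) Q, 0 <= lambda -> Q \is symmetricmx ->
        G (lambda *: Q) = lambda * G Q
    & forall Q Q', Q \is symmetricmx -> Q' \is symmetricmx ->
        loewner_le Q' Q -> G Q' <= G Q].

End EuclideanSpace.

(* The expectation is a function on all of [Omega -> R]; its values outside
   [inH] are irrelevant, no axiom or definition below refers to them. *)
Record sublin_space (R : realType) := SublinSpace {
  Omega : Type;
  inH : (Omega -> R) -> Prop;
  E : (Omega -> R) -> R;
  Omega_nonempty : inhabited Omega;
  inH_zero : inH (fun=> 0);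
  inH_linear : forall (a : R) X Y,
    inH X -> inH Y -> inH (fun w => a * X w + Y w);
  inH_comp : forall (k : nat) (X : 'I_k -> Omega -> R) (phi : 'cV[R]_k -> R),
    (forall i, inH (X i)) -> C_lLip phi ->
    inH (fun w => phi (\col_i X i w));
  E_monotone : forall X Y, inH X -> inH Y -> (forall w, Y w <= X w) -> E Y <= E X;
  E_const : forall c : R, E (fun=> c) = c;
  E_subadd : forall X Y, inH X -> inH Y -> E (fun w => X w + Y w) <= E X + E Y;
  E_poshom : forall (lambda : R) X, 0 <= lambda -> inH X ->
    E (fun w => lambda * X w) = lambda * E X }.

Section RandomVectors.
Variable R : realType.
Implicit Types S : sublin_space R.

Definition random_vector S k (X : Omega S -> 'cV[R]_k) : Prop :=
  forall i, inH (fun w => X w i 0).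

Definition same_dist S1 S2 k
    (X1 : Omega S1 -> 'cV[R]_k) (X2 : Omega S2 -> 'cV[R]_k) : Prop :=
  forall phi : 'cV[R]_k -> R, C_lLip phi ->
    E (fun w => phi (X1 w)) = E (fun w => phi (X2 w)).

(* [Y] is independent from [X]; the notion is not symmetric. *)
Definition independent_from S k l
    (Y : Omega S -> 'cV[R]_l) (X : Omega S -> 'cV[R]_k) : Prop :=
  forall phi : 'cV[R]_(k + l) -> R, C_lLip phi ->
    E (fun w => phi (col_mx (X w) (Y w))) =
    E (fun w => E (fun w' => phi (col_mx (X w) (Y w')))).

Definition independent_copy S k (Xbar X : Omega S -> 'cV[R]_k) : Prop :=
  [/\ random_vector Xbar, same_dist Xbar X & independent_from Xbar X].

(* [S'] is a larger space than [S]: random variables on [S] become random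
   variables on [S'], with the same expectation, by composition with [p]. *)
Definition extension S S' (p : Omega S' -> Omega S) : Prop :=
  forall X : Omega S -> R, inH X ->
    inH (fun w => X (p w)) /\ E (fun w => X (p w)) = E X.

(* The independent copy may live on an extension of [S]; the law of the pair
   [(X, Xbar)] depends neither on the extension nor on the copy. *)
Definition G_normal S k (X : Omega S -> 'cV[R]_k) : Prop :=
  random_vector X /\
  exists (S' : sublin_space R) (p : Omega S' -> Omega S)
         (Xbar : Omega S' -> 'cV[R]_k),
    let X' := fun w => X (p w) in
    [/\ extension p, independent_copy Xbar X'
      & forall a b : R, 0 <= a -> 0 <= b ->
          same_dist (fun w => a *: X' w + b *: Xbar w)
                    (fun w => Num.sqrt (a ^+ 2 + b ^+ 2) *: X w)].

End RandomVectors.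

(* The dimension nm, in the form the library uses for n blocks of size m. *)
Notation blockdim n m := (\sum_(i < n) m)%N.

Section Blocks.
Variables (R : realType) (n m : nat).

(* Block matrix (Q 0; 0 0), with one additional block row and block column. *)
Definition pad_block (Q : 'M[R]_(blockdim n m)) : 'M[R]_(blockdim n.+1 m) :=
  @mxblock _ n.+1 n.+1 (fun=> m) (fun=> m) (fun i j =>
    match unlift ord_max i, unlift ord_max j with
    | Some i', Some j' => @submxblock _ n n (fun=> m) (fun=> m) Q i' j'
    | _, _ => 0
    end).

(* The (i, j) block of [perm_block s Q] is the (s i, s j) block of [Q]. *)
Definition perm_block (s : 'S_n) (Q : 'M[R]_(blockdim n m)) :
    'M[R]_(blockdim n m) :=
  @mxblock _ n n (fun=> m) (fun=> m) (fun i j =>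
    @submxblock _ n n (fun=> m) (fun=> m) Q (s i) (s j)).

End Blocks.

Section RandomFields.
Variables (R : realType) (Gamma : Type) (m : nat).
Implicit Types S : sublin_space R.

(* A tuple of n pairwise distinct indices is an injective map from ['I_n]. *)
Definition field_vector S (W : Gamma -> Omega S -> 'cV[R]_m) n
    (g : 'I_n -> Gamma) (w : Omega S) : 'cV[R]_(blockdim n m) :=
  @mxcol _ n (fun=> m) 1 (fun i => W (g i) w).

Definition random_field S (W : Gamma -> Omega S -> 'cV[R]_m) : Prop :=
  forall c, random_vector (W c).

Definition G_gaussian_field S (W : Gamma -> Omega S -> 'cV[R]_m) : Prop :=
  random_field W /\
  forall n (g : 'I_n -> Gamma), injective g -> G_normal (field_vector W g).

Definition has_generators S (W : Gamma -> Omega S -> 'cV[R]_m)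
    (G : forall n, ('I_n -> Gamma) -> 'M[R]_(blockdim n m) -> R) : Prop :=
  forall n (g : 'I_n -> Gamma), injective g ->
  forall Q : 'M[R]_(blockdim n m), Q \is symmetricmx ->
    2^-1 * E (fun w => dotv (Q *m field_vector W g w) (field_vector W g w)) =
    G n g Q.

Definition same_field_dist S1 S2 (W1 : Gamma -> Omega S1 -> 'cV[R]_m)
    (W2 : Gamma -> Omega S2 -> 'cV[R]_m) : Prop :=
  forall n (g : 'I_n -> Gamma), injective g ->
    same_dist (field_vector W1 g) (field_vector W2 g).

End RandomFields.

(* Main.v *)
Require Import Defs.
From HB Require Import structures.
From mathcomp Require Import all_boot all_order all_algebra all_fingroup.
From mathcomp Require Import sesquilinear.
From mathcomp Require Import reals.
From mathcomp Require Import boolp classical_sets topology normedtype.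
From mathcomp Require Import sequences exp.
From mathcomp Require Import ring lra.

Set Implicit Arguments.
Unset Strict Implicit.
Unset Printing Implicit Defensive.

Import Order.TTheory GRing.Theory Num.Theory numFieldNormedType.Exports.
Local Open Scope ring_scope.

(** The proof replaces random vectors by their laws: sublinear functionals [L] on
[C_lLip], where [L phi] stands for [E (phi X)]. A vector is G-normal exactly
when its law is [stable], that is,
[L (x |-> L (y |-> phi (a x + b y))) = L (x |-> phi (sqrt (a^2 + b^2) x))].

The core is a comparison of random walks, [walk_comparison]. Two centred laws
which agree on quadratic forms and have finite third moments lead to walks of
[n] steps, of size [1 / sqrt n], whose expectations of a Lipschitz function
differ by an error that tends to 0 and depends only on the Lipschitz constant
and on the third moments. Lindeberg's argument needs test functions with
bounded third-order Taylor remainders. The expectations [u] after [j] steps are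
only Lipschitz, but they can be mollified: since [L] is sublinear, Jensen's
inequality gives [L (A u) <= A (L u)] for every average [A] over translations
([averaging], [mollifier]), and this one-sided estimate is the one that is
needed; exchanging the two laws gives the other half.

Uniqueness ([stable_unique]): for a stable law, [n] steps of size [1 / sqrt n]
have the law of a single step of size 1, so two stable laws which agree on
quadratic forms agree on Lipschitz functions, hence, by truncation
([C_lLip_approx]), on [C_lLip].

Existence ([stable_law_exists]): a law with bounded support and
[L <Q x, x> = 2 G Q] is the cheapest superhedging price [hedge_law], where
linear claims are free and the claim [<Q x, x> / 2] costs [G Q]. As [n m] steps
of it are [n] steps of the law of [m] steps, comparison shows that its walks
form a Cauchy sequence ([walk_lip_cauchy]). The limit [lim_law] is stable:
at rational times this is read off the walk, and real times follow by
continuity.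

The field: compatibility and symmetry give consistency of the functions [G] under
the selection of subfamilies ([cov_consistent]), and uniqueness turns it into
consistency of the stable laws ([tuple_law_sel]). The expectation is then well
defined on the cylinder functions over [Gamma -> R^m] ([chart_space]). The same
construction, applied to the product with one more vector, provides the
independent copies ([chart_G_normal]). Uniqueness of the field in law is once
more [stable_unique]. *)

(** * Euclidean geometry of column vectors *)

Section Euclid.
Variables (R : realType) (k : nat).
Implicit Types (x y z : 'cV[R]_k) (a : R).

Lemma dotvC x y : dotv x y = dotv y x.
Proof. by apply: eq_bigr => i _; rewrite mulrC. Qed.

Lemma dotvDl x y z : dotv (x + y) z = dotv x z + dotv y z.
Proof. by rewrite -big_split; apply: eq_bigr => i _; rewrite !mxE mulrDl. Qed.

Lemma dotvDr x y z : dotv x (y + z) = dotv x y + dotv x z.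
Proof. by rewrite dotvC dotvDl !(dotvC x). Qed.

Lemma dotvZl a x y : dotv (a *: x) y = a * dotv x y.
Proof. by rewrite mulr_sumr; apply: eq_bigr => i _; rewrite !mxE mulrA. Qed.

Lemma dotvZr a x y : dotv x (a *: y) = a * dotv x y.
Proof. by rewrite dotvC dotvZl dotvC. Qed.

Lemma dotvNl x y : dotv (- x) y = - dotv x y.
Proof. by rewrite -scaleN1r dotvZl mulN1r. Qed.

Lemma dotvNr x y : dotv x (- y) = - dotv x y.
Proof. by rewrite dotvC dotvNl dotvC. Qed.

Lemma dotv0l y : dotv 0 y = 0.
Proof. by rewrite -(scale0r 0) dotvZl mul0r. Qed.

Lemma dotv0r y : dotv y 0 = 0.
Proof. by rewrite dotvC dotv0l. Qed.

Lemma dotv_ge0 x : 0 <= dotv x x.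
Proof. by apply: sumr_ge0 => i _; rewrite -expr2 sqr_ge0. Qed.

Lemma enorm_ge0 x : 0 <= enorm x.
Proof. exact: sqrtr_ge0. Qed.

Lemma sqr_enorm x : enorm x ^+ 2 = dotv x x.
Proof. by rewrite sqr_sqrtr // dotv_ge0. Qed.

Lemma enorm0 : enorm (0 : 'cV[R]_k) = 0.
Proof. by rewrite /enorm dotv0l sqrtr0. Qed.

Lemma enormZ a x : enorm (a *: x) = `|a| * enorm x.
Proof.
by rewrite /enorm dotvZl dotvZr mulrA -expr2 sqrtrM ?sqr_ge0 // sqrtr_sqr.
Qed.

Lemma enormN x : enorm (- x) = enorm x.
Proof. by rewrite -scaleN1r enormZ normrN1 mul1r. Qed.

Lemma enormC x y : enorm (x - y) = enorm (y - x).
Proof. by rewrite -enormN opprB. Qed.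

Lemma dotv_eq0 x : dotv x x = 0 -> x = 0.
Proof.
move=> /eqP; rewrite psumr_eq0 => [|i _]; last by rewrite -expr2 sqr_ge0.
move=> /allP x0; apply/matrixP => i j; rewrite ord1 mxE; apply/eqP.
by have := x0 i (mem_index_enum _); rewrite mulf_eq0 orbb.
Qed.

Lemma cauchy_schwarz x y : `|dotv x y| <= enorm x * enorm y.
Proof.
rewrite -(ler_pXn2r (n := 2)) ?nnegrE ?mulr_ge0 ?enorm_ge0 //.
rewrite -normrX ger0_norm ?sqr_ge0 // exprMn !sqr_enorm.
have [y0|y_neq0] := eqVneq (dotv y y) 0.
  by rewrite (dotv_eq0 y0) !dotv0r expr0n mulr0.
have y_gt0 : 0 < dotv y y by rewrite lt_def y_neq0 dotv_ge0.
(* the squared norm of the component of x orthogonal to y is nonnegative *)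
have := dotv_ge0 (dotv y y *: x - dotv x y *: y).
rewrite !(dotvDl, dotvDr, dotvZl, dotvZr, dotvNl, dotvNr) (dotvC y x) => H.
have : 0 <= dotv y y * (dotv x x * dotv y y - dotv x y ^+ 2) by nra.
by rewrite pmulr_rge0 // subr_ge0.
Qed.

Lemma enormD x y : enorm (x + y) <= enorm x + enorm y.
Proof.
rewrite -(ler_pXn2r (n := 2)) ?nnegrE ?addr_ge0 ?enorm_ge0 //.
rewrite sqrrD !sqr_enorm dotvDl !dotvDr (dotvC y x).
have := le_trans (ler_norm _) (cauchy_schwarz x y); lra.
Qed.

Lemma enorm_sum (I : Type) (r : seq I) (F : I -> 'cV[R]_k) :
  enorm (\sum_(i <- r) F i) <= \sum_(i <- r) enorm (F i).
Proof.
elim/big_rec2: _ => [|i a x _ le_xa]; first by rewrite enorm0.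
by apply: le_trans (enormD _ _) _; rewrite lerD2l.
Qed.

Lemma ler_dist_enorm x y : `|enorm x - enorm y| <= enorm (x - y).
Proof.
have le_sub (u v : 'cV[R]_k) : enorm u - enorm v <= enorm (u - v).
  by rewrite lerBlDr; have := enormD (u - v) v; rewrite subrK.
by rewrite ler_norml le_sub andbT -lerN2 opprB opprK enormC le_sub.
Qed.

Lemma coord_le_enorm x i : `|x i 0| <= enorm x.
Proof.
rewrite -sqrtr_sqr ler_sqrt ?dotv_ge0 // /dotv (bigD1 i) //= -expr2 lerDl.
by apply: sumr_ge0 => j _; rewrite -expr2 sqr_ge0.
Qed.

Lemma enorm_delta (i : 'I_k) : enorm (delta_mx i 0 : 'cV[R]_k) = 1.
Proof.
rewrite /enorm /dotv (bigD1 i) //= big1 => [|j /negPf neq_ji].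
  by rewrite !mxE !eqxx mulr1 addr0 sqrtr1.
by rewrite !mxE neq_ji mul0r.
Qed.

Lemma vec_sum_delta x : x = \sum_i x i 0 *: delta_mx i 0.
Proof. by rewrite [LHS]matrix_sum_delta; apply: eq_bigr => i _; rewrite big_ord1. Qed.

Lemma enorm_le_sum x : enorm x <= \sum_i `|x i 0|.
Proof.
rewrite {1}[x]vec_sum_delta; apply: le_trans (enorm_sum _ _) _.
by apply: ler_sum => i _; rewrite enormZ enorm_delta mulr1.
Qed.

Lemma dotv_mulmx (Q : 'M[R]_k) x : dotv (Q *m x) x = \sum_i \sum_j Q i j * (x j 0 * x i 0).
Proof.
by apply: eq_bigr => i _; rewrite !mxE mulr_suml; apply: eq_bigr => j _; rewrite mulrA.
Qed.

End Euclid.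

Lemma dotv_trmx (R : realType) k l (B : 'M[R]_(l, k)) (x : 'cV[R]_k) (y : 'cV[R]_l) :
  dotv (B *m x) y = dotv x (B^T *m y).
Proof.
have dotE n (u v : 'cV[R]_n) : dotv u v = (u^T *m v) 0 0.
  by rewrite mxE; apply: eq_bigr => i _; rewrite !mxE.
by rewrite !dotE trmx_mul mulmxA.
Qed.

Lemma enorm_mulmx (R : realType) k l (B : 'M[R]_(l, k)) :
  exists2 C : R, 0 <= C & forall x, enorm (B *m x) <= C * enorm x.
Proof.
exists (\sum_i \sum_j `|B i j|) => [|x].
  by apply: sumr_ge0 => i _; apply: sumr_ge0.
apply: le_trans (enorm_le_sum _) _; rewrite mulr_suml; apply: ler_sum => i _.
rewrite mxE mulr_suml; apply: le_trans (ler_norm_sum _ _ _) _.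
by apply: ler_sum => j _; rewrite normrM ler_wpM2l // coord_le_enorm.
Qed.

Lemma sqr_enorm_col (R : realType) k l (x : 'cV[R]_k) (y : 'cV[R]_l) :
  enorm (col_mx x y) ^+ 2 = enorm x ^+ 2 + enorm y ^+ 2.
Proof.
rewrite !sqr_enorm /dotv big_split_ord /=.
by congr (_ + _); apply: eq_bigr => i _; rewrite ?col_mxEu ?col_mxEd.
Qed.

Lemma enorm_col0 (R : realType) k l (x : 'cV[R]_k) :
  enorm (col_mx x (0 : 'cV[R]_l)) = enorm x.
Proof.
apply/eqP; rewrite -(eqrXn2 (n := 2)) ?enorm_ge0 //.
by rewrite sqr_enorm_col enorm0 expr0n addr0.
Qed.

Lemma enorm_0col (R : realType) k l (y : 'cV[R]_l) :
  enorm (col_mx (0 : 'cV[R]_k) y) = enorm y.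
Proof.
apply/eqP; rewrite -(eqrXn2 (n := 2)) ?enorm_ge0 //.
by rewrite sqr_enorm_col enorm0 expr0n add0r.
Qed.

Lemma enorm_col_le (R : realType) k l (x : 'cV[R]_k) (y : 'cV[R]_l) :
  enorm (col_mx x y) <= enorm x + enorm y.
Proof.
have -> : col_mx x y = col_mx x 0 + col_mx 0 y by rewrite add_col_mx addr0 add0r.
by apply: le_trans (enormD _ _) _; rewrite enorm_col0 enorm_0col.
Qed.

(** * Locally Lipschitz functions of polynomial growth *)

Section Weights.
Variable R : realType.
Implicit Types s t a b c : R.

Lemma weight_mono s t p q : 1 <= s -> s <= t -> (p <= q)%N -> s ^+ p <= t ^+ q.
Proof.
move=> s_ge1 le_st le_pq; apply: le_trans (_ : t ^+ p <= _).
  by apply: lerXn2r; rewrite ?nnegrE; lra.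
by apply: ler_weXn2l => //; lra.
Qed.

Lemma weight_ge1 s q : 1 <= s -> 1 <= s ^+ q.
Proof. exact: exprn_ege1. Qed.

End Weights.

Section PolyLip.
Variable R : realType.

(** The local Lipschitz condition of [C_lLip] for vector-valued maps. The powers
of the weight [1 + |x| + |y| >= 1] increase with the exponent and multiply,
which makes them easier to compose than the sums [1 + |x|^q + |y|^q]. *)
Definition poly_lip k l (F : 'cV[R]_k -> 'cV[R]_l) : Prop :=
  exists (C : R) (q : nat), 0 <= C /\ forall x y,
    enorm (F x - F y) <= C * (1 + enorm x + enorm y) ^+ q * enorm (x - y).

Lemma C_lLipP k (phi : 'cV[R]_k -> R) :
  C_lLip phi <-> exists (C : R) (q : nat), 0 <= C /\ forall x y,
    `|phi x - phi y| <= C * (1 + enorm x + enorm y) ^+ q * enorm (x - y).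
Proof.
split=> -[C [q [C_pos phiP]]].
  exists (C * 3), q; split=> [|x y]; first by rewrite mulr_ge0 // ltW.
  apply: le_trans (phiP x y) _; rewrite ler_wpM2r ?enorm_ge0 //.
  rewrite -mulrA ler_wpM2l ?(ltW C_pos) //.
  have [x0 y0] := (enorm_ge0 x, enorm_ge0 y).
  have W1 : 1 <= (1 + enorm x + enorm y) ^+ q by apply: weight_ge1; lra.
  have : enorm x ^+ q <= (1 + enorm x + enorm y) ^+ q.
    by rewrite lerXn2r ?nnegrE //; lra.
  have : enorm y ^+ q <= (1 + enorm x + enorm y) ^+ q.
    by rewrite lerXn2r ?nnegrE //; lra.
  lra.
exists (C * 3 ^+ q + 1), q; split=> [|x y].
  by rewrite ltr_wpDl // mulr_ge0 // exprn_ge0.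
apply: le_trans (phiP x y) _; rewrite ler_wpM2r ?enorm_ge0 //.
have := enorm_ge0 x; have := enorm_ge0 y.
move: (enorm x) (enorm y) => s t t0 s0.
have sq0 : 0 <= s ^+ q by apply: exprn_ge0.
have tq0 : 0 <= t ^+ q by apply: exprn_ge0.
have bnd u : 0 <= u -> 1 + s + t <= 3 * u -> u ^+ q <= 1 + s ^+ q + t ^+ q ->
    C * (1 + s + t) ^+ q <= (C * 3 ^+ q + 1) * (1 + s ^+ q + t ^+ q).
  move=> u0 le_u le_uq; apply: le_trans (_ : C * (3 ^+ q * u ^+ q) <= _).
    by rewrite ler_wpM2l // -exprMn lerXn2r ?nnegrE //; lra.
  have : 0 <= C * 3 ^+ q by rewrite mulr_ge0 // exprn_ge0.
  rewrite mulrA; move: (C * 3 ^+ q) => D D0; nra.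
have [le_1s|/ltW le_s1] := lerP 1 s; have [le_st|/ltW le_ts] := lerP s t.
- by apply: (bnd t); lra.
- by apply: (bnd s); lra.
- have [le_1t|/ltW le_t1] := lerP 1 t; first by apply: (bnd t); lra.
  by apply: (bnd 1) => //; rewrite ?expr1n; lra.
- by apply: (bnd 1) => //; rewrite ?expr1n; lra.
Qed.

Lemma poly_lip_growth k l (F : 'cV[R]_k -> 'cV[R]_l) :
  poly_lip F -> exists (C : R) (q : nat), 0 <= C /\
    forall x, enorm (F x) <= C * (1 + enorm x) ^+ q.
Proof.
move=> [C [q [C0 FP]]]; exists (enorm (F 0) + C), q.+1.
split=> [|x]; first by rewrite addr_ge0 ?enorm_ge0.
have := FP x 0; rewrite enorm0 addr0 subr0 => FxP.
have F0 := enorm_ge0 (F 0).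
have := enormD (F x - F 0) (F 0); rewrite subrK => H.
have x0 := enorm_ge0 x.
have W1 : 1 <= (1 + enorm x) ^+ q by apply: weight_ge1; lra.
have CW : 0 <= C * (1 + enorm x) ^+ q by rewrite mulr_ge0 //; lra.
rewrite exprSr; move: (_ ^+ q) W1 CW FxP => W W1 CW FxP.
have : 0 <= W * enorm x by rewrite mulr_ge0 //; lra.
nra.
Qed.

Lemma C_lLip_growth k (phi : 'cV[R]_k -> R) :
  C_lLip phi -> exists (C : R) (q : nat), 0 <= C /\
    forall x, `|phi x| <= C * (1 + enorm x) ^+ q.
Proof.
move=> /C_lLipP [C [q [C0 phiP]]]; exists (`|phi 0| + C), q.+1.
split=> [|x]; first by rewrite addr_ge0.
have := phiP x 0; rewrite enorm0 addr0 subr0 => FxP.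
have F0 : 0 <= `|phi 0| by [].
have := ler_normD (phi x - phi 0) (phi 0); rewrite subrK => H.
have x0 := enorm_ge0 x.
have W1 : 1 <= (1 + enorm x) ^+ q by apply: weight_ge1; lra.
have CW : 0 <= C * (1 + enorm x) ^+ q by rewrite mulr_ge0 //; lra.
rewrite exprSr; move: (_ ^+ q) W1 CW FxP => W W1 CW FxP.
have : 0 <= W * enorm x by rewrite mulr_ge0 //; lra.
nra.
Qed.

Lemma C_lLip_comp k l (phi : 'cV[R]_l -> R) (F : 'cV[R]_k -> 'cV[R]_l) :
  C_lLip phi -> poly_lip F -> C_lLip (fun x => phi (F x)).
Proof.
move=> /C_lLipP [C [q [C0 phiP]]] FL; have [D [p [D0 FG]]] := poly_lip_growth FL.
case: FL => B [r [B0 FP]]; apply/C_lLipP.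
exists (C * (1 + D + D) ^+ q * B), (p * q + r)%N; split=> [|x y].
  by rewrite !mulr_ge0 // exprn_ge0; lra.
apply: le_trans (phiP _ _) _.
set W := 1 + enorm x + enorm y.
have [x0 y0] := (enorm_ge0 x, enorm_ge0 y).
have W1 : 1 <= W by rewrite /W; lra.
have Wp1 : 1 <= W ^+ p by apply: weight_ge1.
have Fle z : 1 + enorm z <= W -> enorm (F z) <= D * W ^+ p.
  move=> le_zW; apply: le_trans (FG z) _; rewrite ler_wpM2l //.
  by apply: weight_mono => //; have := enorm_ge0 z; lra.
have le1 : (1 + enorm (F x) + enorm (F y)) ^+ q <= (1 + D + D) ^+ q * W ^+ (p * q).
  rewrite exprM -exprMn lerXn2r ?nnegrE //.
  - by have [] := (enorm_ge0 (F x), enorm_ge0 (F y)); lra.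
  - by rewrite mulr_ge0; lra.
  have := Fle x; have := Fle y; rewrite /W => Fy Fx.
  by have := Fx ltac:(lra); have := Fy ltac:(lra); rewrite -/W; nra.
rewrite exprD.
apply: le_trans (_ : C * ((1 + D + D) ^+ q * W ^+ (p * q)) * (B * W ^+ r * enorm (x - y)) <= _).
  apply: ler_pM; rewrite ?enorm_ge0 ?mulr_ge0 ?exprn_ge0 //.
    by rewrite !addr_ge0 ?enorm_ge0.
  by rewrite ler_wpM2l.
by rewrite le_eqVlt; apply/orP; left; apply/eqP; ring.
Qed.

Lemma poly_lip_col k l (F : 'I_l -> 'cV[R]_k -> R) :
  (forall i, C_lLip (F i)) -> poly_lip (fun x => \col_i F i x).
Proof.
move=> FL.
have /choice[C /choice[q FP]] i := (C_lLipP _).1 (FL i).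
have C0 i : 0 <= C i by case: (FP i).
exists (\sum_i C i), (\sum_i q i)%N; split=> [|x y]; first exact: sumr_ge0.
apply: le_trans (enorm_le_sum _) _; rewrite !mulr_suml; apply: ler_sum => i _.
rewrite !mxE; apply: le_trans ((FP i).2 x y) _.
rewrite ler_wpM2r ?enorm_ge0 // ler_wpM2l //.
have [x0 y0] := (enorm_ge0 x, enorm_ge0 y).
apply: weight_mono; [lra|by []|].
by rewrite (bigD1 i) //= leq_addr.
Qed.

Lemma poly_lip_linear k l (B : 'M[R]_(l, k)) (b : 'cV[R]_l) :
  poly_lip (fun x => b + B *m x).
Proof.
have [C C0 BP] := enorm_mulmx B; exists C, 0%N; split=> // x y.
by rewrite expr0 mulr1 opprD addrACA subrr add0r -mulmxBr.
Qed.

Lemma C_lLip_linear k l (phi : 'cV[R]_l -> R) (B : 'M[R]_(l, k)) :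
  C_lLip phi -> C_lLip (fun x => phi (B *m x)).
Proof.
move=> phiL; have := C_lLip_comp phiL (poly_lip_linear B 0).
by congr C_lLip; apply/funext => x; rewrite add0r.
Qed.

Lemma C_lLip_affine k (phi : 'cV[R]_k -> R) (x : 'cV[R]_k) (a : R) :
  C_lLip phi -> C_lLip (fun y => phi (x + a *: y)).
Proof.
move=> phiL; have := C_lLip_comp phiL (poly_lip_linear a%:M x).
by congr C_lLip; apply/funext => y; rewrite mul_scalar_mx.
Qed.

Lemma C_lLip_translate k (phi : 'cV[R]_k -> R) (z : 'cV[R]_k) :
  C_lLip phi -> C_lLip (fun y => phi (y + z)).
Proof.
move=> phiL; have := C_lLip_affine z 1 phiL.
by congr C_lLip; apply/funext => y; rewrite scale1r addrC.
Qed.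

Section Algebra.
Variable k : nat.
Implicit Types (f g : 'cV[R]_k -> R).

Definition lip (Lam : R) f : Prop := forall x y, `|f x - f y| <= Lam * enorm (x - y).

Lemma lip_lLip (Lam : R) f : 0 <= Lam -> lip Lam f -> C_lLip f.
Proof.
move=> Lam0 fL; apply/C_lLipP; exists Lam, 0%N; split=> // x y.
by rewrite expr0 mulr1.
Qed.

Lemma C_lLip_const c : C_lLip (fun _ : 'cV[R]_k => c).
Proof.
by apply: (@lip_lLip 0) => // x y; rewrite subrr normr0 mul0r.
Qed.

Lemma C_lLipM f g : C_lLip f -> C_lLip g -> C_lLip (fun x => f x * g x).
Proof.
move=> fL gL; have [D [p [D0 fG]]] := C_lLip_growth fL.
have [D' [p' [D'0 gG]]] := C_lLip_growth gL.
move: fL gL => /C_lLipP[C [q [C0 fP]]] /C_lLipP[C' [q' [C'0 gP]]].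
apply/C_lLipP; exists (D * C' + D' * C), (p + q' + (p' + q))%N.
split=> [|x y]; first by rewrite addr_ge0 // mulr_ge0.
have -> : f x * g x - f y * g y = f x * (g x - g y) + g y * (f x - f y) by ring.
apply: le_trans (ler_normD _ _) _; rewrite !normrM !mulrDl.
have [x0 y0] := (enorm_ge0 x, enorm_ge0 y).
set W := 1 + enorm x + enorm y.
have W1 : 1 <= W by rewrite /W; lra.
have term (A B a b n m : R) (i j l : nat) : 0 <= A -> 0 <= B ->
    0 <= a -> 0 <= b -> a <= A * W ^+ i -> b <= B * W ^+ j * n -> 0 <= n ->
    (i + j <= l)%N -> a * b <= A * B * W ^+ l * n.
  move=> A0 B0 a0 b0 le_a le_b n0 le_l; apply: le_trans (ler_pM a0 b0 le_a le_b) _.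
  have -> : A * W ^+ i * (B * W ^+ j * n) = A * B * W ^+ (i + j) * n.
    by rewrite exprD; ring.
  by rewrite ler_wpM2r // ler_wpM2l ?mulr_ge0 //; apply: weight_mono.
apply: lerD.
- apply: (term _ _ _ _ _ 0 p q'); rewrite ?enorm_ge0 // ?leq_addr //.
  apply: le_trans (fG x) _; rewrite ler_wpM2l //.
  by apply: weight_mono; rewrite /W //; lra.
- apply: (term _ _ _ _ _ 0 p' q); rewrite ?enorm_ge0 // ?leq_addl //.
  apply: le_trans (gG y) _; rewrite ler_wpM2l //.
  by apply: weight_mono; rewrite /W //; lra.
Qed.

Lemma C_lLipD f g : C_lLip f -> C_lLip g -> C_lLip (fun x => f x + g x).
Proof.
move=> /C_lLipP[C [q [C0 fP]]] /C_lLipP[C' [q' [C'0 gP]]].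
apply/C_lLipP; exists (C + C'), (q + q')%N; split=> [|x y]; first exact: addr_ge0.
rewrite opprD addrACA; apply: le_trans (ler_normD _ _) _; rewrite !mulrDl.
have [x0 y0] := (enorm_ge0 x, enorm_ge0 y).
apply: lerD; [apply: le_trans (fP x y) _|apply: le_trans (gP x y) _];
  rewrite ler_wpM2r ?enorm_ge0 // ler_wpM2l //; apply: weight_mono => //;
  by rewrite ?leq_addr ?leq_addl //; lra.
Qed.

Lemma C_lLipZ (a : R) f : C_lLip f -> C_lLip (fun x => a * f x).
Proof. exact/C_lLipM/C_lLip_const. Qed.

Lemma C_lLipN f : C_lLip f -> C_lLip (fun x => - f x).
Proof.
by move=> /(C_lLipZ (-1)); congr C_lLip; apply/funext => x; rewrite mulN1r.
Qed.

Lemma C_lLipB f g : C_lLip f -> C_lLip g -> C_lLip (fun x => f x - g x).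
Proof. by move=> fL /C_lLipN; exact: C_lLipD. Qed.

Lemma C_lLip_sum (I : Type) (r : seq I) (F : I -> 'cV[R]_k -> R) :
  (forall i, C_lLip (F i)) -> C_lLip (fun x => \sum_(i <- r) F i x).
Proof.
move=> FL; elim: r => [|i r IHr].
  by have := C_lLip_const 0; congr C_lLip; apply/funext => x; rewrite big_nil.
have := C_lLipD (FL i) IHr.
by congr C_lLip; apply/funext => x; rewrite big_cons.
Qed.

Lemma C_lLipX f q : C_lLip f -> C_lLip (fun x => f x ^+ q).
Proof.
move=> fL; elim: q => [|q IHq]; first exact: C_lLip_const.
have := C_lLipM fL IHq.
by congr C_lLip; apply/funext => x; rewrite exprS.
Qed.

Lemma C_lLip_dotv (p : 'cV[R]_k) : C_lLip (dotv p).
Proof.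
apply: (lip_lLip (enorm_ge0 p)) => x y.
by rewrite -dotvNr -dotvDr cauchy_schwarz.
Qed.

Lemma C_lLip_enorm : C_lLip (@enorm R k).
Proof.
by apply: (@lip_lLip 1) => // x y; rewrite mul1r ler_dist_enorm.
Qed.

Lemma C_lLip_coord (i : 'I_k) : C_lLip (fun x : 'cV[R]_k => x i 0).
Proof.
apply: (@lip_lLip 1) => // x y; rewrite mul1r.
by have := coord_le_enorm (x - y) i; rewrite !mxE.
Qed.

Lemma C_lLip_quad (Q : 'M[R]_k) : C_lLip (fun x => dotv (Q *m x) x).
Proof.
have := @C_lLip_sum _ (index_enum 'I_k) (fun i x => \sum_j Q i j * (x j 0 * x i 0)).
rewrite (_ : (fun x => _) = fun x => dotv (Q *m x) x); last first.
  by apply/funext => x; rewrite dotv_mulmx.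
apply=> i; apply: C_lLip_sum => j; apply: C_lLipZ.
by apply: C_lLipM; apply: C_lLip_coord.
Qed.

(** The test functions [(1 + |x|^2)^q] through which all moments are
controlled; unlike [|x|^q] they are smooth. *)
Definition moment_fun q (x : 'cV[R]_k) : R := (1 + enorm x ^+ 2) ^+ q.

Lemma C_lLip_moment q : C_lLip (moment_fun q).
Proof.
by apply/C_lLipX/C_lLipD; [exact: C_lLip_const|exact/C_lLipX/C_lLip_enorm].
Qed.

Lemma moment_ge1 q x : 1 <= moment_fun q x.
Proof. by apply: weight_ge1; rewrite lerDl sqr_ge0. Qed.

Lemma weight_le_moment q x : (1 + enorm x) ^+ q <= 2 ^+ q * moment_fun q x.
Proof.
rewrite -exprMn; have x0 := enorm_ge0 x.
by rewrite lerXn2r ?nnegrE; nra.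
Qed.

End Algebra.
End PolyLip.

#[global] Hint Resolve C_lLip_const C_lLip_dotv C_lLip_enorm C_lLip_quad
  C_lLip_moment C_lLip_coord : core.

(** * Sublinear laws on Euclidean space *)

Section Laws.
Variable R : realType.

(** The distribution of a [k]-dimensional random vector [X], as the functional
[phi |-> E (phi X)] on [C_lLip]. *)
Definition sublin_law k (L : ('cV[R]_k -> R) -> R) : Prop :=
  [/\ forall f g, C_lLip f -> C_lLip g -> (forall x, f x <= g x) -> L f <= L g,
      forall c, L (fun=> c) = c,
      forall f g, C_lLip f -> C_lLip g -> L (fun x => f x + g x) <= L f + L g
    & forall a f, 0 <= a -> C_lLip f -> L (fun x => a * f x) = a * L f].

Section LawTheory.
Variables (k : nat) (L : ('cV[R]_k -> R) -> R).
Hypothesis L_law : sublin_law L.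
Implicit Types (f g h : 'cV[R]_k -> R).

Lemma law_le f g : C_lLip f -> C_lLip g -> (forall x, f x <= g x) -> L f <= L g.
Proof. by case: L_law => + _ _ _; apply. Qed.

Lemma law_const c : L (fun=> c) = c.
Proof. by case: L_law => _ + _ _; apply. Qed.

Lemma law_subadd f g : C_lLip f -> C_lLip g -> L (fun x => f x + g x) <= L f + L g.
Proof. by case: L_law => _ _ + _; apply. Qed.

Lemma law_poshom a f : 0 <= a -> C_lLip f -> L (fun x => a * f x) = a * L f.
Proof. by case: L_law => _ _ _; apply. Qed.

Lemma law_ge0 f : C_lLip f -> (forall x, 0 <= f x) -> 0 <= L f.
Proof. by move=> fL f0; rewrite -[leLHS](law_const 0); apply: law_le. Qed.

Lemma law_leB f g : C_lLip f -> C_lLip g -> L f <= L g + L (fun x => f x - g x).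
Proof.
move=> fL gL; have := law_subadd gL (C_lLipB fL gL).
by congr (_ <= _); congr L; apply/funext => x; rewrite addrC subrK.
Qed.

Lemma law_dist f g h : C_lLip f -> C_lLip g -> C_lLip h ->
  (forall x, `|f x - g x| <= h x) -> `|L f - L g| <= L h.
Proof.
move=> fL gL hL fgh.
have half u v : C_lLip u -> C_lLip v -> (forall x, `|u x - v x| <= h x) ->
    L u - L v <= L h.
  move=> uL vL uvh; rewrite lerBlDl; apply: le_trans (law_leB uL vL) _.
  rewrite lerD2l; apply: law_le => // [|x]; first exact: C_lLipB.
  exact: le_trans (ler_norm _) (uvh x).
rewrite ler_norml half // andbT -lerN2 opprK opprB half // => x.
by rewrite distrC.
Qed.

(** A summand without mean uncertainty and with mean 0 does not change the
expectation, as for linear expectations. *)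
Lemma law_add_null f h : C_lLip f -> C_lLip h -> L h <= 0 ->
  L (fun x => - h x) <= 0 -> L (fun x => f x + h x) = L f.
Proof.
move=> fL hL h_le hN_le; apply/eqP; rewrite eq_le; apply/andP; split.
  by apply: le_trans (law_subadd fL hL) _; rewrite gerDl.
have -> : L f = L (fun x => (f x + h x) + - h x).
  by congr L; apply/funext => x; rewrite addrK.
apply: le_trans (law_subadd (C_lLipD fL hL) (C_lLipN hL)) _.
by rewrite gerDl.
Qed.

Lemma law_addc f c : C_lLip f -> L (fun x => f x + c) = L f + c.
Proof.
move=> fL; apply/eqP; rewrite eq_le; apply/andP; split.
  by apply: le_trans (law_subadd fL _) _ => //; rewrite law_const.
rewrite -lerBrDr -(law_const (- c)).
have -> : L f = L (fun x => (f x + c) + - c).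
  by congr L; apply/funext => x; rewrite addrK.
by apply: law_subadd; [apply: C_lLipD|].
Qed.

End LawTheory.

Lemma dirac_law k (x : 'cV[R]_k) : sublin_law (fun phi => phi x).
Proof. by split. Qed.

(** Conditioning: [K x] is the law of the second stage of an experiment whose
first stage has the outcome [x]. *)
Lemma law_bind k l (L : ('cV[R]_k -> R) -> R) (K : 'cV[R]_k -> ('cV[R]_l -> R) -> R) :
  sublin_law L -> (forall x, sublin_law (K x)) ->
  (forall phi, C_lLip phi -> C_lLip (K^~ phi)) ->
  sublin_law (fun phi => L (K^~ phi)).
Proof.
move=> LL KL KC; split=> [f g fL gL le_fg|c|f g fL gL|a f a0 fL].
- by apply: (law_le LL); [exact: KC..|move=> x; apply: (law_le (KL x))].
- by under eq_fun => x do rewrite (law_const (KL x)); rewrite (law_const LL).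
- apply: le_trans (law_subadd LL (KC _ fL) (KC _ gL)).
  apply: (law_le LL) => [||x]; last exact: (law_subadd (KL x)).
    exact/KC/C_lLipD.
  by apply: C_lLipD; apply: KC.
- under eq_fun => x do rewrite (law_poshom (KL x)) //.
  by rewrite (law_poshom LL) //; apply: KC.
Qed.

(** The weight of [col_mx x y] and [col_mx x' y] is at most
[(1 + |x| + |x'|) * (1 + 2 |y|)], so that a moment of [L] factors out of the
local Lipschitz constant. *)
Lemma C_lLip_law k l (L : ('cV[R]_l -> R) -> R) (phi : 'cV[R]_(k + l) -> R) :
  sublin_law L -> C_lLip phi -> C_lLip (fun x => L (fun y => phi (col_mx x y))).
Proof.
move=> LL phiL; have [C [q [C0 phiP]]] := (C_lLipP _).1 phiL.
have secL x : C_lLip (fun y => phi (col_mx x y)).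
  have := C_lLip_comp phiL (poly_lip_linear (col_mx 0 1%:M) (col_mx x 0)).
  congr C_lLip; apply/funext => y; congr phi.
  by rewrite mul_col_mx mul0mx mul1mx add_col_mx addr0 add0r.
have wL : C_lLip (fun y : 'cV[R]_l => (1 + 2 * enorm y) ^+ q).
  by apply/C_lLipX/C_lLipD; [exact: C_lLip_const|exact/C_lLipZ/C_lLip_enorm].
apply/C_lLipP; exists (C * L (fun y => (1 + 2 * enorm y) ^+ q)), q; split.
  rewrite mulr_ge0 // (law_ge0 LL) // => y; rewrite exprn_ge0 //.
  by have := enorm_ge0 y; lra.
move=> x x'; set c := C * (1 + enorm x + enorm x') ^+ q * enorm (x - x').
have [x0 x'0] := (enorm_ge0 x, enorm_ge0 x').
have c0 : 0 <= c by rewrite !mulr_ge0 ?exprn_ge0 ?enorm_ge0 //; lra.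
have -> : C * L (fun y => (1 + 2 * enorm y) ^+ q) *
    (1 + enorm x + enorm x') ^+ q * enorm (x - x') =
    L (fun y => c * (1 + 2 * enorm y) ^+ q).
  by rewrite (law_poshom LL) // /c; ring.
apply: (law_dist LL) => // [|y]; first exact: C_lLipZ.
apply: le_trans (phiP _ _) _.
have -> : col_mx x y - col_mx x' y = col_mx (x - x') 0.
  by rewrite opp_col_mx add_col_mx subrr.
rewrite enorm_col0.
have -> : c * (1 + 2 * enorm y) ^+ q =
    C * ((1 + enorm x + enorm x') * (1 + 2 * enorm y)) ^+ q * enorm (x - x').
  by rewrite exprMn /c; ring.
rewrite ler_wpM2r ?enorm_ge0 // ler_wpM2l //.
have y0 := enorm_ge0 y.
rewrite lerXn2r ?nnegrE.
- by [].
- by rewrite !addr_ge0 ?enorm_ge0.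
- by rewrite mulr_ge0; lra.
by have := enorm_col_le x y; have := enorm_col_le x' y; nra.
Qed.

Lemma C_lLip_law_lin k (L : ('cV[R]_k -> R) -> R) (phi : 'cV[R]_k -> R) (a b : R) :
  sublin_law L -> C_lLip phi -> C_lLip (fun x => L (fun y => phi (a *: x + b *: y))).
Proof.
move=> LL phiL.
have := C_lLip_law LL (C_lLip_linear (row_mx a%:M b%:M) phiL).
congr C_lLip; apply/funext => x; congr L; apply/funext => y.
by rewrite mul_row_col !mul_scalar_mx.
Qed.

(** The form in which the error of [C_lLip_approx] enters the value of a law. *)
Lemma law_moment_dist k (L : ('cV[R]_k -> R) -> R) q eta (phi psi : 'cV[R]_k -> R) :
  sublin_law L -> 0 <= eta -> C_lLip phi -> C_lLip psi ->
  (forall x, `|phi x - psi x| <= eta * moment_fun q x) ->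
  `|L phi - L psi| <= eta * L (moment_fun q).
Proof.
move=> LL eta0 phiL psiL dphi; rewrite -(law_poshom LL) //.
by apply: (law_dist LL) => //; apply: C_lLipZ.
Qed.

(** * Truncation *)

Definition clamp (N t : R) : R := Num.max (- N) (Num.min t N).

Lemma clampE N t : 0 <= N ->
  [\/ clamp N t = t /\ `|t| <= N, clamp N t = N /\ N <= t | clamp N t = - N /\ t <= - N].
Proof.
move=> N0; rewrite /clamp; have [le_tN|/ltW le_Nt] := lerP t N.
  have [le_t|/ltW le_t] := lerP (- N) t; first by apply: Or31; rewrite ler_norml le_t.
  exact: Or33.
by have -> : Num.max (- N) N = N; [apply/max_idPr; lra|apply: Or32].
Qed.

Lemma clamp_dist N s t : 0 <= N -> `|clamp N s - clamp N t| <= `|s - t|.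
Proof.
move=> N0; case: (clampE s N0) => -[-> +]; case: (clampE t N0) => -[-> +];
  move=> Ht Hs; rewrite ler_norml;
  have [Hst1 Hst2] := (ler_norm (s - t), lerNnormlW (lexx `|s - t|));
  move: Ht Hs; rewrite ?ler_norml => Ht Hs; apply/andP; split; lra.
Qed.

Lemma clamp_le N t : 0 <= N -> `|clamp N t| <= N.
Proof.
by move=> N0; case: (clampE t N0) => -[-> //]; rewrite ?normrN ger0_norm.
Qed.

Lemma clamp_le_norm N t : 0 <= N -> `|clamp N t| <= `|t|.
Proof.
move=> N0; case: (clampE t N0) => -[-> //] tP; rewrite ?normrN ger0_norm //.
  exact: le_trans tP (ler_norm _).
by rewrite -normrN; apply: le_trans (ler_norm _); lra.
Qed.

Lemma clamp_error N t : 0 < N -> `|t - clamp N t| <= t ^+ 2 / N.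
Proof.
move=> N0; rewrite ler_pdivlMr //.
case: (clampE t (ltW N0)) => -[->] tP; rewrite ?subrr ?normr0 ?mul0r ?sqr_ge0 //.
  by rewrite ger0_norm; nra.
by rewrite ler0_norm; nra.
Qed.

(** Clamping every coordinate to [-N, N] turns a locally Lipschitz function
into a globally Lipschitz one, at a cost of order [1/N] relative to a moment.
Comparisons of laws thus reduce to globally Lipschitz functions, see
[law_le_lip]. *)
Lemma C_lLip_approx k (phi : 'cV[R]_k -> R) : C_lLip phi ->
  exists q, forall eta, 0 < eta -> exists Lam psi,
    [/\ 0 <= Lam, lip Lam psi & forall x, `|phi x - psi x| <= eta * moment_fun q x].
Proof.
move=> /C_lLipP[C [q [C0 phiP]]].
pose S : R := k%:R + 1; have S1 : 1 <= S by rewrite lerDr.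
pose cl N (x : 'cV[R]_k) : 'cV[R]_k := \col_i clamp N (x i 0).
have sum_const (F : 'I_k -> R) c : 0 <= c -> (forall i, F i <= c) -> \sum_i F i <= S * c.
  move=> c0 Fc; apply: le_trans (ler_sum _ (fun i _ => Fc i)) _.
  rewrite sumr_const card_ord -mulr_natl ler_wpM2r // /S; lra.
have cl_norm N x : 0 <= N -> enorm (cl N x) <= S * enorm x.
  move=> N0; apply: le_trans (enorm_le_sum _) _; apply: sum_const => [|i].
    exact: enorm_ge0.
  by rewrite mxE; apply: le_trans (clamp_le_norm _ N0) (coord_le_enorm _ _).
have cl_norm' N x : 0 <= N -> enorm (cl N x) <= S * N.
  move=> N0; apply: le_trans (enorm_le_sum _) _; apply: sum_const => // i.
  by rewrite mxE clamp_le.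
have cl_dist N x y : 0 <= N -> enorm (cl N x - cl N y) <= S * enorm (x - y).
  move=> N0; apply: le_trans (enorm_le_sum _) _; apply: sum_const => [|i].
    exact: enorm_ge0.
  rewrite !mxE; apply: le_trans (clamp_dist _ _ N0) _.
  by have := coord_le_enorm (x - y) i; rewrite !mxE.
have cl_err N x : 0 < N -> enorm (x - cl N x) <= S * (enorm x ^+ 2 / N).
  move=> N0; apply: le_trans (enorm_le_sum _) _; apply: sum_const => [|i].
    by rewrite divr_ge0 ?sqr_ge0 ?ltW.
  rewrite !mxE; apply: le_trans (clamp_error _ N0) _.
  rewrite ler_pM2r ?invr_gt0 // -real_normK ?num_real //.
  by rewrite lerXn2r ?nnegrE ?enorm_ge0 ?coord_le_enorm.
pose D := C * (2 * S) ^+ q * 2 ^+ q * S + 1.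
have D1 : 1 <= D.
  by rewrite /D lerDr !mulr_ge0 ?exprn_ge0 //; lra.
exists (q + 1)%N => eta eta0.
have [N N0 NE] : exists2 N, 0 < N & N = D / eta.
  by exists (D / eta) => //; rewrite divr_gt0 //; lra.
have SN0 : 0 <= S * N by rewrite mulr_ge0 //; lra.
exists (C * (1 + S * N + S * N) ^+ q * S), (fun x => phi (cl N x)); split.
- by rewrite !mulr_ge0 ?exprn_ge0 //; lra.
- move=> x y; apply: le_trans (phiP _ _) _; rewrite -!mulrA ler_wpM2l //.
  apply: ler_pM; [|exact: enorm_ge0| |exact: cl_dist (ltW N0)].
    by rewrite exprn_ge0 // !addr_ge0 ?enorm_ge0.
  rewrite lerXn2r ?nnegrE ?addr_ge0 ?enorm_ge0 //.
  by rewrite !lerD // cl_norm' ?ltW.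
- move=> x; apply: le_trans (phiP _ _) _.
  have x0 := enorm_ge0 x.
  apply: le_trans (_ : C * ((2 * S) ^+ q * (2 ^+ q * moment_fun q x)) *
                       (S * (enorm x ^+ 2 / N)) <= _).
    apply: ler_pM; rewrite ?enorm_ge0 ?cl_err // ?mulr_ge0 ?exprn_ge0 //.
      by rewrite !addr_ge0 ?enorm_ge0.
    rewrite ler_wpM2l //.
    apply: le_trans (_ : (2 * S) ^+ q * (1 + enorm x) ^+ q <= _); last first.
      by rewrite ler_wpM2l ?weight_le_moment // exprn_ge0 //; lra.
    have clx := cl_norm N x (ltW N0); have clx0 := enorm_ge0 (cl N x).
    rewrite -exprMn lerXn2r ?nnegrE.
    - by [].
    - lra.
    - nra.
    - nra.
  have -> : C * ((2 * S) ^+ q * (2 ^+ q * moment_fun q x)) * (S * (enorm x ^+ 2 / N)) =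
      C * (2 * S) ^+ q * 2 ^+ q * S / N * (moment_fun q x * enorm x ^+ 2) by ring.
  apply: ler_pM.
  + by rewrite divr_ge0 ?(ltW N0) // !mulr_ge0 ?exprn_ge0 //; lra.
  + by rewrite mulr_ge0 ?sqr_ge0 // (le_trans ler01) ?moment_ge1.
  + rewrite ler_pdivrMr // NE [leRHS]mulrC divfK ?gt_eqF //.
    by rewrite /D lerDl.
  + rewrite /moment_fun exprD expr1 ler_wpM2l ?lerDr //.
    by rewrite (le_trans ler01) ?moment_ge1.
Qed.

Lemma law_le_lip k (L1 L2 : ('cV[R]_k -> R) -> R) :
  sublin_law L1 -> sublin_law L2 ->
  (forall Lam phi, 0 <= Lam -> lip Lam phi -> L1 phi <= L2 phi) ->
  forall phi, C_lLip phi -> L1 phi <= L2 phi.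
Proof.
move=> L1L L2L le12 phi phiL; have [q phiA] := C_lLip_approx phiL.
have L10 : 0 <= L1 (moment_fun q).
  by apply: (law_ge0 L1L) => // x; apply: le_trans (moment_ge1 _ _).
have L20 : 0 <= L2 (moment_fun q).
  by apply: (law_ge0 L2L) => // x; apply: le_trans (moment_ge1 _ _).
apply/ler_addgt0Pl => e e0; set M := L1 (moment_fun q) + L2 (moment_fun q) + 1.
have M0 : 0 < M by rewrite /M; lra.
have [Lam [psi [Lam0 psiL dpsi]]] := phiA (e / M) (divr_gt0 e0 M0).
have psiC := lip_lLip Lam0 psiL.
have eM0 : 0 <= e / M by rewrite ltW ?divr_gt0.
have := law_moment_dist L1L eM0 phiL psiC dpsi; rewrite ler_norml => /andP[_ H1].
have := law_moment_dist L2L eM0 phiL psiC dpsi; rewrite ler_norml => /andP[H2 _].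
have := le12 _ _ Lam0 psiL.
have : e / M * L1 (moment_fun q) + e / M * L2 (moment_fun q) <= e.
  rewrite -mulrDr mulrAC ler_pdivrMr // ler_pM2l // /M; lra.
lra.
Qed.

End Laws.

(** * Random walks: iterating a sublinear law *)

Section Step.
Variables (R : realType) (k : nat).
Implicit Types (L : ('cV[R]_k -> R) -> R) (f g phi psi : 'cV[R]_k -> R).

(** One step of a walk with increment [a X], [X] of law [L]; the [n]-fold
iterate is the expectation after [n] independent steps. *)
Definition step L (a : R) phi (x : 'cV[R]_k) : R := L (fun y => phi (x + a *: y)).

(** Walks are invariant under translation and scaling. *)
Lemma iter_step_affine L n (a b : R) psi x z :
  iter n (step L a) (fun y => psi (x + b *: y)) z =
  iter n (step L (b * a)) psi (x + b *: z).
Proof.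
elim: n z => [|n IHn] z //=; rewrite /step; congr L; apply/funext => y.
by rewrite IHn scalerDr addrA scalerA.
Qed.

Section StepLaw.
Variable L : ('cV[R]_k -> R) -> R.
Hypothesis L_law : sublin_law L.

Lemma C_lLip_step a phi : C_lLip phi -> C_lLip (step L a phi).
Proof.
move=> phiL; have := C_lLip_law_lin 1 a L_law phiL.
by congr C_lLip; apply/funext => x; rewrite /step scale1r.
Qed.

Lemma C_lLip_iter n a phi : C_lLip phi -> C_lLip (iter n (step L a) phi).
Proof. by move=> phiL; elim: n => //= n; apply: C_lLip_step. Qed.

Lemma step_law a x : sublin_law (fun phi => step L a phi x).
Proof.
apply: (@law_bind R k k L (fun y phi => phi (x + a *: y)) L_law) => [y|phi].
  exact: dirac_law.
exact: C_lLip_affine.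
Qed.

Lemma iter_step_law n a x : sublin_law (fun phi => iter n (step L a) phi x).
Proof.
elim: n x => [|n IHn] x; first exact: dirac_law.
apply: (@law_bind R k k (fun phi => step L a phi x)
  (fun y phi => iter n (step L a) phi y) (step_law a x)) => // phi.
exact: C_lLip_iter.
Qed.

Lemma lip_step Lam a phi : 0 <= Lam -> lip Lam phi -> lip Lam (step L a phi).
Proof.
move=> Lam0 phiL x y; have phiC := lip_lLip Lam0 phiL.
rewrite -[leRHS](law_const L_law).
apply: (law_dist L_law); rewrite ?C_lLip_const; do ?exact: C_lLip_affine.
  by [].
by move=> z; have := phiL (x + a *: z) (y + a *: z); rewrite opprD addrACA subrr addr0.
Qed.

Lemma lip_iter Lam n a phi : 0 <= Lam -> lip Lam phi -> lip Lam (iter n (step L a) phi).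
Proof. by move=> Lam0 phiL; elim: n => //= n; apply: lip_step. Qed.

Lemma step_scale_dist Lam a b phi x : 0 <= Lam -> lip Lam phi ->
  `|step L a phi x - step L b phi x| <= Lam * `|a - b| * L (@enorm R k).
Proof.
move=> Lam0 phiL; have phiC := lip_lLip Lam0 phiL.
rewrite -(law_poshom L_law) ?mulr_ge0 //.
apply: (law_dist L_law); do ?exact: C_lLip_affine; first exact: C_lLipZ.
move=> y; have := phiL (x + a *: y) (x + b *: y).
by rewrite opprD addrACA subrr add0r -scalerBl enormZ mulrA.
Qed.

End StepLaw.

Lemma law_sup_dist L f g c : sublin_law L -> C_lLip f -> C_lLip g ->
  (forall x, `|f x - g x| <= c) -> `|L f - L g| <= c.
Proof.
move=> LL fL gL dfg; rewrite -[leRHS](law_const LL).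
exact: (law_dist LL).
Qed.

Lemma law_le_add L f g c : sublin_law L -> C_lLip f -> C_lLip g ->
  (forall x, f x <= g x + c) -> L f <= L g + c.
Proof.
move=> LL fL gL le_fg; rewrite -(law_addc LL) //.
by apply: (law_le LL) => //; apply: C_lLipD.
Qed.

End Step.

(** * Limits of real sequences *)

Section RealLimits.
Variable R : realType.
Implicit Types (a b c : R) (u : nat -> R).

Lemma ler_div_nat a b c : (forall n, (0 < n)%N -> a <= b + c / n%:R) -> a <= b.
Proof.
move=> ab; apply/ler_addgt0Pr => e e0.
pose n := (Num.truncn (`|c| / e)).+1.
apply: le_trans (ab n isT) _; rewrite lerD2l ler_pdivrMr ?ltr0n //.
apply: le_trans (ler_norm c) _; rewrite mulrC -ler_pdivrMr //.
by rewrite ltW // truncnS_gt.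
Qed.

Lemma limn_near u : cvgn u ->
  forall e, 0 < e -> exists n0, forall n, (n0 <= n)%N -> `|u n - limn u| <= e.
Proof.
move=> /cvgrPdist_le ucv e /ucv [n0 _ n0P]; exists n0 => n /n0P /=.
by rewrite distrC.
Qed.

(** Refining a Riemann sum and subdividing the steps of a walk compare the terms
of index [n] and [n * m]; this form of the Cauchy condition suffices. *)
Lemma cauchy_mul_cvgn u :
  (forall e, 0 < e -> exists n0, forall n m, (n0 <= n)%N -> (0 < n)%N -> (0 < m)%N ->
     `|u n - u (n * m)%N| <= e) -> cvgn u.
Proof.
move=> uC; apply/cauchy_cvgP/cauchy_exP => e e0.
have e40 : 0 < e / 4 by rewrite divr_gt0.
have [n0 n0P] := uC _ e40; exists (u n0.+1); exists n0.+1 => // n /= le_n.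
(* both terms are compared with the term of index n0.+1 * n *)
have := n0P n0.+1 n (leqnSn _) isT (leq_trans (ltn0Sn _) le_n).
have := n0P n n0.+1 (ltnW le_n) (leq_trans (ltn0Sn _) le_n) isT.
rewrite mulnC => H1 H2; rewrite /ball /=.
apply: le_lt_trans (ler_distD (u (n0.+1 * n)%N) _ _) _.
by rewrite (distrC _ (u n)); lra.
Qed.

Lemma limn_dist_mul u c n : cvgn u -> (0 < n)%N ->
  (forall m, (0 < m)%N -> `|u n - u (n * m)%N| <= c) -> `|u n - limn u| <= c.
Proof.
move=> ucv n0 uc; apply/ler_addgt0Pr => e e0.
have [m mP] := limn_near ucv e0.
have := mP (n * m.+1)%N (leq_trans (leqnSn m) (leq_pmull _ n0)).
have := uc m.+1 isT.
have := ler_distD (u (n * m.+1)%N) (u n) (limn u); lra.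
Qed.

End RealLimits.

(** * Averaging operators *)

Section LipAlgebra.
Variables (R : realType) (k : nat).
Implicit Types (u w : 'cV[R]_k -> R).

Lemma lipD Lam Lam' c u w : lip Lam u -> lip Lam' w ->
  lip (`|c| * Lam + Lam') (fun x => c * u x + w x).
Proof.
move=> uL wL x y; rewrite opprD addrACA -mulrBr mulrDl.
apply: le_trans (ler_normD _ _) _; rewrite normrM -mulrA.
by apply: lerD; [rewrite ler_wpM2l|].
Qed.

Lemma lip_shift Lam u z : lip Lam u -> lip Lam (fun x => u (x + z)).
Proof. by move=> uL x y; have := uL (x + z) (y + z); rewrite opprD addrACA subrr addr0. Qed.

End LipAlgebra.

Section Averaging.
Variables (R : realType) (k : nat).
Implicit Types (u w : 'cV[R]_k -> R) (x z : 'cV[R]_k) (Lam : R).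

(** Operators [u |-> E (u (. + Z))] for a classical random variable [Z]. What
makes them compatible with sublinear laws is Jensen's inequality
[avg_jensen]. *)
Record averaging (kap : R) (A : ('cV[R]_k -> R) -> 'cV[R]_k -> R) : Prop := Averaging {
  avg_lip : forall Lam u, 0 <= Lam -> lip Lam u -> lip Lam (A u);
  avg_lin : forall Lam Lam' c u w x, 0 <= Lam -> 0 <= Lam' -> lip Lam u -> lip Lam' w ->
    A (fun y => c * u y + w y) x = c * A u x + A w x;
  avg_mono : forall Lam Lam' u w c, 0 <= Lam -> 0 <= Lam' -> lip Lam u -> lip Lam' w ->
    (forall x, u x <= w x + c) -> forall x, A u x <= A w x + c;
  avg_shift : forall u z x, A (fun y => u (y + z)) x = A u (x + z);
  avg_near : forall Lam u x, 0 <= Lam -> lip Lam u -> `|A u x - u x| <= kap * Lam;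
  avg_jensen : forall L a Lam u x, sublin_law L -> 0 <= Lam -> lip Lam u ->
    step L a (A u) x <= A (step L a u) x }.

Lemma averaging_id : averaging 0 id.
Proof.
by split=> // Lam u x Lam0 uL; rewrite subrr normr0 mul0r.
Qed.

Lemma averaging_comp kap kap' A A' : averaging kap A -> averaging kap' A' ->
  averaging (kap + kap') (fun u => A (A' u)).
Proof.
move=> HA HA'; split.
- by move=> Lam u Lam0 uL; apply: (avg_lip HA) => //; apply: (avg_lip HA').
- move=> Lam Lam' c u w x Lam0 Lam'0 uL wL.
  rewrite -(avg_lin HA _ _ Lam0 Lam'0); do ?exact: (avg_lip HA').
  congr A; apply/funext => y.
  exact: (avg_lin HA' _ _ Lam0 Lam'0).
- move=> Lam Lam' u w c Lam0 Lam'0 uL wL le_uw.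
  apply: (avg_mono HA Lam0 Lam'0); do ?exact: (avg_lip HA').
  exact: (avg_mono HA' Lam0 Lam'0).
- move=> u z x; rewrite -(avg_shift HA); congr A.
  by apply/funext => y; rewrite (avg_shift HA').
- move=> Lam u x Lam0 uL.
  have := avg_near HA x Lam0 (avg_lip HA' Lam0 uL).
  have := avg_near HA' x Lam0 uL.
  have := ler_distD (A' u x) (A (A' u) x) (u x); lra.
- move=> L a Lam u x LL Lam0 uL.
  have A'L := avg_lip HA' Lam0 uL.
  apply: le_trans (avg_jensen HA _ _ LL Lam0 A'L) _.
  rewrite -[leRHS]addr0; move: x; apply: (avg_mono HA Lam0 Lam0).
  + exact: lip_step.
  + by apply: (avg_lip HA') => //; apply: lip_step.
  + by move=> x; rewrite addr0; apply: (avg_jensen HA' _ _ LL Lam0 uL).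
Qed.

Section AveragingTheory.
Variables (kap : R) (A : ('cV[R]_k -> R) -> 'cV[R]_k -> R).
Hypothesis HA : averaging kap A.

Lemma avg0 x : A (fun=> 0) x = 0.
Proof.
have lip0 : lip 0 (fun _ : 'cV[R]_k => 0 : R) by move=> y z; rewrite subrr normr0 mul0r.
have := avg_lin HA 1 x (lexx 0) (lexx 0) lip0 lip0.
rewrite mul1r (_ : (fun y => _) = fun=> 0) => [H|]; first by lra.
by apply/funext => y; rewrite addr0.
Qed.

Lemma avg_bound Lam u c x : 0 <= Lam -> lip Lam u -> (forall x, `|u x| <= c) ->
  `|A u x| <= c.
Proof.
move=> Lam0 uL uc.
have lip0 : lip 0 (fun _ : 'cV[R]_k => 0 : R) by move=> y z; rewrite subrr normr0 mul0r.
rewrite ler_norml; apply/andP; split.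
  rewrite -subr_ge0 opprK -(avg0 x).
  apply: (avg_mono HA (lexx 0) Lam0 lip0 uL) => y.
  by have := uc y; rewrite ler_norml => /andP[+ _]; lra.
rewrite -[leRHS]add0r -(avg0 x); apply: (avg_mono HA Lam0 (lexx 0) uL lip0) => y.
by rewrite add0r; apply: le_trans (ler_norm _) (uc y).
Qed.

Definition diffq (e : R) z u x : R := e^-1 * (u (x + e *: z) - u x).

Lemma lip_diffq Lam e z u : 0 < e -> lip Lam u -> lip (2 * Lam / e) (diffq e z u).
Proof.
move=> e0 uL x y; rewrite /diffq -mulrBr normrM ger0_norm ?invr_ge0 ?(ltW e0) //.
have -> : 2 * Lam / e * enorm (x - y) = e^-1 * (2 * Lam * enorm (x - y)) by ring.
rewrite ler_wpM2l ?invr_ge0 ?(ltW e0) //.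
have := uL (x + e *: z) (y + e *: z).
rewrite (_ : x + e *: z - (y + e *: z) = x - y); last by rewrite opprD addrACA subrr addr0.
have -> : u (x + e *: z) - u x - (u (y + e *: z) - u y) =
  (u (x + e *: z) - u (y + e *: z)) - (u x - u y) by ring.
have := ler_normB (u (x + e *: z) - u (y + e *: z)) (u x - u y).
move: (uL x y) => ?; lra.
Qed.

Lemma avg_diffq Lam e z u x : 0 <= Lam -> lip Lam u ->
  A (diffq e z u) x = diffq e z (A u) x.
Proof.
move=> Lam0 uL.
have u1 : lip (`|- e^-1| * Lam + 0) (fun y => - e^-1 * u y + 0).
  by apply: lipD => // y y'; rewrite subrr normr0 mul0r.
have u2 : lip Lam (fun y => u (y + e *: z)) by apply: lip_shift.
have L10 : 0 <= `|- e^-1| * Lam + 0 by rewrite addr0 mulr_ge0.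
have lip0 : lip 0 (fun _ : 'cV[R]_k => 0 : R) by move=> y y'; rewrite subrr normr0 mul0r.
have -> : diffq e z u = fun y => e^-1 * u (y + e *: z) + (- e^-1 * u y + 0).
  by apply/funext => y; rewrite /diffq; ring.
rewrite (avg_lin HA e^-1 x Lam0 L10 u2 u1) (avg_lin HA (- e^-1) x Lam0 (lexx 0) uL lip0).
by rewrite avg0 (avg_shift HA) /diffq; ring.
Qed.

(** First-order expansions in a direction [z] pass through an averaging
operator. *)
Lemma avg_expansion Lam Lam' B z t f g x : 0 <= Lam -> 0 <= Lam' ->
  lip Lam f -> lip Lam' g ->
  (forall x, `|f (x + z) - f x - t * g x| <= B) ->
  `|A f (x + z) - A f x - t * A g x| <= B.
Proof.
move=> Lam0 Lam'0 fL gL fg.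
have h1 : lip (`|- t| * Lam' + Lam) (fun y => - t * g y + f (y + z)).
  by apply: lipD => //; apply: lip_shift.
have h10 : 0 <= `|- t| * Lam' + Lam by rewrite addr_ge0 ?mulr_ge0.
have h2 := lipD (-1) fL h1.
have -> : A f (x + z) - A f x - t * A g x =
    A (fun y => -1 * f y + (- t * g y + f (y + z))) x.
  rewrite (avg_lin HA (-1) x Lam0 h10 fL h1).
  rewrite (avg_lin HA (- t) x Lam'0 Lam0 gL (lip_shift z fL)) (avg_shift HA); ring.
apply: (avg_bound _ _ h2) => [|y]; first by rewrite addr_ge0 ?mulr_ge0.
have -> : -1 * f y + (- t * g y + f (y + z)) = f (y + z) - f y - t * g y by ring.
exact: fg.
Qed.

End AveragingTheory.
End Averaging.

Section Mean.
Variables (R : realType) (k : nat).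
Implicit Types (u w : 'cV[R]_k -> R) (x z : 'cV[R]_k) (Lam : R).

Definition rsum (e : 'cV[R]_k) n u x : R :=
  n%:R^-1 * \sum_(0 <= j < n) u (x + (j%:R / n%:R) *: e).

(** The integral of [u (x + s e)] over [s] in [0, 1]. *)
Definition mean (e : 'cV[R]_k) u x : R := limn (fun n => rsum e n u x).

Variable e : 'cV[R]_k.

Lemma rsum_refine Lam u x n m : 0 <= Lam -> lip Lam u -> (0 < n)%N -> (0 < m)%N ->
  `|rsum e n u x - rsum e (n * m) u x| <= Lam * enorm e / n%:R.
Proof.
move=> Lam0 uL n0 m0.
have n0R : n%:R != 0 :> R by rewrite pnatr_eq0 -lt0n.
have m0R : m%:R != 0 :> R by rewrite pnatr_eq0 -lt0n.
rewrite /rsum big_nat_mul.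
have -> : \sum_(0 <= j < n) u (x + (j%:R / n%:R) *: e) =
    \sum_(0 <= j < n) \sum_(j * m <= i < j.+1 * m) m%:R^-1 * u (x + (j%:R / n%:R) *: e).
  apply: eq_bigr => j _; rewrite sumr_const_nat mulSn addnK.
  by rewrite -mulrnAl -[_^-1 *+ m]mulr_natr mulVf // mul1r.
set S := (X in _ - _ * X); rewrite natrM invfM -[_ / m%:R * S]mulrA -mulrBr.
rewrite normrM ger0_norm ?invr_ge0 // {}/S natrM.
rewrite [leRHS]mulrC ler_wpM2l ?invr_ge0 //.
rewrite mulr_sumr -sumrB.
apply: le_trans (ler_norm_sum _ _ _) _.
have -> : Lam * enorm e = \sum_(0 <= j < n) Lam * enorm e / n%:R.
  by rewrite sumr_const_nat subn0 -[RHS]mulr_natr divfK.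
apply: ler_sum_nat => j /andP[_ lt_jn]; rewrite mulr_sumr -sumrB.
apply: le_trans (ler_norm_sum _ _ _) _.
have -> : Lam * enorm e / n%:R = \sum_(j * m <= i < j.+1 * m) m%:R^-1 * (Lam * enorm e / n%:R).
  rewrite sumr_const_nat mulSn addnK -mulrnAl -[_^-1 *+ m]mulr_natr mulVf // mul1r //.
apply: ler_sum_nat => i /andP[le_ji lt_ij].
rewrite -mulrBr normrM ger0_norm ?invr_ge0 // ler_wpM2l ?invr_ge0 //.
apply: le_trans (uL _ _) _.
rewrite opprD addrACA subrr add0r -scalerBl enormZ -mulrA ler_wpM2l // mulrC.
rewrite ler_wpM2l ?enorm_ge0 //.
have -> : j%:R / n%:R - i%:R / (n%:R * m%:R) = ((j * m)%N%:R - i%:R) / (n%:R * m%:R) :> R.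
  by rewrite natrM; field; rewrite n0R m0R.
rewrite ler0_norm; last first.
  by rewrite pmulr_lle0 ?subr_le0 ?ler_nat // invr_gt0 mulr_gt0 ?ltr0n.
rewrite -mulNr opprB ler_pdivrMr ?mulr_gt0 ?ltr0n // mulrA mulVf // mul1r.
rewrite lerBlDr -natrD ler_nat.
by rewrite -mulSn ltnW.
Qed.

Lemma rsum_mean Lam u x n : 0 <= Lam -> lip Lam u -> (0 < n)%N ->
  `|rsum e n u x - mean e u x| <= Lam * enorm e / n%:R.
Proof.
move=> Lam0 uL n0; apply: limn_dist_mul => // [|m m0]; last exact: rsum_refine.
apply: cauchy_mul_cvgn => eta eta0.
pose c := Lam * enorm e; have c0 : 0 <= c by rewrite mulr_ge0 ?enorm_ge0.
exists (Num.truncn (c / eta)).+1 => p q le_p p0 q0.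
apply: le_trans (rsum_refine x Lam0 uL p0 q0) _.
rewrite -/c ler_pdivrMr ?ltr0n // mulrC -ler_pdivrMr //.
by apply: le_trans (ltW (truncnS_gt _)) _; rewrite ler_nat.
Qed.

End Mean.

Section MeanAveraging.
Variables (R : realType) (k : nat) (e : 'cV[R]_k).
Implicit Types (u w : 'cV[R]_k -> R) (x y z : 'cV[R]_k) (Lam : R).

Lemma rsum_le n u w x y c : (0 < n)%N -> (forall z, u (x + z) <= w (y + z) + c) ->
  rsum e n u x <= rsum e n w y + c.
Proof.
move=> n0 le_uw; have n0R : n%:R != 0 :> R by rewrite pnatr_eq0 -lt0n.
have -> : c = n%:R^-1 * \sum_(0 <= j < n) c.
  by rewrite sumr_const_nat subn0 -[c *+ n]mulr_natl mulKf.
rewrite -mulrDr ler_wpM2l ?invr_ge0 // -big_split.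
by apply: ler_sum_nat => j _; apply: le_uw.
Qed.

Lemma mean_le Lam Lam' u w x y c : 0 <= Lam -> 0 <= Lam' -> lip Lam u -> lip Lam' w ->
  (forall n, (0 < n)%N -> rsum e n u x <= rsum e n w y + c) ->
  mean e u x <= mean e w y + c.
Proof.
move=> Lam0 Lam'0 uL wL le_uw.
apply: (@ler_div_nat _ _ _ ((Lam + Lam') * enorm e)) => n n0.
have := rsum_mean e x Lam0 uL n0; have := rsum_mean e y Lam'0 wL n0.
have := le_uw n n0; rewrite !ler_norml mulrDl mulrDl => H1 /andP[H2 H3] /andP[H4 H5].
lra.
Qed.

(** Jensen's inequality for a finite average is subadditivity. *)
Lemma rsum_jensen L a n u x : sublin_law L -> C_lLip u -> (0 < n)%N ->
  step L a (rsum e n u) x <= rsum e n (step L a u) x.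
Proof.
move=> LL uC n0; rewrite /step /rsum (law_poshom LL) ?invr_ge0 //; last first.
  apply: C_lLip_sum => j.
  by apply: (@C_lLip_affine _ _ (fun y => u (y + _))); apply: C_lLip_translate.
rewrite ler_wpM2l ?invr_ge0 //; elim: (index_iota 0 n) => [|j s IHs].
  under eq_fun => y do rewrite big_nil.
  by rewrite big_nil (law_const LL).
under eq_fun => y do rewrite big_cons.
have jC : C_lLip (fun y => u (x + a *: y + (j%:R / n%:R) *: e)).
  by apply: (@C_lLip_affine _ _ (fun y => u (y + _))); apply: C_lLip_translate.
have sC : C_lLip (fun y => \sum_(i <- s) u (x + a *: y + (i%:R / n%:R) *: e)).
  apply: C_lLip_sum => i.
  by apply: (@C_lLip_affine _ _ (fun y => u (y + _))); apply: C_lLip_translate.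
apply: le_trans (law_subadd LL jC sC) _; rewrite big_cons lerD //.
by rewrite le_eqVlt; apply/orP; left; apply/eqP; congr L; apply/funext => y; rewrite addrAC.
Qed.

Lemma averaging_mean : averaging (enorm e) (mean e).
Proof.
have near n Lam u x : 0 <= Lam -> lip Lam u -> (0 < n)%N ->
    rsum e n u x - Lam * enorm e / n%:R <= mean e u x <=
    rsum e n u x + Lam * enorm e / n%:R.
  move=> Lam0 uL n0; have := rsum_mean e x Lam0 uL n0.
  by rewrite ler_norml => /andP[H1 H2]; apply/andP; split; lra.
have mean_lip Lam u : 0 <= Lam -> lip Lam u -> lip Lam (mean e u).
  move=> Lam0 uL x y.
  have half x' y' : mean e u x' <= mean e u y' + Lam * enorm (x' - y').
    apply: (mean_le Lam0 Lam0 uL uL) => n n0; apply: rsum_le => // z.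
    have := uL (x' + z) (y' + z); rewrite opprD addrACA subrr addr0 => H.
    by have := le_trans (ler_norm _) H; lra.
  have := half x y; have := half y x; rewrite (enormC y) ler_norml => H1 H2.
  by apply/andP; split; lra.
split=> //.
- move=> Lam Lam' c u w x Lam0 Lam'0 uL wL.
  have cuwL := lipD c uL wL.
  have L'0 : 0 <= `|c| * Lam + Lam' by rewrite addr_ge0 ?mulr_ge0.
  apply/eqP; rewrite -subr_eq0 -normr_le0.
  pose M := ((`|c| * Lam + Lam') + `|c| * Lam + Lam') * enorm e.
  apply: (@ler_div_nat _ _ _ M) => n n0; rewrite add0r.
  have := rsum_mean e x L'0 cuwL n0; have := rsum_mean e x Lam'0 wL n0.
  have := ler_wpM2l (normr_ge0 c) (rsum_mean e x Lam0 uL n0); rewrite -normrM.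
  have -> : rsum e n (fun y => c * u y + w y) x = c * rsum e n u x + rsum e n w x.
    by rewrite /rsum big_split /= -mulr_sumr; ring.
  have -> : M / n%:R = (`|c| * Lam + Lam') * enorm e / n%:R +
      `|c| * (Lam * enorm e / n%:R) + Lam' * enorm e / n%:R by rewrite /M; ring.
  rewrite !ler_norml => /andP[H1 H2] /andP[H3 H4] /andP[H5 H6].
  by apply/andP; split; lra.
- move=> Lam Lam' u w c Lam0 Lam'0 uL wL le_uw x.
  by apply: (mean_le Lam0 Lam'0 uL wL) => n n0; apply: rsum_le => // z; apply: le_uw.
- move=> u z x; rewrite /mean; congr (limn _); apply/funext => n.
  by congr (_ * _); apply: eq_bigr => j _; rewrite addrAC.
- move=> Lam u x Lam0 uL.
  (* the Riemann sum with a single term is the value at x *)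
  have := rsum_mean e x Lam0 uL (ltn0Sn 0).
  rewrite /rsum big_nat1 mul0r scale0r addr0 invr1 mul1r mulr1 distrC.
  by rewrite mulrC.
- move=> L a Lam u x LL Lam0 uL.
  have uC := lip_lLip Lam0 uL.
  have sL := lip_step LL a Lam0 uL.
  apply: (@ler_div_nat _ _ _ (2 * (Lam * enorm e))) => n n0.
  have /andP[H _] := near n _ _ x Lam0 sL n0.
  have nC : C_lLip (rsum e n u).
    by apply: C_lLipZ; apply: C_lLip_sum => j; apply: C_lLip_translate.
  have : step L a (mean e u) x <= step L a (rsum e n u) x + Lam * enorm e / n%:R.
    apply: (law_le_add LL); do ?exact: C_lLip_affine.
      exact/C_lLip_affine/(lip_lLip Lam0)/mean_lip.
    by move=> y; have /andP[] := near n _ _ (x + a *: y) Lam0 uL n0; lra.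
  have := rsum_jensen a x LL uC n0; lra.
Qed.

(** For [t >= 0] the shift by [t e] trades the initial piece of the segment of
integration for a piece of the same length beyond its end; [u] is close to
[u x] on the former and to [u (x + e)] on the latter. *)
Lemma mean_deriv Lam u x t : 0 <= Lam -> lip Lam u ->
  `|mean e u (x + t *: e) - mean e u x - t * (u (x + e) - u x)| <=
  4 * Lam * enorm e * t ^+ 2.
Proof.
move=> Lam0 uL; set D := fun x => u (x + e) - u x.
have DL : lip (2 * Lam) D.
  move=> y z; have := uL (y + e) (z + e); rewrite opprD addrACA subrr addr0.
  have := uL y z; rewrite /D.
  have -> : u (y + e) - u y - (u (z + e) - u z) = (u (y + e) - u (z + e)) - (u y - u z).
    by ring.
  have := ler_normB (u (y + e) - u (z + e)) (u y - u z); lra.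
have e0 := enorm_ge0 e.
have mL := avg_lip averaging_mean Lam0 uL.
suff pos s y : 0 <= s ->
    `|mean e u (y + s *: e) - mean e u y - s * D y| <= 2 * Lam * enorm e * s ^+ 2.
  have [t0|/ltW t0] := lerP 0 t.
    have T0 : 0 <= Lam * enorm e * t ^+ 2 by rewrite !mulr_ge0 ?sqr_ge0.
    by apply: le_trans (pos t x t0) _; lra.
  have := pos (- t) (x + t *: e) ltac:(lra).
  rewrite scaleNr addrK sqrrN.
  have xtE : x + t *: e - x = t *: e by rewrite addrC addKr.
  have := DL (x + t *: e) x; rewrite xtE enormZ (ler0_norm t0) => DxP H.
  have : `|t * (D (x + t *: e) - D x)| <= 2 * Lam * enorm e * t ^+ 2.
    rewrite normrM ler0_norm //.
    have Nt0 : 0 <= - t by lra.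
    have := ler_wpM2l Nt0 DxP; congr (_ <= _); ring.
  move: H; rewrite -/(D x) !ler_norml => /andP[H1 H2] /andP[H3 H4].
  by apply/andP; split; lra.
move=> s0.
pose c := 3 * (Lam * enorm e) + `|D y|.
apply: (@ler_div_nat _ _ _ c) => n n0.
have n0R : 0 < n%:R :> R by rewrite ltr0n.
have sn0 : 0 <= s * n%:R by rewrite mulr_ge0.
pose p := Num.truncn (s * n%:R).
have /andP[le_p lt_p] := truncn_itv sn0; rewrite -/p in le_p lt_p.
pose r : R := p%:R / n%:R.
have r0 : 0 <= r by rewrite divr_ge0.
have le_rs : r <= s by rewrite ler_pdivrMr.
have lt_sr : s - r <= n%:R^-1.
  rewrite lerBlDr -[n%:R^-1]mul1r -mulrDl ler_pdivlMr //.
  by rewrite addrC natr1 ltW.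
have D1 : `|mean e u (y + s *: e) - mean e u (y + r *: e)| <= Lam * enorm e / n%:R.
  apply: le_trans (mL _ _) _; rewrite opprD addrACA subrr add0r -scalerBl enormZ.
  rewrite -mulrA ler_wpM2l // mulrC ler_wpM2l // ger0_norm //; lra.
have D2 := rsum_mean e (y + r *: e) Lam0 uL n0.
have D3 := rsum_mean e y Lam0 uL n0.
have D4 : `|(s - r) * D y| <= `|D y| / n%:R.
  rewrite normrM mulrC ler_wpM2l // ger0_norm //; lra.
have D5 : `|rsum e n u (y + r *: e) - rsum e n u y - r * D y| <=
    2 * Lam * enorm e * s ^+ 2.
  have shiftE : rsum e n u (y + r *: e) - rsum e n u y =
      n%:R^-1 * \sum_(0 <= j < p) D (y + (j%:R / n%:R) *: e).
    rewrite /rsum -mulrBr; congr (_ * _).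
    pose F j : R := u (y + (j%:R / n%:R) *: e).
    have catF a b : \sum_(0 <= j < a + b) F j =
        \sum_(0 <= j < a) F j + \sum_(0 <= j < b) F (j + a)%N.
      rewrite (big_cat_nat (n := a)) ?leq_addr //=; congr (_ + _).
      by rewrite -{1}[a]add0n big_addn addKn.
    have -> : \sum_(0 <= j < n) u (y + r *: e + (j%:R / n%:R) *: e) =
        \sum_(0 <= j < n) F (j + p)%N.
      apply: eq_bigr => j _.
      by rewrite /F natrD mulrDl scalerDl addrA addrAC.
    have -> : \sum_(0 <= j < p) D (y + (j%:R / n%:R) *: e) =
        \sum_(0 <= j < p) F (j + n)%N - \sum_(0 <= j < p) F j.
      rewrite -sumrB; apply: eq_bigr => j _; congr (u _ - _).
      by rewrite natrD mulrDl mulfV ?gt_eqF // scalerDl scale1r addrA.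
    have := catF n p; rewrite addnC catF; lra.
  have -> : r * D y = n%:R^-1 * \sum_(0 <= j < p) D y.
    by rewrite sumr_const_nat subn0 -[_ *+ p]mulr_natl /r; ring.
  rewrite shiftE -mulrBr -sumrB normrM ger0_norm ?invr_ge0 //.
  apply: le_trans (_ : n%:R^-1 * \sum_(0 <= j < p) 2 * Lam * enorm e * r <= _).
    rewrite ler_wpM2l ?invr_ge0 //; apply: le_trans (ler_norm_sum _ _ _) _.
    apply: ler_sum_nat => j /andP[_ lt_jp].
    apply: le_trans (DL _ _) _.
    have -> : y + (j%:R / n%:R) *: e - y = (j%:R / n%:R) *: e by rewrite addrC addKr.
    rewrite enormZ ger0_norm ?divr_ge0 //.
    rewrite -[leRHS]mulrA ler_wpM2l ?mulr_ge0 // mulrC ler_wpM2l //.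
    by rewrite ler_pM2r ?invr_gt0 // ler_nat ltnW.
  rewrite sumr_const_nat subn0 -[_ *+ p]mulr_natl.
  have -> : n%:R^-1 * (p%:R * (2 * Lam * enorm e * r)) = 2 * Lam * enorm e * r ^+ 2.
    by rewrite /r; ring.
  rewrite ler_wpM2l ?mulr_ge0 // lerXn2r ?nnegrE //.
move: D1 D2 D3 D4 D5; rewrite !ler_norml.
have -> : c / n%:R = 3 * (Lam * enorm e / n%:R) + `|D y| / n%:R by rewrite /c; ring.
move=> /andP[? ?] /andP[? ?] /andP[? ?] /andP[? ?] /andP[? ?].
by apply/andP; split; lra.
Qed.

End MeanAveraging.

(** * Mollification and Taylor expansion *)

Section Mollify.
Variables (R : realType) (k : nat).
Implicit Types (u w f g : 'cV[R]_k -> R) (x y z : 'cV[R]_k) (Lam t : R).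

Local Notation dlt i := (delta_mx i 0 : 'cV[R]_k).

Definition mollify1 (e : R) (s : seq 'I_k) u : 'cV[R]_k -> R :=
  foldr (fun i v => mean (e *: dlt i) v) u s.

Lemma averaging_mollify1 e s : 0 < e -> averaging ((size s)%:R * e) (mollify1 e s).
Proof.
move=> e0; elim: s => [|i s IHs] /=; first by rewrite mul0r; apply: averaging_id.
have := averaging_comp (averaging_mean (e *: dlt i)) IHs.
by rewrite enormZ enorm_delta mulr1 gtr0_norm // mulrS mulrDl mul1r.
Qed.

(** Differentiating in the direction [i] turns the mean in that direction into
a difference quotient and leaves the other means alone, so that the
derivative of the mollified function is again an average of Lipschitz
functions. *)
Lemma mollify1_deriv e s i : 0 < e -> i \in s ->
  exists kap A, averaging kap A /\ forall Lam w x t, 0 <= Lam -> lip Lam w ->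
    `|mollify1 e s w (x + t *: dlt i) - mollify1 e s w x -
      t * A (diffq e (dlt i) w) x| <= 4 * Lam / e * t ^+ 2.
Proof.
move=> e0; elim: s => //= j s IHs; rewrite inE; have [<- _|_ /= i_s] := eqVneq i j.
  exists ((size s)%:R * e), (mollify1 e s); split=> [|Lam w x t Lam0 wL].
    exact: averaging_mollify1.
  have Hs := averaging_mollify1 s e0.
  rewrite (avg_diffq Hs _ _ _ Lam0 wL).
  have := mean_deriv (e *: dlt i) x (t / e) Lam0 (avg_lip Hs Lam0 wL).
  rewrite scalerA divfK ?gt_eqF // enormZ enorm_delta mulr1 (gtr0_norm e0).
  congr (_ <= _).
    by congr (Num.norm _); rewrite /diffq; ring.
  by field; rewrite gt_eqF.
have [kap [A [HA AP]]] := IHs i_s.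
exists (enorm (e *: dlt j) + kap), (fun u => mean (e *: dlt j) (A u)); split.
  exact: averaging_comp (averaging_mean _) HA.
move=> Lam w x t Lam0 wL.
have L20 : 0 <= 2 * Lam / e by apply: divr_ge0 (ltW e0); apply: mulr_ge0.
apply: (avg_expansion (averaging_mean _) x Lam0 L20).
- exact: (avg_lip (averaging_mollify1 s e0)).
- exact/(avg_lip HA)/lip_diffq.
- by move=> y; apply: AP.
Qed.

(** From partial to full first-order expansions, moving one coordinate at a
time. *)
Lemma first_order f (g : 'I_k -> 'cV[R]_k -> R) B Lam x y : 0 <= B -> 0 <= Lam ->
  (forall i x t, `|f (x + t *: dlt i) - f x - t * g i x| <= B * t ^+ 2) ->
  (forall i, lip Lam (g i)) ->
  `|f (x + y) - f x - \sum_i g i x * y i 0| <=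
  k%:R * (B + k%:R * Lam) * enorm y ^+ 2.
Proof.
move=> B0 Lam0 fg gL; have y0 := enorm_ge0 y; have y20 := sqr_ge0 (enorm y).
suff prefix s : `|f (x + \sum_(i <- s) y i 0 *: dlt i) - f x - \sum_(i <- s) g i x * y i 0| <=
    (size s)%:R * (B + (size s)%:R * Lam) * enorm y ^+ 2.
  by have := prefix (enum 'I_k); rewrite size_enum_ord !big_enum -vec_sum_delta.
elim: s => [|i s IHs].
  by rewrite !big_nil addr0 subrr subr0 normr0 mul0r mul0r.
rewrite !big_cons; set z := \sum_(j <- s) y j 0 *: dlt j in IHs *.
have zle : enorm z <= (size s)%:R * enorm y.
  apply: le_trans (enorm_sum _ _) _.
  rewrite -sum1_size natr_sum mulr_suml; apply: ler_sum => j _.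
  by rewrite enormZ enorm_delta mulr1 mul1r coord_le_enorm.
have yi2 : y i 0 ^+ 2 <= enorm y ^+ 2.
  by rewrite -real_normK ?num_real // lerXn2r ?nnegrE ?coord_le_enorm.
have H1 : `|f (x + z + y i 0 *: dlt i) - f (x + z) - y i 0 * g i (x + z)| <= B * enorm y ^+ 2.
  by apply: le_trans (fg _ _ _) _; rewrite ler_wpM2l.
have H2 : `|y i 0 * (g i (x + z) - g i x)| <= Lam * (size s)%:R * enorm y ^+ 2.
  have xzE : x + z - x = z by rewrite addrC addKr.
  have := gL i (x + z) x; rewrite xzE => gxz.
  rewrite normrM expr2; apply: le_trans (_ : enorm y * (Lam * ((size s)%:R * enorm y)) <= _).
    apply: ler_pM; rewrite ?coord_le_enorm //.
    by apply: le_trans gxz _; rewrite ler_wpM2l.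
  by rewrite le_eqVlt; apply/orP; left; apply/eqP; ring.
have -> : x + (y i 0 *: dlt i + z) = x + z + y i 0 *: dlt i by rewrite addrA addrAC.
rewrite /= mulrS; move: IHs H1 H2; rewrite !ler_norml.
have s0 : 0 <= (size s)%:R * Lam * enorm y ^+ 2 by rewrite !mulr_ge0.
have s1 : 0 <= Lam * enorm y ^+ 2 by rewrite !mulr_ge0.
set n := (size s)%:R in s0 *; set Y := enorm y ^+ 2 in s0 s1 *.
move=> /andP[? ?] /andP[? ?] /andP[? ?].
have -> : (1 + n) * (B + (1 + n) * Lam) * Y =
  n * (B + n * Lam) * Y + B * Y + 2 * (n * Lam * Y) + Lam * Y by ring.
by apply/andP; split; lra.
Qed.

(** Taylor's formula along the segment from [x] to [x + y]: its [N] pieces are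
expanded to first order and the increments are added up, after which [N]
goes to infinity. *)
Lemma second_order f (g : 'I_k -> 'cV[R]_k -> R) (q : 'I_k -> 'I_k -> 'cV[R]_k -> R)
    B Lam B' Lam' x y : 0 <= B -> 0 <= Lam -> 0 <= B' -> 0 <= Lam' ->
  (forall i x t, `|f (x + t *: dlt i) - f x - t * g i x| <= B * t ^+ 2) ->
  (forall i, lip Lam (g i)) ->
  (forall i j x t, `|g i (x + t *: dlt j) - g i x - t * q i j x| <= B' * t ^+ 2) ->
  (forall i j, lip Lam' (q i j)) ->
  `|f (x + y) - f x - \sum_i g i x * y i 0 -
    2^-1 * \sum_i \sum_j q i j x * (y j 0 * y i 0)| <=
  k%:R * (k%:R * (B' + k%:R * Lam')) * enorm y ^+ 3.
Proof.
move=> B0 Lam0 B'0 Lam'0 fg gL gq qL; have y0 := enorm_ge0 y.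
pose C1 := k%:R * (B + k%:R * Lam); pose C2 := k%:R * (B' + k%:R * Lam').
have C20 : 0 <= C2 by rewrite !mulr_ge0 ?addr_ge0 ?mulr_ge0.
pose P := \sum_i g i x * y i 0; pose Q := \sum_i \sum_j q i j x * (y j 0 * y i 0).
pose h (t : R) := f (x + t *: y) - f x - t * P - t ^+ 2 / 2 * Q.
pose Z := C1 * enorm y ^+ 2 + `|Q| / 2.
have incr t d : 0 <= t <= 1 -> 0 <= d ->
    `|h (t + d) - h t| <= d * (k%:R * C2 * enorm y ^+ 3) + d ^+ 2 * Z.
  move=> /andP[t0 t1] d0.
  have Hf := first_order (x + t *: y) (d *: y) B0 Lam0 fg gL.
  rewrite -/C1 enormZ exprMn real_normK ?num_real // in Hf.
  have Hg i : `|(g i (x + t *: y) - g i x - t * \sum_j q i j x * y j 0) * y i 0| <=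
      C2 * enorm y ^+ 3.
    rewrite normrM (_ : C2 * _ = C2 * enorm y ^+ 2 * enorm y); last by ring.
    apply: ler_pM; rewrite ?coord_le_enorm //.
    have := first_order x (t *: y) B'0 Lam'0 (gq i) (qL i).
    rewrite -/C2 enormZ exprMn real_normK ?num_real //.
    have -> : \sum_j q i j x * (t *: y) j 0 = t * \sum_j q i j x * y j 0.
      by rewrite mulr_sumr; apply: eq_bigr => j _; rewrite mxE; ring.
    move=> /le_trans; apply; rewrite ler_wpM2l // ler_piMl ?sqr_ge0 //.
    by rewrite exprn_ile1.
  have Hs : `|\sum_i g i (x + t *: y) * y i 0 - P - t * Q| <= k%:R * C2 * enorm y ^+ 3.
    have -> : \sum_i g i (x + t *: y) * y i 0 - P - t * Q =
        \sum_i (g i (x + t *: y) - g i x - t * \sum_j q i j x * y j 0) * y i 0.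
      rewrite /P /Q mulr_sumr -!sumrB; apply: eq_bigr => i _.
      rewrite !mulrBl; congr (_ - _); rewrite -mulrA; congr (_ * _).
      by rewrite mulr_suml; apply: eq_bigr => j _; ring.
    apply: le_trans (ler_norm_sum _ _ _) _; apply: le_trans (ler_sum _ (fun i _ => Hg i)) _.
    by rewrite sumr_const card_ord -[_ *+ k]mulr_natl mulrA.
  have -> : h (t + d) - h t =
      (f (x + t *: y + d *: y) - f (x + t *: y) - \sum_i g i (x + t *: y) * (d *: y) i 0) +
      d * (\sum_i g i (x + t *: y) * y i 0 - P - t * Q) - d ^+ 2 * (Q / 2).
    have -> : \sum_i g i (x + t *: y) * (d *: y) i 0 = d * \sum_i g i (x + t *: y) * y i 0.
      by rewrite mulr_sumr; apply: eq_bigr => j _; rewrite mxE; ring.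
    by rewrite /h scalerDl addrA; field.
  set a1 := f _ - _ - _ in Hf *; set a2 := \sum_i g i (x + t *: y) * y i 0 - P - t * Q in Hs *.
  have N2 : `|d * a2| <= d * (k%:R * C2 * enorm y ^+ 3).
    by rewrite normrM (ger0_norm d0) ler_wpM2l.
  have N3 : `|d ^+ 2 * (Q / 2)| = d ^+ 2 * (`|Q| / 2).
    by rewrite normrM (ger0_norm (sqr_ge0 d)) normrM (ger0_norm (_ : 0 <= 2^-1)) ?invr_ge0.
  have := ler_normB (a1 + d * a2) (d ^+ 2 * (Q / 2)); have := ler_normD a1 (d * a2).
  have -> : d ^+ 2 * Z = C1 * (d ^+ 2 * enorm y ^+ 2) + d ^+ 2 * (`|Q| / 2).
    by rewrite /Z; ring.
  lra.
have telescope N n : (0 < N)%N -> (n <= N)%N -> `|h (n%:R / N%:R)| <=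
    n%:R * (N%:R^-1 * (k%:R * C2 * enorm y ^+ 3) + N%:R^-1 ^+ 2 * Z).
  move=> N0; have N0R : 0 < N%:R :> R by rewrite ltr0n.
  elim: n => [|n IHn] lt_nN.
    by rewrite !mul0r /h scale0r addr0 subrr expr0n !mul0r !subr0 normr0.
  have n01 : 0 <= (n%:R / N%:R : R) <= 1.
    by apply/andP; split; [exact: divr_ge0|rewrite ler_pdivrMr // mul1r ler_nat ltnW].
  have := incr _ N%:R^-1 n01; rewrite invr_ge0 ler0n => /(_ isT).
  have -> : n%:R / N%:R + N%:R^-1 = n.+1%:R / N%:R :> R.
    by rewrite -natr1 mulrDl mul1r.
  have := IHn (ltnW lt_nN); set X := _ + _ ^+ 2 * Z.
  have -> : n.+1%:R * X = n%:R * X + X by rewrite -natr1 mulrDl mul1r.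
  have := ler_normD (h (n.+1%:R / N%:R) - h (n%:R / N%:R)) (h (n%:R / N%:R)).
  rewrite subrK; lra.
apply: (@ler_div_nat _ _ _ Z) => N N0; have N0R : 0 < N%:R :> R by rewrite ltr0n.
have := telescope N N N0 (leqnn N).
rewrite mulfV ?gt_eqF // /h scale1r expr1n mul1r mul1r.
congr (_ <= _); rewrite -/C2. by field; rewrite gt_eqF.
Qed.

(** Mollifying twice over every coordinate yields functions with Lipschitz
second derivatives; the bound on the third-order remainder depends on the
Lipschitz constant only, not on the function or on the point. *)
Lemma mollifier (e : R) : 0 < e -> exists A, averaging (2 * k%:R * e) A /\
  forall Lam, 0 <= Lam -> exists2 C, 0 <= C & forall u x, lip Lam u ->
    exists (p : 'cV[R]_k) (Q : 'M[R]_k), Q \is symmetricmx /\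
      forall y, `|A u (x + y) - (A u x + dotv p y + 2^-1 * dotv (Q *m y) y)| <=
        C * enorm y ^+ 3.
Proof.
move=> e0; set M := mollify1 e (enum 'I_k).
have HM : averaging (k%:R * e) M.
  by have := averaging_mollify1 (enum 'I_k) e0; rewrite size_enum_ord.
exists (fun u => M (M u)); split=> [|Lam Lam0].
  by have := averaging_comp HM HM; congr averaging; ring.
have /choice[kp /choice[A /all_and2[HA AP]]] i := mollify1_deriv e0 (mem_enum 'I_k i).
pose Lam1 := 2 * Lam / e; pose Lam2 := 2 * Lam1 / e.
have Lam10 : 0 <= Lam1 by apply: divr_ge0 (ltW e0); apply: mulr_ge0.
have Lam20 : 0 <= Lam2 by apply: divr_ge0 (ltW e0); apply: mulr_ge0.
pose B := 4 * Lam / e; pose B' := 4 * Lam1 / e.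
have B0 : 0 <= B by apply: divr_ge0 (ltW e0); apply: mulr_ge0.
have B'0 : 0 <= B' by apply: divr_ge0 (ltW e0); apply: mulr_ge0.
exists (k%:R * (k%:R * (B' + k%:R * Lam2))) => [|u x uL].
  do 2!(apply: mulr_ge0; first exact: ler0n).
  by apply: addr_ge0 => //; apply: mulr_ge0.
have MuL := avg_lip HM Lam0 uL.
pose g i := A i (diffq e (dlt i) (M u)).
pose q i j := A i (diffq e (dlt i) (A j (diffq e (dlt j) u))).
have gL i : lip Lam1 (g i) by apply: (avg_lip (HA i)) => //; apply: lip_diffq.
have hL j : lip Lam1 (A j (diffq e (dlt j) u)).
  by apply: (avg_lip (HA j)) => //; apply: lip_diffq.
have qL i j : lip Lam2 (q i j) by apply: (avg_lip (HA i)) => //; apply: lip_diffq.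
have fg i z t : `|M (M u) (z + t *: dlt i) - M (M u) z - t * g i z| <= B * t ^+ 2.
  exact: AP.
have gq i j z t : `|g i (z + t *: dlt j) - g i z - t * q i j z| <= B' * t ^+ 2.
  apply: (avg_expansion (HA i) z Lam10 Lam20); do ?exact: lip_diffq.
  move=> z'; have -> : diffq e (dlt i) (M u) (z' + t *: dlt j) - diffq e (dlt i) (M u) z' -
      t * diffq e (dlt i) (A j (diffq e (dlt j) u)) z' =
    e^-1 * ((M u (z' + e *: dlt i + t *: dlt j) - M u (z' + e *: dlt i) -
             t * A j (diffq e (dlt j) u) (z' + e *: dlt i)) -
            (M u (z' + t *: dlt j) - M u z' - t * A j (diffq e (dlt j) u) z')).
    by rewrite /diffq (addrAC z' (t *: dlt j)); ring.
  rewrite normrM ger0_norm ?invr_ge0 ?(ltW e0) //.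
  have -> : B' * t ^+ 2 = e^-1 * (2 * (4 * Lam / e * t ^+ 2)).
    by rewrite /B' /Lam1; ring.
  rewrite ler_wpM2l ?invr_ge0 ?(ltW e0) //.
  have := AP j _ _ (z' + e *: dlt i) t Lam0 uL; have := AP j _ _ z' t Lam0 uL.
  set a := (X in `|X| <= _) => Ha; set b := (X in `|X| <= _) => Hb.
  by have := ler_normB b a; lra.
exists (\col_i g i x), (\matrix_(i, j) (2^-1 * (q i j x + q j i x))); split.
  by apply/is_hermitianmxP; rewrite expr0 scale1r; apply/matrixP => i j; rewrite !mxE addrC.
move=> y; have := second_order x y B0 Lam10 B'0 Lam20 fg gL gq qL.
congr (_ <= _); congr (Num.norm _); rewrite !opprD !addrA; congr (_ - _ - _).
  by apply: eq_bigr => i _; rewrite mxE.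
congr (_ * _); rewrite dotv_mulmx.
(* only the symmetric part of q contributes to the quadratic form *)
pose S := \sum_i \sum_j q i j x * (y j 0 * y i 0).
have SE : S = \sum_i \sum_j q j i x * (y j 0 * y i 0).
  rewrite /S exchange_big; apply: eq_bigr => i _; apply: eq_bigr => j _.
  by rewrite (mulrC (y i 0)).
rewrite -/S; transitivity (2^-1 * (S + S)); first by field.
rewrite {2}SE /S -big_split mulr_sumr; apply: eq_bigr => i _.
by rewrite -big_split mulr_sumr; apply: eq_bigr => j _; rewrite mxE /=; ring.
Qed.

End Mollify.

(** * Comparison of random walks *)

Section Comparison.
Variables (R : realType) (k : nat).
Implicit Types (L : ('cV[R]_k -> R) -> R) (phi : 'cV[R]_k -> R) (x : 'cV[R]_k).

(** As [p] may be replaced by [- p], linear functions have no mean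
uncertainty: [L (dotv p) = L (dotv (- p)) = 0]. *)
Definition centred L := forall p, L (dotv p) <= 0.

Definition same_quad L1 L2 := forall Q : 'M[R]_k, Q \is symmetricmx ->
  L1 (fun x => dotv (Q *m x) x) = L2 (fun x => dotv (Q *m x) x).

Definition third_moment L := L (fun x => enorm x ^+ 3).

(** The size of the steps of a walk which reaches time 1 in [n] steps. *)
Definition scale n : R := (Num.sqrt n%:R)^-1.

Lemma scale_ge0 n : 0 <= scale n.
Proof. by rewrite invr_ge0 sqrtr_ge0. Qed.

Lemma sqr_scale n : scale n ^+ 2 = n%:R^-1.
Proof. by rewrite exprVn sqr_sqrtr. Qed.

Lemma scaleM n m : scale (n * m) = scale n * scale m.
Proof. by rewrite /scale natrM sqrtrM // invfM. Qed.

Lemma centred_add L f p a : sublin_law L -> centred L -> C_lLip f ->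
  L (fun y => f y + a * dotv p y) = L f.
Proof.
move=> LL L0 fC; apply: (law_add_null LL fC); first exact: C_lLipZ.
  by have := L0 (a *: p); congr (L _ <= _); apply/funext => y; rewrite dotvZl.
by have := L0 (- a *: p); congr (L _ <= _); apply/funext => y; rewrite dotvZl mulNr.
Qed.

(** The linear term of the expansion of [v] at [x] does not contribute because
[L] is centred, and the constant can be taken out; what remains is the
expectation of the quadratic term. *)
Lemma step_expansion L a C v x p Q : sublin_law L -> centred L -> 0 <= a -> 0 <= C ->
  C_lLip v ->
  (forall y, `|v (x + y) - (v x + dotv p y + 2^-1 * dotv (Q *m y) y)| <= C * enorm y ^+ 3) ->
  `|step L a v x - (v x + a ^+ 2 / 2 * L (fun y => dotv (Q *m y) y))| <=
  C * a ^+ 3 * third_moment L.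
Proof.
move=> LL L0 a0 C0 vC vE.
have a20 : 0 <= a ^+ 2 / 2 by rewrite divr_ge0 ?sqr_ge0.
have qC : C_lLip (fun y => a ^+ 2 / 2 * dotv (Q *m y) y) by apply: C_lLipZ.
have qcC : C_lLip (fun y => a ^+ 2 / 2 * dotv (Q *m y) y + v x) by apply: C_lLipD.
have PC : C_lLip (fun y => a ^+ 2 / 2 * dotv (Q *m y) y + v x + a * dotv p y).
  by apply: C_lLipD => //; apply: C_lLipZ.
have -> : v x + a ^+ 2 / 2 * L (fun y => dotv (Q *m y) y) =
    L (fun y => a ^+ 2 / 2 * dotv (Q *m y) y + v x + a * dotv p y).
  by rewrite centred_add // (law_addc LL) // (law_poshom LL) // addrC.
have C30 : 0 <= C * a ^+ 3 by rewrite mulr_ge0 ?exprn_ge0.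
have e3C : C_lLip (fun y : 'cV[R]_k => enorm y ^+ 3) by apply: C_lLipX.
rewrite -(law_poshom LL) //; apply: (law_dist LL) => //.
- exact: C_lLip_affine.
- exact: C_lLipZ.
move=> y; have := vE (a *: y); rewrite enormZ exprMn (ger0_norm a0) mulrA.
by rewrite dotvZr -scalemxAr dotvZl dotvZr; congr (Num.norm _ <= _); field.
Qed.

(** Lindeberg's method, with the walk itself in the place of a smooth solution
of the limiting equation. Let [u_j] be the expectation of [phi] after [j]
steps of the first walk and [A] a mollifier. By Jensen's inequality [A u_j+1]
dominates one step of the first walk from [A u_j]; as [A u_j] has bounded
third-order remainders, one step of the second walk gives the same up to a
multiple of [scale n ^+ 3], hence [n] steps up to a multiple of [scale n]. *)
Lemma walk_comparison K Lam eta : 0 <= K -> 0 <= Lam -> 0 < eta ->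
  exists n0, forall n, (n0 <= n)%N -> (0 < n)%N -> forall L1 L2 phi x,
    sublin_law L1 -> sublin_law L2 -> centred L1 -> centred L2 -> same_quad L1 L2 ->
    third_moment L1 <= K -> third_moment L2 <= K -> lip Lam phi ->
    iter n (step L2 (scale n)) phi x <= iter n (step L1 (scale n)) phi x + eta.
Proof.
move=> K0 Lam0 eta0.
pose D := 8 * (k%:R + 1) * (Lam + 1).
have D0 : 0 < D by rewrite !mulr_gt0 // ltr_wpDl.
have [e e0 eE] : exists2 e, 0 < e & e * D = eta.
  by exists (eta / D); rewrite ?divr_gt0 ?divfK ?gt_eqF.
have [A [HA AT]] := mollifier k e0; have [C C0 CP] := AT Lam Lam0.
set kap := 2 * k%:R * e in HA.
have kapLam : kap * Lam <= eta / 4.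
  rewrite -eE /D /kap.
  have H1 : 0 <= e * Lam by rewrite mulr_ge0 // ltW.
  have H2 : 0 <= k%:R * e :> R by rewrite mulr_ge0 // ltW.
  have H3 : 0 <= k%:R * e * Lam :> R by rewrite mulr_ge0.
  lra.
pose c := 4 * (C * K) / eta; have CK0 : 0 <= C * K by rewrite mulr_ge0.
have c0 : 0 <= c by rewrite divr_ge0 ?(ltW eta0) ?mulr_ge0.
exists (Num.truncn (c ^+ 2)).+1 => n le_n n0 L1 L2 phi x L1L L2L L10 L20 L12 L1K L2K phiL.
have n0R : 0 < n%:R :> R by rewrite ltr0n.
have sq0 : 0 < Num.sqrt n%:R :> R by rewrite sqrtr_gt0.
have le_c : c <= Num.sqrt n%:R.
  rewrite -(ler_pXn2r (n := 2)) ?nnegrE ?(ltW sq0) // sqr_sqrtr ?ler0n //.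
  by apply: le_trans (ltW (truncnS_gt _)) _; rewrite ler_nat.
set a := scale n; have a0 : 0 <= a by apply: scale_ge0.
have uL j : lip Lam (iter j (step L1 a) phi) by apply: lip_iter.
pose u j := iter j (step L1 a) phi.
pose err := 2 * (C * a ^+ 3 * K).
have one_step j y : step L2 a (A (u j)) y <= A (u j.+1) y + err.
  have AuC := lip_lLip Lam0 (avg_lip HA Lam0 (uL j)).
  apply: le_trans (_ : step L1 a (A (u j)) y + err <= _); last first.
    by rewrite lerD2r; apply: (avg_jensen HA _ _ L1L Lam0 (uL j)).
  have [p [Q [Qs QP]]] := CP _ y (uL j).
  have := step_expansion L1L L10 a0 C0 AuC QP.
  have := step_expansion L2L L20 a0 C0 AuC QP.
  rewrite L12 //.
  have Ca0 : 0 <= C * a ^+ 3 by rewrite mulr_ge0 ?exprn_ge0.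
  have := ler_wpM2l Ca0 L1K; have := ler_wpM2l Ca0 L2K.
  by rewrite !ler_norml /err => ? ? /andP[? ?] /andP[? ?]; lra.
have walk j y : iter j (step L2 a) (A phi) y <= A (u j) y + j%:R * err.
  elim: j y => [|j IHj] y; first by rewrite mul0r addr0.
  rewrite iterS; apply: le_trans (_ : step L2 a (A (u j)) y + j%:R * err <= _).
    apply: (law_le_add (step_law L2L a y)) => //.
      exact/(C_lLip_iter L2L)/(lip_lLip Lam0)/(avg_lip HA).
    exact: (lip_lLip Lam0 (avg_lip HA Lam0 (uL j))).
  by have := one_step j y; rewrite -natr1 mulrDl mul1r; lra.
have start : iter n (step L2 a) phi x <= iter n (step L2 a) (A phi) x + eta / 4.
  apply: (law_le_add (iter_step_law L2L n a x)).
  - exact: (lip_lLip Lam0 phiL).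
  - exact: (lip_lLip Lam0 (avg_lip HA Lam0 phiL)).
  move=> y; have := avg_near HA y Lam0 phiL; rewrite ler_norml => /andP[? _]; lra.
have := avg_near HA x Lam0 (uL n); rewrite ler_norml => /andP[_ finish].
have total : n%:R * err <= eta / 2.
  have -> : n%:R * err = 2 * (C * K) * a * (n%:R * a ^+ 2) by rewrite /err; ring.
  rewrite sqr_scale mulfV ?gt_eqF // mulr1 /a /scale ler_pdivrMr //.
  have : c * eta <= Num.sqrt n%:R * eta by rewrite ler_pM2r.
  by rewrite /c divfK ?gt_eqF //; lra.
have := walk n x; rewrite -/a -/(u n); rewrite -/(u n) in finish; lra.
Qed.

End Comparison.

(** * Uniqueness of the stable law with a given covariance function *)

Section Stable.
Variables (R : realType) (k : nat).
Implicit Types (L : ('cV[R]_k -> R) -> R) (phi : 'cV[R]_k -> R) (x : 'cV[R]_k).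

(** G-normality of a vector in terms of its law; the variable [y] is the
independent copy. *)
Definition stable L := forall a b phi, 0 <= a -> 0 <= b -> C_lLip phi ->
  L (fun x => L (fun y => phi (a *: x + b *: y))) =
  L (fun x => phi (Num.sqrt (a ^+ 2 + b ^+ 2) *: x)).

(** The value [L (dotv p)] is doubled when an independent copy is added, but
multiplied by [sqrt 2] according to stability. *)
Lemma stable_centred L : sublin_law L -> stable L -> centred L.
Proof.
move=> LL Ls p; have := Ls 1 1 (dotv p) ler01 ler01 (C_lLip_dotv p).
have -> : L (fun x => L (fun y => dotv p (1 *: x + 1 *: y))) = 2 * L (dotv p).
  transitivity (L (fun x => dotv p x + L (dotv p))).
    congr L; apply/funext => x; rewrite addrC -(law_addc LL) //.
    by congr L; apply/funext => y; rewrite !scale1r dotvDr addrC.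
  by rewrite (law_addc LL) // mulr2n mulrDl mul1r.
have -> : (fun x => dotv p (Num.sqrt (1 ^+ 2 + 1 ^+ 2) *: x)) =
    fun x => Num.sqrt 2 * dotv p x.
  by apply/funext => x; rewrite dotvZr expr1n.
rewrite (law_poshom LL) ?sqrtr_ge0 //.
move: (L _) => l /eqP; rewrite -subr_eq0 -mulrBl mulf_eq0 => /orP[|/eqP -> //].
rewrite subr_eq0 => /eqP /(congr1 (fun t => t ^+ 2)).
by rewrite sqr_sqrtr // => H; exfalso; lra.
Qed.

Lemma stable_step L a b phi x : stable L -> 0 <= a -> 0 <= b -> C_lLip phi ->
  step L a (step L b phi) x = step L (Num.sqrt (a ^+ 2 + b ^+ 2)) phi x.
Proof.
move=> Ls a0 b0 phiC.
have phixC : C_lLip (fun y => phi (x + y)).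
  by have := C_lLip_translate x phiC; congr C_lLip; apply/funext => y; rewrite addrC.
rewrite /step -(Ls a b _ a0 b0 phixC); congr L; apply/funext => y; congr L.
by apply/funext => z; rewrite addrA.
Qed.

Lemma step0 L phi : sublin_law L -> step L 0 phi = phi.
Proof.
move=> LL; apply/funext => x; rewrite /step -[RHS](law_const LL); congr L.
by apply/funext => y; rewrite scale0r addr0.
Qed.

Lemma stable_iter L n a phi x : sublin_law L -> stable L -> 0 <= a -> C_lLip phi ->
  iter n (step L a) phi x = step L (Num.sqrt n%:R * a) phi x.
Proof.
move=> LL Ls a0 phiC; elim: n x => [|n IHn] x.
  by rewrite sqrtr0 mul0r step0.
rewrite iterS (_ : iter n (step L a) phi = step L (Num.sqrt n%:R * a) phi); last first.
  exact/funext.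
rewrite stable_step // ?mulr_ge0 ?sqrtr_ge0 //; congr (step L _ phi x).
rewrite exprMn sqr_sqrtr // -{1}[a ^+ 2]mul1r -mulrDl sqrtrM ?addr_ge0 //.
by rewrite sqrtr_sqr ger0_norm // addrC natr1.
Qed.

Lemma stable_walk L n phi x : sublin_law L -> stable L -> (0 < n)%N -> C_lLip phi ->
  iter n (step L (scale R n)) phi x = step L 1 phi x.
Proof.
move=> LL Ls n0 phiC; rewrite stable_iter ?scale_ge0 // mulfV //.
by rewrite gt_eqF // sqrtr_gt0 ltr0n.
Qed.

(** The walks of both laws are close to each other by [walk_comparison], and by
stability they have the given laws. *)
Lemma stable_unique L1 L2 phi : sublin_law L1 -> sublin_law L2 ->
  stable L1 -> stable L2 -> same_quad L1 L2 -> C_lLip phi -> L1 phi = L2 phi.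
Proof.
move=> L1L L2L L1s L2s L12 phiC.
have third_ge0 L : sublin_law L -> 0 <= third_moment L.
  move=> LL; apply: (law_ge0 LL) => [|x]; first exact/C_lLipX.
  by rewrite exprn_ge0 ?enorm_ge0.
have half L L' : sublin_law L -> sublin_law L' -> stable L -> stable L' ->
    same_quad L L' -> L' phi <= L phi.
  move=> LL LL' Ls Ls' LL'q; apply: law_le_lip phiC => // Lam psi Lam0 psiL.
  apply/ler_addgt0Pr => e e0.
  have K0 := addr_ge0 (third_ge0 _ LL) (third_ge0 _ LL').
  have [n0 n0P] := walk_comparison k K0 Lam0 e0.
  have psiC := lip_lLip Lam0 psiL.
  have := n0P n0.+1 (leqnSn _) isT L L' psi 0 LL LL' (stable_centred LL Ls)
    (stable_centred LL' Ls') LL'q _ _ psiL.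
  rewrite !stable_walk // /step lerDl lerDr !third_ge0 // => /(_ isT isT).
  by congr (_ <= _ + e); congr (_ _); apply/funext => y; rewrite add0r scale1r.
by apply/eqP; rewrite eq_le !half // => Q Qs; rewrite L12.
Qed.

End Stable.

(** * A law with prescribed covariance function *)

Section Symmetric.
Variables (R : realType) (k : nat).
Implicit Types Q : 'M[R]_k.

Lemma symmetricP Q : Q \is symmetricmx <-> Q^T = Q.
Proof.
split=> [/is_hermitianmxP|QT].
  by rewrite expr0 scale1r => {2}->; apply/matrixP => i j; rewrite !mxE.
apply/is_hermitianmxP; rewrite expr0 scale1r; apply/matrixP => i j.
by rewrite -{1}QT !mxE.
Qed.

Lemma symmetric0 : (0 : 'M[R]_k) \is symmetricmx.
Proof. by apply/symmetricP; rewrite trmx0. Qed.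

Lemma symmetric1 : (1%:M : 'M[R]_k) \is symmetricmx.
Proof. by apply/symmetricP; rewrite trmx1. Qed.

Lemma symmetricD Q Q' : Q \is symmetricmx -> Q' \is symmetricmx -> Q + Q' \is symmetricmx.
Proof. by move=> /symmetricP QT /symmetricP QT'; apply/symmetricP; rewrite linearD /= QT QT'. Qed.

Lemma symmetricZ a Q : Q \is symmetricmx -> a *: Q \is symmetricmx.
Proof. by move=> /symmetricP QT; apply/symmetricP; rewrite linearZ /= QT. Qed.

End Symmetric.

Section Superhedging.
Variables (R : realType) (k : nat) (G : 'M[R]_k -> R).
Hypothesis G_sublin : monotone_sublinear G.
Implicit Types (p x y : 'cV[R]_k) (Q : 'M[R]_k) (phi : 'cV[R]_k -> R) (c : R).

Lemma cov0 : G 0 = 0.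
Proof.
case: G_sublin => _ GZ _.
by have := GZ 0 0 (lexx 0) (symmetric0 _ _); rewrite scale0r mul0r.
Qed.

Lemma covZ a Q : 0 <= a -> Q \is symmetricmx -> G (a *: Q) = a * G Q.
Proof. by case: G_sublin => _ GZ _; apply: GZ. Qed.

Lemma cov_mono Q Q' : Q \is symmetricmx -> Q' \is symmetricmx ->
  (forall x, dotv (Q *m x) x <= dotv (Q' *m x) x) -> G Q <= G Q'.
Proof.
case: G_sublin => _ _ GM Qs Q's QQ'; apply: GM => // x.
by rewrite mulmxBl dotvDl dotvNl subr_ge0.
Qed.

Lemma cov1_ge0 : 0 <= G 1%:M.
Proof.
rewrite -cov0; apply: cov_mono; rewrite ?symmetric0 ?symmetric1 // => x.
by rewrite mul0mx mul1mx dotv0l dotv_ge0.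
Qed.

(** The support of the law is the ball of this radius, which is large enough
for quadratic functions to be priced correctly; see [hedge_cost_quad]. *)
Definition hedge_radius : R := Num.sqrt (2 * G 1%:M + 1).

Lemma sqr_hedge_radius : hedge_radius ^+ 2 = 2 * G 1%:M + 1.
Proof. by rewrite sqr_sqrtr //; have := cov1_ge0; lra. Qed.

Lemma hedge_radius_gt0 : 0 < hedge_radius.
Proof. by rewrite sqrtr_gt0; have := cov1_ge0; lra. Qed.

Definition hedges c p Q phi : Prop :=
  Q \is symmetricmx /\ forall y, enorm y <= hedge_radius ->
    phi y <= c + dotv p y + 2^-1 * dotv (Q *m y) y.

(** The cheapest superhedging price of [phi], when linear claims are free and
the claim [<Qy, y>/2] costs [G Q]. *)
Definition hedge_law phi : R :=
  inf [set r | exists c p Q, hedges c p Q phi /\ r = c + G Q]%classic.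

(** Without the restriction to a ball this would be monotonicity of [G]. On the
ball, averaging over [y] and [- y] gives [Q0 - Q <= (2 c / rho^2) I], and
[G ((2 c / rho^2) I) <= c] by the choice of the radius [rho]. *)
Lemma hedge_cost_quad c p Q Q0 : Q0 \is symmetricmx ->
  hedges c p Q (fun y => 2^-1 * dotv (Q0 *m y) y) -> G Q0 <= c + G Q.
Proof.
move=> Q0s [Qs hQ]; set rho := hedge_radius in hQ.
have rho0 : 0 < rho := hedge_radius_gt0.
pose D := Q0 - Q.
have Ds : D \is symmetricmx by rewrite /D -scaleN1r symmetricD ?symmetricZ.
have c0 : 0 <= c.
  have := hQ 0; rewrite enorm0 !mulmx0 !dotv0r !mulr0 !addr0; apply; exact: ltW.
have Dle y : enorm y <= rho -> dotv (D *m y) y <= 2 * c.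
  move=> yle; have := hQ y yle; have := hQ (- y); rewrite enormN => /(_ yle).
  by rewrite !mulmxN !dotvNl !dotvNr !opprK /D mulmxBl dotvDl dotvNl; lra.
pose b := 2 * c / rho ^+ 2.
have b0 : 0 <= b by rewrite divr_ge0 ?sqr_ge0 ?mulr_ge0.
have DI : G D <= b * G 1%:M.
  rewrite -covZ ?symmetric1 //; apply: cov_mono; rewrite ?symmetricZ ?symmetric1 // => x.
  rewrite -scalemxAl mul1mx dotvZl -sqr_enorm.
  have := enorm_ge0 x; rewrite le_eqVlt => /orP[/eqP x0|x0].
    rewrite -x0 expr0n mulr0.
    have /dotv_eq0 -> : dotv x x = 0 by rewrite -sqr_enorm -x0 expr0n.
    by rewrite mulmx0 dotv0r.
  have := Dle ((rho / enorm x) *: x); rewrite enormZ.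
  rewrite (ger0_norm (ltW (divr_gt0 rho0 x0))) divfK ?gt_eqF // => /(_ (lexx _)).
  rewrite -scalemxAr dotvZl dotvZr mulrA -expr2 expr_div_n.
  rewrite mulrAC ler_pdivrMr ?exprn_gt0 // mulrC -ler_pdivlMr ?exprn_gt0 //.
  by move=> /le_trans; apply; rewrite /b le_eqVlt; apply/orP; left; apply/eqP; ring.
have bc : b * G 1%:M <= c.
  rewrite /b mulrAC ler_pdivrMr ?exprn_gt0 // sqr_hedge_radius.
  have := cov1_ge0; nra.
have : G Q0 <= G Q + G D.
  by case: G_sublin => GD _ _; have := GD Q D Qs Ds; rewrite /D addrC subrK.
lra.
Qed.

Lemma hedge_law_le c p Q phi : C_lLip phi -> hedges c p Q phi -> hedge_law phi <= c + G Q.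
Proof.
move=> phiC hQ; apply: ge_inf; last by exists c, p, Q.
have [C [q [C0 Cq]]] := C_lLip_growth phiC.
pose B := C * (1 + hedge_radius) ^+ q.
exists (- B) => _ [c' [p' [Q' [[Q's hQ'] ->]]]].
have : G 0 <= (c' + B) + G Q'.
  apply: (@hedge_cost_quad _ p'); rewrite ?symmetric0 //; split=> // y yle.
  rewrite mul0mx dotv0l mulr0.
  have : - B <= phi y.
    have : `|phi y| <= B.
      apply: le_trans (Cq y) _; rewrite ler_wpM2l //.
      have y0 := enorm_ge0 y; have r0 := hedge_radius_gt0.
      by rewrite lerXn2r ?nnegrE; lra.
    by rewrite ler_norml => /andP[].
  by have := hQ' y yle; lra.
rewrite cov0; lra.
Qed.

Lemma le_hedge_law phi l : C_lLip phi ->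
  (forall c p Q, hedges c p Q phi -> l <= c + G Q) -> l <= hedge_law phi.
Proof.
move=> phiC lP; apply: lb_le_inf; last by move=> _ [c [p [Q [/lP + ->]]]].
have [C [q [C0 Cq]]] := C_lLip_growth phiC.
exists (C * (1 + hedge_radius) ^+ q + G 0), (C * (1 + hedge_radius) ^+ q), 0, 0.
split=> //; split=> [|y yle]; first exact: symmetric0.
rewrite mul0mx !dotv0l mulr0 !addr0.
apply: le_trans (ler_norm _) _; apply: le_trans (Cq y) _; rewrite ler_wpM2l //.
have y0 := enorm_ge0 y; have r0 := hedge_radius_gt0.
by rewrite lerXn2r ?nnegrE; lra.
Qed.

Lemma hedge_law_const c : hedge_law (fun=> c) = c.
Proof.
apply/eqP; rewrite eq_le; apply/andP; split.
  have := @hedge_law_le c 0 0 (fun=> c); rewrite cov0 addr0; apply=> //.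
  by split=> [|y _]; rewrite ?symmetric0 // mul0mx !dotv0l mulr0 !addr0.
apply: le_hedge_law => // c' p Q [Qs hQ].
have : G 0 <= (c' - c) + G Q.
  apply: (@hedge_cost_quad _ p); rewrite ?symmetric0 //; split=> // y yle.
  by rewrite mul0mx dotv0l mulr0; have := hQ y yle; lra.
rewrite cov0; lra.
Qed.

Lemma hedge_law_sublin : sublin_law hedge_law.
Proof.
split=> [f g fC gC le_fg|c|f g fC gC|a f].
- apply: le_hedge_law => // c p Q [Qs hQ]; apply: (@hedge_law_le c p) => //.
  by split=> // y /hQ; apply: le_trans.
- exact: hedge_law_const.
- rewrite -lerBlDr; apply: le_hedge_law => // c p Q [Qs hQ].
  rewrite lerBlDr -lerBlDl; apply: le_hedge_law => // c' p' Q' [Q's hQ'].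
  rewrite lerBlDl; apply: le_trans (_ : (c + c') + G (Q + Q') <= _).
    apply: (@hedge_law_le _ (p + p')); first exact: C_lLipD.
    split=> [|y yle]; first exact: symmetricD.
    by have := hQ y yle; have := hQ' y yle; rewrite mulmxDl !dotvDl; lra.
  by case: G_sublin => GD _ _; have := GD Q Q' Qs Q's; lra.
- rewrite le_eqVlt => /orP[/eqP <-|a0] fC.
    under eq_fun => x do rewrite mul0r.
    by rewrite hedge_law_const mul0r.
  have scale b g : 0 < b -> C_lLip g -> hedge_law (fun x => b * g x) <= b * hedge_law g.
    move=> b0 gC; rewrite mulrC -ler_pdivrMr //.
    apply: le_hedge_law => // c p Q [Qs hQ]; rewrite ler_pdivrMr // mulrC mulrDr.
    rewrite -covZ ?(ltW b0) //; apply: (@hedge_law_le _ (b *: p)); first exact: C_lLipZ.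
    split=> [|y yle]; first exact: symmetricZ.
    have := hQ y yle; rewrite -(ler_pM2l b0) dotvZl -scalemxAl dotvZl => /le_trans.
    by apply; rewrite le_eqVlt; apply/orP; left; apply/eqP; ring.
  apply/eqP; rewrite eq_le scale //=.
  have := scale a^-1 (fun x => a * f x); rewrite invr_gt0 => /(_ a0 (C_lLipZ a fC)).
  have -> : (fun x => a^-1 * (a * f x)) = f.
    by apply/funext => x; rewrite mulKf ?gt_eqF.
  by rewrite mulrC ler_pdivlMr // mulrC.
Qed.

Lemma hedge_law_centred : centred hedge_law.
Proof.
move=> p; have := @hedge_law_le 0 p 0 (dotv p) (C_lLip_dotv p).
rewrite cov0 addr0; apply; split=> [|y _]; first exact: symmetric0.
by rewrite mul0mx dotv0l mulr0 add0r addr0.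
Qed.

Lemma hedge_law_quad Q : Q \is symmetricmx ->
  hedge_law (fun y => dotv (Q *m y) y) = 2 * G Q.
Proof.
move=> Qs; have Q2s : 2 *: Q \is symmetricmx by apply: symmetricZ.
have QE y : dotv (Q *m y) y = 2^-1 * dotv ((2 *: Q) *m y) y.
  by rewrite -scalemxAl dotvZl mulKf // pnatr_eq0.
apply/eqP; rewrite eq_le -covZ //; apply/andP; split.
  have := @hedge_law_le 0 0 (2 *: Q) (fun y => dotv (Q *m y) y) (C_lLip_quad Q).
  by rewrite add0r; apply; split=> // y _; rewrite dotv0l !add0r -QE.
apply: le_hedge_law => // c p Q' [Q's hQ]; apply: (@hedge_cost_quad _ p) => //.
by split=> // y yle; rewrite -QE; apply: hQ.
Qed.

(** Moments are controlled as for a Gaussian walk because the increments are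
bounded: up to an error of order [a^2], relative to its value at [x], the
function [moment_fun q] is affine in the increment. *)
Lemma hedge_law_moment q : exists2 K, 0 <= K & forall a x, 0 <= a <= 1 ->
  step hedge_law a (moment_fun q) x <= (1 + K * a ^+ 2) * moment_fun q x.
Proof.
have r0 := hedge_radius_gt0; set rho := hedge_radius in r0.
(* bs + g stands for the relative change of 1 + |x|^2, where bs is of the first
   and g of the second order in the increment *)
have [K K0 KP] : exists2 K, 0 <= K & forall bs g s : R, 0 <= s <= rho ->
    `|bs| <= s -> 0 <= g <= s ^+ 2 -> `|(1 + bs + g) ^+ q - 1 - q%:R * bs| <= K * s ^+ 2.
  elim: q => [|q [K K0 KP]].
    by exists 0 => // bs g s _ _ _; rewrite expr0 subrr mul0r subr0 normr0 mul0r.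
  exists (K * (1 + rho + rho ^+ 2) + q%:R * (1 + rho) + 1).
    have q0 : 0 <= q%:R :> R by [].
    have := sqr_ge0 rho; nra.
  move=> bs g s sP bsP gP; have := KP bs g s sP bsP gP.
  set d := (1 + bs + g) ^+ q - 1 - q%:R * bs => dP.
  case/andP: sP => s0 s_rho; case/andP: gP => g0 gs.
  have -> : (1 + bs + g) ^+ q.+1 - 1 - q.+1%:R * bs =
      d * (1 + bs + g) + q%:R * bs * (bs + g) + g.
    by rewrite exprS -natr1 /d; ring.
  have s2_rho2 : s ^+ 2 <= rho ^+ 2 by rewrite lerXn2r ?nnegrE ?(ltW r0).
  have H1 : `|d * (1 + bs + g)| <= K * (1 + rho + rho ^+ 2) * s ^+ 2.
    rewrite normrM mulrAC; apply: ler_pM => //.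
    by move: bsP; rewrite !ler_norml => /andP[? ?]; apply/andP; split; lra.
  have H2 : `|q%:R * bs * (bs + g)| <= q%:R * (1 + rho) * s ^+ 2.
    rewrite -mulrA normrM ger0_norm // -mulrA ler_wpM2l // normrM.
    have -> : (1 + rho) * s ^+ 2 = s * (s * (1 + rho)) by ring.
    apply: ler_pM => //; apply: le_trans (ler_normD _ _) _; rewrite (ger0_norm g0).
    nra.
  have := ler_normD (d * (1 + bs + g) + q%:R * bs * (bs + g)) g.
  have := ler_normD (d * (1 + bs + g)) (q%:R * bs * (bs + g)).
  rewrite (ger0_norm g0); lra.
exists (K * rho ^+ 2) => [|a x /andP[a0 a1]]; first by rewrite mulr_ge0 ?sqr_ge0.
set m := 1 + enorm x ^+ 2; have m1 : 1 <= m by rewrite lerDl sqr_ge0.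
have m0 : 0 < m by lra.
have mq0 : 0 <= m ^+ q by rewrite exprn_ge0 // ltW.
rewrite /moment_fun -/m.
have := @hedge_law_le ((1 + K * rho ^+ 2 * a ^+ 2) * m ^+ q)
  ((m ^+ q * q%:R * a * 2 / m) *: x) 0 (fun y => moment_fun q (x + a *: y)).
rewrite cov0 addr0; apply; first exact: C_lLip_affine.
split=> [|y yle]; first exact: symmetric0.
rewrite mul0mx dotv0l mulr0 addr0 dotvZl /moment_fun.
have x0 := enorm_ge0 x; have y0 := enorm_ge0 y.
pose bs := a * 2 * dotv x y / m; pose g := a ^+ 2 * enorm y ^+ 2 / m.
have mE : 1 + enorm (x + a *: y) ^+ 2 = m * (1 + bs + g).
  have -> : m * (1 + bs + g) = m + a * 2 * dotv x y + a ^+ 2 * enorm y ^+ 2.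
    by rewrite /bs /g; field; rewrite gt_eqF.
  rewrite /m !sqr_enorm dotvDl !dotvDr !dotvZl !dotvZr (dotvC y x); ring.
have sP : 0 <= a * rho <= rho.
  by rewrite mulr_ge0 ?(ltW r0) //= -[leRHS]mul1r ler_wpM2r ?(ltW r0).
have bsP : `|bs| <= a * rho.
  have := cauchy_schwarz x y; rewrite /bs normrM normfV (gtr0_norm m0) => cs.
  rewrite ler_pdivrMr // normrM ger0_norm; last by rewrite mulr_ge0.
  have H : `|dotv x y| <= enorm x * rho by apply: le_trans cs _; rewrite ler_wpM2l.
  have H' : 2 * (enorm x * rho) <= rho * m.
    have : 0 <= rho * (1 - enorm x) ^+ 2 by rewrite mulr_ge0 ?sqr_ge0 ?(ltW r0).
    by rewrite /m sqrrB; lra.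
  rewrite -!mulrA ler_wpM2l //; lra.
have gP : 0 <= g <= (a * rho) ^+ 2.
  apply/andP; split; first by rewrite divr_ge0 ?(ltW m0) ?mulr_ge0 ?sqr_ge0.
  rewrite /g ler_pdivrMr // exprMn -[leLHS]mulr1.
  apply: ler_pM => //; first by rewrite mulr_ge0 ?sqr_ge0.
  by rewrite ler_wpM2l ?sqr_ge0 // lerXn2r ?nnegrE ?(ltW r0).
have := KP bs g (a * rho) sP bsP gP; rewrite ler_norml => /andP[_ H].
rewrite mE exprMn.
have -> : (1 + K * rho ^+ 2 * a ^+ 2) * m ^+ q + m ^+ q * q%:R * a * 2 / m * dotv x y =
    m ^+ q * (1 + q%:R * bs + K * (a * rho) ^+ 2).
  by rewrite /bs; field; rewrite gt_eqF.
by rewrite ler_wpM2l //; lra.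
Qed.

End Superhedging.

(** * The central limit theorem *)

Lemma subr_sqrt_le (R : realType) (s t : R) : 0 <= s -> s <= t ->
  Num.sqrt t - Num.sqrt s <= Num.sqrt (t - s).
Proof.
move=> s0 le_st; have t0 : 0 <= t by lra.
have ts0 : 0 <= t - s by lra.
rewrite lerBlDr -(ler_pXn2r (n := 2)) ?nnegrE ?addr_ge0 ?sqrtr_ge0 //.
have := sqrtr_ge0 (t - s); have := sqrtr_ge0 s.
rewrite sqrrD !sqr_sqrtr //; nra.
Qed.

Section CentralLimit.
Variables (R : realType) (k : nat) (L0 : ('cV[R]_k -> R) -> R).
Hypothesis L0_law : sublin_law L0.
Hypothesis L0_centred : centred L0.
Hypothesis L0_moment : forall q, exists2 K, 0 <= K & forall a x, 0 <= a <= 1 ->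
  step L0 a (moment_fun q) x <= (1 + K * a ^+ 2) * moment_fun q x.
Implicit Types (phi psi : 'cV[R]_k -> R) (x y : 'cV[R]_k) (Lam : R).

(** The law of [(X_1 + ... + X_n) / sqrt n] for independent steps [X_i]. *)
Definition walk n phi : R := iter n (step L0 (scale R n)) phi 0.

Lemma walk_law n : sublin_law (walk n).
Proof. exact: iter_step_law. Qed.

Lemma walk_centred n : centred (walk n).
Proof.
move=> p; rewrite le_eqVlt; apply/orP; left; apply/eqP; rewrite /walk.
suff walkE j a x : iter j (step L0 a) (dotv p) x = dotv p x by rewrite walkE dotv0r.
elim: j x => //= j IHj x; rewrite /step; under eq_fun => y do rewrite IHj dotvDr dotvZr.
by rewrite centred_add // (law_const L0_law).
Qed.

(** A step of size [a] adds the constant [a ^+ 2 * L0 <Q y, y>] to a quadratic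
form; the cross term is linear in the increment. *)
Lemma walk_quad n (Q : 'M[R]_k) : (0 < n)%N ->
  walk n (fun x => dotv (Q *m x) x) = L0 (fun x => dotv (Q *m x) x).
Proof.
move=> n0; set l := L0 _; pose a := scale R n.
suff walkE j x : iter j (step L0 a) (fun x => dotv (Q *m x) x) x =
    dotv (Q *m x) x + j%:R * (a ^+ 2 * l).
  rewrite /walk walkE dotv0r add0r sqr_scale mulrA mulfV ?mul1r //.
  by rewrite pnatr_eq0 -lt0n.
elim: j x => [|j IHj] x; first by rewrite mul0r addr0.
rewrite iterS /step; transitivity (L0 (fun y => a ^+ 2 * dotv (Q *m y) y +
    (dotv (Q *m x) x + j%:R * (a ^+ 2 * l)) + a * dotv (Q^T *m x + Q *m x) y)).
  congr L0; apply/funext => y; rewrite IHj.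
  rewrite mulmxDr dotvDl !dotvDr -scalemxAr !dotvZl !dotvZr dotvDl.
  by rewrite (dotv_trmx Q y x) (dotvC y); ring.
rewrite centred_add //; last by apply: C_lLipD => //; apply: C_lLipZ.
rewrite (law_addc L0_law); last exact: C_lLipZ.
by rewrite (law_poshom L0_law) ?sqr_ge0 // -/l -natr1; ring.
Qed.

Lemma scale_le1 n : (0 < n)%N -> scale R n <= 1.
Proof.
move=> n0; rewrite -(ler_pXn2r (n := 2)) ?nnegrE ?scale_ge0 // sqr_scale expr1n.
by rewrite invf_le1 ?ltr0n // ler1n.
Qed.

Lemma walk_moment q : exists M, forall n, (0 < n)%N -> walk n (moment_fun q) <= M.
Proof.
have [K K0 KP] := L0_moment q; exists (expR K) => n n0; pose a := scale R n.
have a01 : 0 <= a <= 1 by rewrite scale_ge0 scale_le1.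
have Ka0 : 0 <= 1 + K * a ^+ 2 by rewrite addr_ge0 // mulr_ge0 // sqr_ge0.
have walkE j x : iter j (step L0 a) (moment_fun q) x <= (1 + K * a ^+ 2) ^+ j * moment_fun q x.
  elim: j x => [|j IHj] x; first by rewrite mul1r.
  rewrite iterS exprSr -mulrA.
  apply: le_trans (ler_wpM2l (exprn_ge0 j Ka0) (KP a x a01)).
  rewrite -(law_poshom (step_law L0_law a x)) ?exprn_ge0 //.
  apply: (law_le (step_law L0_law a x)) => //; first exact: C_lLip_iter.
  exact: C_lLipZ.
apply: le_trans (walkE n 0) _; rewrite /moment_fun enorm0 expr0n addr0 expr1n mulr1.
have n0R : n%:R != 0 :> R by rewrite pnatr_eq0 -lt0n.
have -> : expR K = expR (K * a ^+ 2) ^+ n.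
  by rewrite -expRM_natl sqr_scale mulrCA mulfV // mulr1.
by rewrite lerXn2r ?nnegrE ?expR_ge0 ?expR_ge1Dx.
Qed.

Lemma iter_step_walk n j b phi x :
  iter j (step (walk n) b) phi x = iter (j * n) (step L0 (b * scale R n)) phi x.
Proof.
elim: j x => [|j IHj] x //=; rewrite mulSn iterD.
rewrite -(_ : iter j (step (walk n) b) phi = iter (j * n) (step L0 (b * scale R n)) phi); last first.
  exact/funext.
by rewrite /step /walk iter_step_affine scaler0 addr0.
Qed.

Lemma walk1 phi : walk 1 phi = L0 phi.
Proof.
rewrite /walk /= /step /scale sqrtr1 invr1; congr L0; apply/funext => y.
by rewrite add0r scale1r.
Qed.

(** Walks with steps of law [L0] and of law [walk m] have the same covariance,
and [n] of the latter are [n * m] of the former. *)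
Lemma walk_lip_cauchy Lam e : 0 <= Lam -> 0 < e ->
  exists n0, forall n m, (n0 <= n)%N -> (0 < n)%N -> (0 < m)%N ->
    forall phi, lip Lam phi -> `|walk n phi - walk (n * m) phi| <= e.
Proof.
move=> Lam0 e0; have [M MP] := walk_moment 2.
have M0 : 0 <= M.
  apply: le_trans (MP 1%N isT); apply: (law_ge0 (walk_law _)) => // x.
  exact: le_trans (moment_ge1 _ _).
have third m : (0 < m)%N -> third_moment (walk m) <= M.
  move=> m0; apply: le_trans (MP m m0); apply: (law_le (walk_law _)) => // [|x].
    exact/C_lLipX.
  have x0 := enorm_ge0 x; rewrite /moment_fun.
  have [x1|/ltW x1] := lerP (enorm x) 1.
    apply: le_trans (_ : 1 <= _); first exact: exprn_ile1.
    by apply: weight_ge1; rewrite lerDl sqr_ge0.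
  apply: le_trans (_ : enorm x ^+ 4 <= _); first exact: ler_weXn2l.
  by rewrite (exprM _ 2 2) lerXn2r ?nnegrE ?addr_ge0 ?sqr_ge0 // lerDr.
have [n0 n0P] := walk_comparison k M0 Lam0 e0.
exists n0 => n m le_n n_gt0 m0 phi phiL.
have L0E : walk 1 = L0 by apply/funext => psi; rewrite walk1.
have L0K : third_moment L0 <= M by rewrite -L0E third.
have quadE : same_quad L0 (walk m) by move=> Q _; rewrite walk_quad.
have nmE : iter n (step (walk m) (scale R n)) phi 0 = walk (n * m) phi.
  by rewrite iter_step_walk -scaleM.
have := n0P n le_n n_gt0 L0 (walk m) phi 0 L0_law (walk_law m) L0_centred
  (walk_centred m) quadE L0K (third m m0) phiL.
have := n0P n le_n n_gt0 (walk m) L0 phi 0 (walk_law m) L0_law (walk_centred m)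
  L0_centred (fun Q Qs => esym (quadE Q Qs)) (third m m0) L0K phiL.
by rewrite nmE -/(walk n phi) ler_norml => H1 H2; apply/andP; split; lra.
Qed.

Definition lim_law phi : R := limn (fun n => walk n phi).

Lemma walk_cvg phi : C_lLip phi -> cvgn (fun n => walk n phi).
Proof.
move=> phiC; apply: cauchy_mul_cvgn => e e0.
have [q phiA] := C_lLip_approx phiC; have [M MP] := walk_moment q.
have M0 : 0 < M.
  apply: lt_le_trans (MP 1%N isT); apply: lt_le_trans ltr01 _.
  rewrite -[leLHS](law_const (walk_law 1)); apply: (law_le (walk_law _)) => // x.
  exact: moment_ge1.
have eM0 : 0 < e / (3 * M) by rewrite divr_gt0 // mulr_gt0.
have e30 : 0 < e / 3 by rewrite divr_gt0.
have [Lam [psi [Lam0 psiL dpsi]]] := phiA _ eM0.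
have psiC := lip_lLip Lam0 psiL.
have near n : (0 < n)%N -> `|walk n phi - walk n psi| <= e / 3.
  move=> n0; have := law_moment_dist (walk_law n) (ltW eM0) phiC psiC dpsi.
  move=> /le_trans; apply; apply: le_trans (ler_wpM2l (ltW eM0) (MP n n0)) _.
  by rewrite le_eqVlt; apply/orP; left; apply/eqP; field; rewrite gt_eqF.
have [n0 n0P] := walk_lip_cauchy Lam0 e30.
exists n0 => n m le_n n_gt0 m0; have nm0 : (0 < n * m)%N by rewrite muln_gt0 n_gt0.
have := n0P n m le_n n_gt0 m0 psi psiL; have := near n n_gt0; have := near _ nm0.
rewrite !ler_norml => /andP[? ?] /andP[? ?] /andP[? ?].
by apply/andP; split; lra.
Qed.

Lemma lim_law_sublin : sublin_law lim_law.
Proof.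
split=> [f g fC gC le_fg|c|f g fC gC|a f a0 fC].
- apply: ler_lim; do ?exact: walk_cvg.
  by apply: nearW => n; apply: (law_le (walk_law n)).
- by apply: lim_near_cst => //; apply: nearW => n; apply: (law_const (walk_law n)).
- rewrite -limD; do ?exact: walk_cvg.
  apply: ler_lim; [exact/walk_cvg/C_lLipD|apply: is_cvgD; exact: walk_cvg|].
  by apply: nearW => n; apply: (law_subadd (walk_law n)).
- apply: cvg_lim => //.
  rewrite (_ : (fun n => _) = fun n => a * walk n f); last first.
    by apply/funext => n; apply: (law_poshom (walk_law n)).
  by apply: cvgM; [exact: cvg_cst|exact: walk_cvg].
Qed.

Lemma lim_law_quad (Q : 'M[R]_k) :
  lim_law (fun x => dotv (Q *m x) x) = L0 (fun x => dotv (Q *m x) x).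
Proof. by apply: lim_near_cst => //; exists 1%N => // n /=; apply: walk_quad. Qed.

Lemma lim_law_rate Lam e : 0 <= Lam -> 0 < e -> exists n0, forall n, (n0 <= n)%N ->
  (0 < n)%N -> forall phi, lip Lam phi -> `|walk n phi - lim_law phi| <= e.
Proof.
move=> Lam0 e0; have [n0 n0P] := walk_lip_cauchy Lam0 e0.
exists n0 => n le_n n_gt0 phi phiL; apply: limn_dist_mul => // [|m m0].
  exact/walk_cvg/(lip_lLip Lam0).
exact: n0P.
Qed.

Lemma lim_law_step_rate Lam e p r : 0 <= Lam -> 0 < e -> (0 < r)%N ->
  exists n0, forall n, (n0 <= n)%N -> (0 < n)%N -> forall phi x, lip Lam phi ->
    `|iter (p * n) (step L0 (scale R (r * n))) phi x -
      step lim_law (Num.sqrt p%:R * scale R r) phi x| <= e.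
Proof.
move=> Lam0 e0 r0; have [->|p0] := posnP p.
  exists 0%N => n _ _ phi x _; rewrite mul0n sqrtr0 mul0r step0 ?subrr ?normr0 ?(ltW e0) //.
  exact: lim_law_sublin.
set b := Num.sqrt p%:R * scale R r; have b0 : 0 <= b by rewrite mulr_ge0 ?sqrtr_ge0 ?scale_ge0.
have [n0 n0P] := lim_law_rate (mulr_ge0 Lam0 b0) e0.
exists n0 => n le_n n_gt0 phi x phiL; have pn0 : (0 < p * n)%N by rewrite muln_gt0 p0.
have psiL : lip (Lam * b) (fun y => phi (x + b *: y)).
  move=> y z; apply: le_trans (phiL _ _) _.
  by rewrite opprD addrACA subrr add0r -scalerBr enormZ ger0_norm // mulrA.
have := n0P _ (leq_trans le_n (leq_pmull n p0)) pn0 _ psiL.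
rewrite /walk iter_step_affine scaler0 addr0 /step.
have -> : b * scale R (p * n) = scale R (r * n).
  rewrite !scaleM /b {2}/scale; field.
  by rewrite gt_eqF // sqrtr_gt0 ltr0n.
by [].
Qed.

(** With [r * n] steps per unit of time, the times [p / r] and [q / r] are reached
after [p * n] and [q * n] steps of one and the same walk. *)
Lemma lim_law_stable_rat Lam phi x p q r : 0 <= Lam -> lip Lam phi -> (0 < r)%N ->
  step lim_law (Num.sqrt p%:R * scale R r) (step lim_law (Num.sqrt q%:R * scale R r) phi) x =
  step lim_law (Num.sqrt (p + q)%:R * scale R r) phi x.
Proof.
move=> Lam0 phiL r0; have LL := lim_law_sublin.
apply/eqP; rewrite -subr_eq0 -normr_le0; apply/ler_addgt0Pr => e e0; rewrite add0r.
have e30 : 0 < e / 3 by rewrite divr_gt0.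
have [n1 H1] := lim_law_step_rate p Lam0 e30 r0.
have [n2 H2] := lim_law_step_rate q Lam0 e30 r0.
have [n3 H3] := lim_law_step_rate (p + q)%N Lam0 e30 r0.
pose n := (n1 + n2 + n3).+1; set u := step lim_law (_ * _) phi.
have uL : lip Lam u by apply: lip_step.
have le1 : (n1 <= n)%N by rewrite /n -addnA ltnW // ltnS leq_addr.
have le2 : (n2 <= n)%N by rewrite /n -addnA ltnW // ltnS addnCA leq_addr.
have le3 : (n3 <= n)%N by rewrite /n ltnW // ltnS leq_addl.
have := H1 n le1 isT u x uL; have := H3 n le3 isT phi x phiL.
have : `|iter (p * n) (step L0 (scale R (r * n))) (iter (q * n) (step L0 (scale R (r * n))) phi) x
    - iter (p * n) (step L0 (scale R (r * n))) u x| <= e / 3.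
  apply: (law_sup_dist (iter_step_law L0_law _ _ x)).
  - exact/(C_lLip_iter L0_law)/(lip_lLip Lam0).
  - exact: lip_lLip uL.
  - by move=> y; apply: H2.
rewrite -iterD -mulnDl !ler_norml => /andP[? ?] /andP[? ?] /andP[? ?].
by apply/andP; split; lra.
Qed.

Lemma lim_law_stable_lip Lam a b phi x : 0 <= Lam -> lip Lam phi -> 0 <= a -> 0 <= b ->
  step lim_law a (step lim_law b phi) x =
  step lim_law (Num.sqrt (a ^+ 2 + b ^+ 2)) phi x.
Proof.
move=> Lam0 phiL a0 b0; have LL := lim_law_sublin.
have chain (u v w z e : R) : `|u - v| <= e -> `|v - w| <= e -> `|z - w| <= 2 * e ->
    `|u - z| <= 4 * e.
  rewrite !ler_norml => /andP[? ?] /andP[? ?] /andP[? ?].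
  by apply/andP; split; lra.
set M := lim_law (@enorm R k).
have M0 : 0 <= M by apply: (law_ge0 LL) => // y; apply: enorm_ge0.
apply/eqP; rewrite -subr_eq0 -normr_le0.
apply: (@ler_div_nat _ _ _ (4 * (Lam * M))) => n n0; rewrite add0r.
(* approximation at the times that are multiples of 1 / n^2 *)
pose r := (n * n)%N; have r0 : (0 < r)%N by rewrite muln_gt0 n0.
have r0R : 0 < r%:R :> R by rewrite ltr0n.
have rE : scale R r = n%:R^-1.
  by rewrite /r scaleM -expr2 sqr_scale.
have approx (s t : R) (p : nat) c : 0 <= t -> 0 <= c -> p%:R <= t * r%:R -> t * r%:R <= p%:R + c ^+ 2 ->
    s = Num.sqrt t -> `|s - Num.sqrt p%:R * scale R r| <= c / n%:R.
  move=> t0 c0 le1 le2 ->.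
  have -> : Num.sqrt p%:R * scale R r = Num.sqrt (p%:R / r%:R).
    by rewrite sqrtrM // sqrtrV ?ler0n.
  have prt : p%:R / r%:R <= t by rewrite ler_pdivrMr.
  have pr0 : 0 <= p%:R / r%:R :> R by rewrite divr_ge0.
  rewrite ger0_norm; last by rewrite subr_ge0 ler_sqrt.
  apply: le_trans (subr_sqrt_le pr0 prt) _.
  rewrite -[leRHS]ger0_norm ?divr_ge0 // -sqrtr_sqr ler_sqrt ?sqr_ge0 //.
  rewrite expr_div_n -natrX -[(n ^ 2)%N]/r lerBlDr -mulrDl ler_pdivlMr // addrC; lra.
pose p := Num.truncn (a ^+ 2 * r%:R); pose q := Num.truncn (b ^+ 2 * r%:R).
have /andP[p1 p2] := truncn_itv (mulr_ge0 (sqr_ge0 a) (ler0n R r)).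
have /andP[q1 q2] := truncn_itv (mulr_ge0 (sqr_ge0 b) (ler0n R r)).
rewrite -/p -natr1 in p1 p2; rewrite -/q -natr1 in q1 q2.
have Ha : `|a - Num.sqrt p%:R * scale R r| <= 1 / n%:R.
  apply: (approx _ (a ^+ 2)); rewrite ?sqr_ge0 ?expr1n ?(ltW p2) //.
  by rewrite sqrtr_sqr ger0_norm.
have Hb : `|b - Num.sqrt q%:R * scale R r| <= 1 / n%:R.
  apply: (approx _ (b ^+ 2)); rewrite ?sqr_ge0 ?expr1n ?(ltW q2) //.
  by rewrite sqrtr_sqr ger0_norm.
set c := Num.sqrt (a ^+ 2 + b ^+ 2).
have Hc : `|c - Num.sqrt (p + q)%:R * scale R r| <= 2 / n%:R.
  by apply: (approx _ (a ^+ 2 + b ^+ 2)); rewrite ?addr_ge0 ?sqr_ge0 // natrD; lra.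
have LM0 : 0 <= Lam * M by rewrite mulr_ge0.
have move_time s t C y : `|s - t| <= C / n%:R ->
    `|step lim_law s phi y - step lim_law t phi y| <= C * (Lam * M) / n%:R.
  move=> st; apply: le_trans (step_scale_dist LL s t y Lam0 phiL) _.
  by have := ler_wpM2l LM0 st; rewrite -/M; congr (_ <= _); ring.
have psiL := lip_step LL (Num.sqrt q%:R * scale R r) Lam0 phiL.
have uL := lip_step LL b Lam0 phiL.
have := move_time _ _ _ x Hc.
have := lim_law_stable_rat x p q Lam0 phiL r0.
have : `|step lim_law a (step lim_law b phi) x -
         step lim_law (Num.sqrt p%:R * scale R r) (step lim_law b phi) x| <= Lam * M / n%:R.
  apply: le_trans (step_scale_dist LL a _ x Lam0 uL) _.
  by have := ler_wpM2l LM0 Ha; rewrite -/M; congr (_ <= _); ring.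
have : `|step lim_law (Num.sqrt p%:R * scale R r) (step lim_law b phi) x -
         step lim_law (Num.sqrt p%:R * scale R r)
           (step lim_law (Num.sqrt q%:R * scale R r) phi) x| <= 1 * (Lam * M) / n%:R.
  apply: (law_sup_dist (step_law LL _ x)); do ?exact: (lip_lLip Lam0).
  by move=> y; apply: move_time.
have -> : 4 * (Lam * M) / n%:R = 4 * (Lam * M / n%:R) by ring.
have -> : 1 * (Lam * M) / n%:R = Lam * M / n%:R by ring.
have -> : 2 * (Lam * M) / n%:R = 2 * (Lam * M / n%:R) by ring.
move=> E2 E1 ratE E3; rewrite ratE in E2.
exact: chain E1 E2 E3.
Qed.

Lemma lim_law_stable : stable lim_law.
Proof.
move=> a b phi a0 b0; have LL := lim_law_sublin; set c := Num.sqrt _.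
pose L1 psi := step lim_law a (step lim_law b psi) 0.
pose L2 psi := step lim_law c psi 0.
have L1E psi : L1 psi = lim_law (fun x => lim_law (fun y => psi (a *: x + b *: y))).
  by rewrite /L1 /step; congr lim_law; apply/funext => x; rewrite add0r.
have L2E psi : L2 psi = lim_law (fun x => psi (c *: x)).
  by rewrite /L2 /step; congr lim_law; apply/funext => x; rewrite add0r.
have L1L : sublin_law L1.
  apply: (@law_bind R k k (fun psi => step lim_law a psi 0)
    (fun x psi => step lim_law b psi x)) => [|x|psi]; do ?exact: step_law.
  exact: C_lLip_step.
have L2L : sublin_law L2 by apply: step_law.
have L12 Lam psi : 0 <= Lam -> lip Lam psi -> L1 psi = L2 psi.
  by move=> Lam0 psiL; apply: (lim_law_stable_lip _ Lam0).
rewrite -L1E -L2E => phiC; apply/eqP; rewrite eq_le.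
by apply/andP; split; apply: law_le_lip phiC => // Lam psi Lam0 psiL; rewrite (L12 Lam).
Qed.

End CentralLimit.

(** Realized by the limit of the walks whose steps have the superhedging law. *)
Theorem stable_law_exists (R : realType) k (G : 'M[R]_k -> R) : monotone_sublinear G ->
  exists L, [/\ sublin_law L, stable L
    & forall Q, Q \is symmetricmx -> L (fun x => dotv (Q *m x) x) = 2 * G Q].
Proof.
move=> GP; have LL := hedge_law_sublin GP; have L0 := hedge_law_centred GP.
have LM := hedge_law_moment GP.
exists (lim_law (hedge_law G)); split=> [||Q Qs].
- exact: lim_law_sublin.
- exact: lim_law_stable.
- by rewrite lim_law_quad // hedge_law_quad.
Qed.

(** * Sublinear expectation spaces with given finite-dimensional laws *)

Section LinearImage.
Variables (R : realType) (k l : nat) (B : 'M[R]_(l, k)) (L : ('cV[R]_k -> R) -> R).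

Lemma law_linear_image : sublin_law L ->
  sublin_law (fun phi : 'cV[R]_l -> R => L (fun x => phi (B *m x))).
Proof.
move=> L_law; apply: (law_bind (K := fun x phi => phi (B *m x)) L_law) => [x|phi].
  exact: dirac_law.
exact: C_lLip_linear.
Qed.

Lemma stable_linear_image : stable L ->
  stable (fun phi : 'cV[R]_l -> R => L (fun x => phi (B *m x))).
Proof.
move=> Ls a b phi a0 b0 phiC.
transitivity (L (fun x => L (fun y => phi (B *m (a *: x + b *: y))))).
  congr L; apply/funext => x; congr L; apply/funext => y.
  by rewrite mulmxDr -!scalemxAr.
rewrite (Ls a b (fun z => phi (B *m z))) //; last exact: C_lLip_linear.
by congr L; apply/funext => x; rewrite -scalemxAr.
Qed.

End LinearImage.

(** The data of Kolmogorov's extension theorem: laws of finitely many coordinates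
at a time, where consistency is [charts_directed]. The charts need not be
indexed by sets of coordinates, so that products with a further vector are of
the same form. *)
Record charts (R : realType) (Om : Type) := Charts {
  idx : Type;
  dim : idx -> nat;
  proj : forall i, Om -> 'cV[R]_(dim i);
  law : forall i, ('cV[R]_(dim i) -> R) -> R;
  refines := fun i j => exists B : 'M[R]_(dim i, dim j),
    (forall w, proj i w = B *m proj j w) /\
    (forall phi, C_lLip phi -> law phi = law (fun x => phi (B *m x)));
  chart_inhabited : inhabited Om /\ inhabited idx;
  law_sublin : forall i, sublin_law (@law i);
  proj_onto : forall i x, exists w, proj i w = x;
  charts_directed : forall i j, exists2 l, refines i l & refines j l }.
Arguments law {R Om} c i phi.

Section ChartSpace.
Variables (R : realType) (Om : Type) (C : charts R Om).
Implicit Types (X Y : Om -> R) (i j : idx C).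

Definition charted i X := exists2 phi, C_lLip phi & X = fun w => phi (proj i w).

Definition chart_inH X := exists i, charted i X.

Definition chart_E X : R :=
  xget 0 [set r | exists i phi, [/\ C_lLip phi, X = (fun w => phi (proj i w)) & r = law C i phi]]%classic.

Lemma charted_refines i j X : refines i j -> charted i X -> charted j X.
Proof.
move=> [B [PB _]] [phi phiC ->]; exists (fun x => phi (B *m x)); first exact: C_lLip_linear.
by apply/funext => w; rewrite PB.
Qed.

Lemma charted2 X Y : chart_inH X -> chart_inH Y -> exists i, charted i X /\ charted i Y.
Proof.
move=> [i Xi] [j Yj]; have [l il jl] := charts_directed i j; exists l.
by split; [apply: charted_refines Xi|apply: charted_refines Yj].
Qed.

Lemma charted_family n (X : 'I_n -> Om -> R) : (forall o, chart_inH (X o)) ->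
  exists j, forall o, charted j (X o).
Proof.
move=> XH; have [_ [j0]] := chart_inhabited C.
suff [j jP] : exists j, forall o, o \in enum 'I_n -> charted j (X o).
  by exists j => o; apply: jP; rewrite mem_enum.
elim: (enum _) => [|o s [j jP]]; first by exists j0.
have [j' oj'] := XH o; have [l jl j'l] := charts_directed j j'.
exists l => o'; rewrite inE => /orP[/eqP ->|o's]; first exact: charted_refines oj'.
exact: charted_refines (jP o' o's).
Qed.

(** Because the projections are onto, a function on [Om] determines its
representations on the charts, so its expectation does not depend on the
chart. *)
Lemma chart_EE i phi : C_lLip phi -> chart_E (fun w => phi (proj i w)) = law C i phi.
Proof.
move=> phiC; apply: xget_unique; first by exists i, phi.
move=> _ [j [psi [psiC phi_psi ->]]].
have [l [B [PB LB]] [B' [PB' LB']]] := charts_directed i j.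
rewrite LB // LB' //; congr (law C l); apply/funext => x.
have [w <-] := proj_onto (i := l) x; rewrite -PB -PB'.
by have := congr1 (fun f => f w) phi_psi.
Qed.

Lemma chart_inH_zero : chart_inH (fun=> 0).
Proof.
by have [_ [i]] := chart_inhabited C; exists i, (fun=> 0).
Qed.

Lemma chart_inH_linear a X Y : chart_inH X -> chart_inH Y ->
  chart_inH (fun w => a * X w + Y w).
Proof.
move=> XH YH; have [i [[phi phiC ->] [psi psiC ->]]] := charted2 XH YH.
by exists i, (fun x => a * phi x + psi x) => //; apply: C_lLipD => //; apply: C_lLipZ.
Qed.

Lemma chart_inH_comp n (X : 'I_n -> Om -> R) (phi : 'cV[R]_n -> R) :
  (forall o, chart_inH (X o)) -> C_lLip phi -> chart_inH (fun w => phi (\col_o X o w)).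
Proof.
move=> /charted_family[j Xj] phiC.
have /choice[psi psiP] o : exists psi, C_lLip psi /\ X o = fun w => psi (proj j w).
  by have [psi] := Xj o; exists psi.
exists j, (fun x => phi (\col_o psi o x)).
  by apply: C_lLip_comp phiC _; apply: poly_lip_col => o; have [] := psiP o.
apply/funext => w; congr phi; apply/matrixP => o z; rewrite !mxE.
by have [_ ->] := psiP o.
Qed.

Lemma chart_E_monotone X Y : chart_inH X -> chart_inH Y -> (forall w, Y w <= X w) ->
  chart_E Y <= chart_E X.
Proof.
move=> XH YH; have [i [[phi phiC ->] [psi psiC ->]]] := charted2 XH YH => le_YX.
rewrite !chart_EE //; apply: (law_le (law_sublin i)) => // x.
by have [w <-] := proj_onto (i := i) x.
Qed.

Lemma chart_E_const c : chart_E (fun=> c) = c.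
Proof.
have [_ [i]] := chart_inhabited C.
by rewrite (@chart_EE i (fun=> c)) // (law_const (law_sublin i)).
Qed.

Lemma chart_E_subadd X Y : chart_inH X -> chart_inH Y ->
  chart_E (fun w => X w + Y w) <= chart_E X + chart_E Y.
Proof.
move=> XH YH; have [i [[phi phiC ->] [psi psiC ->]]] := charted2 XH YH.
rewrite (@chart_EE i (fun x => phi x + psi x)) ?chart_EE //; last exact: C_lLipD.
exact: (law_subadd (law_sublin i)).
Qed.

Lemma chart_E_poshom a X : 0 <= a -> chart_inH X ->
  chart_E (fun w => a * X w) = a * chart_E X.
Proof.
move=> a0 [i [phi phiC ->]].
rewrite (@chart_EE i (fun x => a * phi x)) ?chart_EE //; last exact: C_lLipZ.
exact: (law_poshom (law_sublin i)).
Qed.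

Definition chart_space : sublin_space R := @SublinSpace R Om chart_inH chart_E
  (chart_inhabited C).1 chart_inH_zero chart_inH_linear chart_inH_comp
  chart_E_monotone chart_E_const chart_E_subadd chart_E_poshom.

End ChartSpace.

Section ProductCharts.
Variables (R : realType) (Om : Type) (C : charts R Om).
Variables (d : nat) (L : ('cV[R]_d -> R) -> R).
Hypothesis L_law : sublin_law L.

Definition prod_proj (i : idx C) (w : Om * 'cV[R]_d) : 'cV[R]_(dim i + d) :=
  col_mx (proj i w.1) w.2.

Definition prod_law (i : idx C) (phi : 'cV[R]_(dim i + d) -> R) : R :=
  law C i (fun x => L (fun y => phi (col_mx x y))).

Lemma prod_inhabited : inhabited (Om * 'cV[R]_d) /\ inhabited (idx C).
Proof. by have [[w] [i]] := chart_inhabited C; split; [exact: (inhabits (w, 0))|]. Qed.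

Lemma prod_law_sublin i : sublin_law (@prod_law i).
Proof.
apply: (law_bind (K := fun x phi => L (fun y => phi (col_mx x y))) (law_sublin i)).
  move=> x; apply: (law_bind (K := fun y phi => phi (col_mx x y)) L_law).
    by move=> y; exact: (dirac_law (col_mx x y)).
  move=> phi phiC.
  have := C_lLip_comp phiC (poly_lip_linear (col_mx 0 1%:M) (col_mx x 0)).
  congr C_lLip; apply/funext => y; congr phi.
  by rewrite mul_col_mx mul0mx mul1mx add_col_mx addr0 add0r.
by move=> phi phiC; apply: (C_lLip_law L_law phiC).
Qed.

Lemma prod_proj_onto i x : exists w, prod_proj i w = x.
Proof.
have [w wP] := proj_onto (usubmx x); exists (w, dsubmx x).
by rewrite /prod_proj /= wP vsubmxK.
Qed.

Lemma prod_charts_directed i j : exists2 l : idx C,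
  exists B : 'M[R]_(dim i + d, dim l + d),
    (forall w, prod_proj i w = B *m prod_proj l w) /\
    (forall phi, C_lLip phi -> prod_law phi = prod_law (fun x => phi (B *m x))) &
  exists B : 'M[R]_(dim j + d, dim l + d),
    (forall w, prod_proj j w = B *m prod_proj l w) /\
    (forall phi, C_lLip phi -> prod_law phi = prod_law (fun x => phi (B *m x))).
Proof.
have ext i' l : refines i' l -> exists B : 'M[R]_(dim i' + d, dim l + d),
    (forall w, prod_proj i' w = B *m prod_proj l w) /\
    (forall phi, C_lLip phi -> prod_law phi = prod_law (fun x => phi (B *m x))).
  move=> [B [PB LB]]; exists (block_mx B 0 0 1%:M); split=> [w|phi phiC].
    by rewrite /prod_proj mul_block_col !mul0mx mul1mx addr0 add0r PB.
  rewrite /prod_law LB; last exact: (C_lLip_law L_law phiC).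
  congr (law C l); apply/funext => x; congr L; apply/funext => y.
  by rewrite mul_block_col !mul0mx mul1mx addr0 add0r.
by have [l il jl] := charts_directed i j; exists l; apply: ext.
Qed.

(** The charts extended by an independent vector of law [L]. *)
Definition prod_charts : charts R (Om * 'cV[R]_d) :=
  @Charts R _ (idx C) (fun i => dim i + d)%N prod_proj prod_law prod_inhabited
    prod_law_sublin prod_proj_onto prod_charts_directed.

End ProductCharts.

Lemma chart_random_vector (R : realType) Om (C : charts R Om) (i : idx C) :
  @random_vector R (chart_space C) _ (@proj R Om C i).
Proof. by move=> o; exists i, (fun x => x o 0). Qed.

(** The independent copy of [proj i] is the additional vector of the product
with [law C i]. *)
Lemma chart_G_normal (R : realType) Om (C : charts R Om) (i : idx C) :
  stable (law C i) -> @G_normal R (chart_space C) _ (@proj R Om C i).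
Proof.
move=> Ls; have Li := law_sublin i; split; first exact: chart_random_vector.
pose C' := prod_charts C Li.
have EE (phi : 'cV[R]_(dim i + dim i) -> R) : C_lLip phi ->
    chart_E C' (fun w => phi (col_mx (proj i w.1) w.2)) =
    law C i (fun x => law C i (fun y => phi (col_mx x y))).
  by move=> phiC; apply: (@chart_EE R _ C' i).
have E1 psi : C_lLip psi -> chart_E C' (fun w => psi (proj i w.1)) = law C i psi.
  move=> psiC; have := EE _ (C_lLip_linear (row_mx 1%:M 0) psiC).
  under eq_fun => w do rewrite mul_row_col mul1mx mul0mx addr0.
  move=> ->; congr (law C i); apply/funext => x.
  under eq_fun => y do rewrite mul_row_col mul1mx mul0mx addr0.
  exact: (law_const Li).
have E2 psi : C_lLip psi -> chart_E C' (fun w => psi w.2) = law C i psi.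
  move=> psiC; have := EE _ (C_lLip_linear (row_mx 0 1%:M) psiC).
  under eq_fun => w do rewrite mul_row_col mul1mx mul0mx add0r.
  move=> ->; rewrite -[RHS](law_const Li); congr (law C i); apply/funext => x.
  by congr (law C i); apply/funext => y; rewrite mul_row_col mul1mx mul0mx add0r.
exists (chart_space C'), fst, snd; split.
- move=> X [j [phi phiC ->]].
  have phi'C := C_lLip_linear (row_mx 1%:M (0 : 'M_(dim j, dim i))) phiC.
  have XE : (fun w : Om * 'cV[R]_(dim i) => phi (proj j w.1)) =
      fun w => phi (row_mx 1%:M 0 *m @proj R _ C' j w).
    by apply/funext => w; rewrite mul_row_col mul1mx mul0mx addr0.
  split; first by exists j, (fun x => phi (row_mx 1%:M 0 *m x)).
  rewrite /= XE (@chart_EE R _ C' j (fun x => phi (row_mx 1%:M 0 *m x))) // chart_EE //.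
  congr (law C j); apply/funext => x; rewrite -[RHS](law_const Li); congr (law C i).
  by apply/funext => y; rewrite mul_row_col mul1mx mul0mx addr0.
- split.
  + move=> o; exists i, (fun x : 'cV[R]_(dim i + dim i) => x (rshift _ o) 0) => //.
    by apply/funext => w; rewrite /= /prod_proj col_mxEd.
  + by move=> phi phiC; rewrite /= E1 // E2.
  + move=> phi phiC; rewrite /= EE // -(E1 (fun x => law C i (fun y => phi (col_mx x y)))).
      congr (chart_E C'); apply/funext => w; rewrite -E2 //.
      have := C_lLip_comp phiC (poly_lip_linear (col_mx 0 1%:M) (col_mx (proj i w.1) 0)).
      congr C_lLip; apply/funext => y; congr phi.
      by rewrite mul_col_mx mul0mx mul1mx add_col_mx addr0 add0r.
    exact: (C_lLip_law Li phiC).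
- move=> a b a0 b0 phi phiC; set c := Num.sqrt _.
  have := EE _ (C_lLip_linear (row_mx a%:M b%:M) phiC).
  under eq_fun => w do rewrite mul_row_col !mul_scalar_mx.
  rewrite /= => ->; have cC : C_lLip (fun x => phi (c *: x)).
    by have := C_lLip_affine 0 c phiC; congr C_lLip; apply/funext => x; rewrite add0r.
  rewrite (chart_EE (i := i) cC) -Ls //; congr (law C i); apply/funext => x.
  by congr (law C i); apply/funext => y; rewrite mul_row_col !mul_scalar_mx.
Qed.

(** * The law of a G-normal vector *)

Section GNormalLaw.
Variables (R : realType) (S : sublin_space R) (k : nat) (X : Omega S -> 'cV[R]_k).

Lemma inH_random_vector phi : random_vector X -> C_lLip phi -> inH (fun w => phi (X w)).
Proof.
move=> XV phiC; have := inH_comp (X := fun i w => X w i 0) XV phiC.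
congr inH; apply/funext => w; congr phi; apply/matrixP => i o.
by rewrite mxE ord1.
Qed.

Lemma random_vector_law : random_vector X -> sublin_law (fun phi => E (fun w => phi (X w))).
Proof.
move=> XV; have XH phi := @inH_random_vector phi XV.
split=> [f g fC gC le_fg|c|f g fC gC|a f a0 fC].
- by apply: E_monotone => [||w]; [exact: XH..|exact: le_fg].
- exact: E_const.
- by apply: E_subadd; apply: XH.
- by apply: E_poshom => //; apply: XH.
Qed.

(** Independence and equality in law of the copy express the joint law of [X]
and its copy through the law of [X]; the extension of the space disappears. *)
Lemma G_normal_stable : G_normal X -> stable (fun phi => E (fun w => phi (X w))).
Proof.
move=> [XV [S' [p [Xbar [ext [XbV Xb_dist Xb_ind] XS]]]]] a b phi a0 b0 phiC.
have LL := random_vector_law XV.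
have abC : C_lLip (fun z => phi (row_mx a%:M b%:M *m z)) by apply: C_lLip_linear.
rewrite -(XS a b a0 b0 phi phiC).
transitivity (E (fun w => phi (row_mx a%:M b%:M *m col_mx (X (p w)) (Xbar w)))); last first.
  by congr E; apply/funext => w; rewrite mul_row_col !mul_scalar_mx.
rewrite (Xb_ind _ abC).
have sC : C_lLip (fun x => E (fun w => phi (a *: x + b *: X w))).
  exact: (C_lLip_law_lin a b LL phiC).
have [_ <-] := ext _ (inH_random_vector XV sC); congr E; apply/funext => w.
have bC : C_lLip (fun y => phi (a *: X (p w) + b *: y)) by apply: C_lLip_affine.
have := Xb_dist _ bC; have [_ ->] := ext _ (inH_random_vector XV bC) => <-.
by congr E; apply/funext => w'; rewrite mul_row_col !mul_scalar_mx.
Qed.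

End GNormalLaw.

(** * Consistency of the covariance functions *)

Section Selection.
Variables (R : realType) (m : nat).

Definition block_sel n n' (f : 'I_n -> 'I_n') : 'M[R]_(blockdim n m, blockdim n' m) :=
  @mxblock _ n n' (fun=> m) (fun=> m) (fun i j => if j == f i then 1%:M else 0).

Lemma mul_sel_col n n' (f : 'I_n -> 'I_n') (x : 'I_n' -> 'cV[R]_m) :
  block_sel f *m @mxcol _ n' (fun=> m) 1 x = @mxcol _ n (fun=> m) 1 (fun i => x (f i)).
Proof.
rewrite /block_sel mul_mxblock_mxrow; apply: eq_mxcol => i.
rewrite (bigD1 (f i)) //= eqxx mul1mx big1 ?addr0 // => j /negPf ->.
by rewrite mul0mx.
Qed.

Lemma sel_comp n n' n'' (g : 'I_n -> 'I_n') (f : 'I_n' -> 'I_n'') :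
  block_sel g *m block_sel f = block_sel (f \o g).
Proof.
rewrite /block_sel mul_mxblock; apply: eq_mxblock => i j.
rewrite (bigD1 (g i)) //= eqxx mul1mx big1 ?addr0 // => l /negPf ->.
by rewrite mul0mx.
Qed.

Definition sel_conj n n' (f : 'I_n -> 'I_n') (Q : 'M[R]_(blockdim n m)) :
  'M[R]_(blockdim n' m) := (block_sel f)^T *m Q *m block_sel f.

Lemma sel_conjE n n' (f : 'I_n -> 'I_n') (Q : 'M[R]_(blockdim n m)) :
  sel_conj f Q = @mxblock _ n' n' (fun=> m) (fun=> m) (fun i j =>
    \sum_(i' | i == f i') \sum_(j' | j == f j') @submxblock _ n n (fun=> m) (fun=> m) Q i' j').
Proof.
rewrite /sel_conj -{1}(submxblockK Q) /block_sel tr_mxblock mul_mxblock mul_mxblock.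
apply: eq_mxblock => i j; rewrite [RHS]big_mkcond /=.
transitivity (\sum_j' \sum_i' (if i == f i' then if j == f j' then
    @submxblock _ n n (fun=> m) (fun=> m) Q i' j' else 0 else 0)).
  apply: eq_bigr => j' _; rewrite mulmx_suml; apply: eq_bigr => i' _.
  case: eqP => _; last by rewrite trmx0 !mul0mx.
  by rewrite trmx1 mul1mx; case: eqP => _; rewrite ?mulmx1 ?mulmx0.
rewrite exchange_big; apply: eq_bigr => i' _; case: eqP => _ /=.
  by rewrite [RHS]big_mkcond.
by rewrite big1.
Qed.

Lemma symmetric_conj k l (B : 'M[R]_(k, l)) (Q : 'M[R]_k) :
  Q \is symmetricmx -> B^T *m Q *m B \is symmetricmx.
Proof.
move=> /symmetricP QT; apply/symmetricP.
by rewrite !trmx_mul trmxK QT mulmxA.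
Qed.

Lemma perm_block_sel n (s : 'S_n) (Q : 'M[R]_(blockdim n m)) :
  perm_block (s^-1)%g Q = sel_conj s Q.
Proof.
rewrite sel_conjE; apply: eq_mxblock => i j.
have fiber l i' : (l == s i') = (i' == (s^-1)%g l).
  by rewrite -(inj_eq (@perm_inj _ s) i') permKV eq_sym.
rewrite (big_pred1 ((s^-1)%g i)) => [|i']; last by rewrite fiber.
by rewrite (big_pred1 ((s^-1)%g j)) => [|j']; last by rewrite fiber.
Qed.

Lemma pad_block_sel n (Q : 'M[R]_(blockdim n m)) :
  pad_block Q = sel_conj (widen_ord (leqnSn n)) Q.
Proof.
rewrite sel_conjE; apply: eq_mxblock => i j.
have fiber (l : 'I_n) i' : (lift ord_max l == widen_ord (leqnSn n) i') = (i' == l).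
  by rewrite -!val_eqE /= /bump leqNgt ltn_ord add0n eq_sym.
have fiber_max i' : (ord_max == widen_ord (leqnSn n) i') = false.
  by rewrite -val_eqE /= gtn_eqF.
case: unliftP => [i1 ->|->]; last by rewrite big_pred0.
rewrite (big_pred1 i1) => [|i']; last by rewrite fiber.
case: unliftP => [j1 ->|->]; last by rewrite big_pred0.
by rewrite (big_pred1 j1) => // j'; rewrite fiber.
Qed.

End Selection.

Section Consistency.
Variables (R : realType) (Gamma : Type) (m : nat).
Variable G : forall n, ('I_n -> Gamma) -> 'M[R]_(blockdim n m) -> R.
Hypothesis G_compatible : forall n (g : 'I_n.+1 -> Gamma), injective g ->
  forall Q : 'M[R]_(blockdim n m), Q \is symmetricmx ->
    @G n.+1 g (pad_block Q) = @G n (fun i => g (widen_ord (leqnSn n) i)) Q.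
Hypothesis G_symmetric : forall n (g : 'I_n -> Gamma), injective g ->
  forall (s : 'S_n) (Q : 'M[R]_(blockdim n m)), Q \is symmetricmx ->
    @G n (fun i => g (s i)) Q = @G n g (perm_block (s^-1)%g Q).

(** Compatibility and symmetry together give consistency for the selection of
any subfamily: a selection that misses an index becomes, after the index has
been exchanged with the last one, a selection from the others. *)
Lemma cov_consistent n' n (g : 'I_n' -> Gamma) (f : 'I_n -> 'I_n') :
  injective g -> injective f -> forall Q : 'M[R]_(blockdim n m), Q \is symmetricmx ->
  @G n' g (sel_conj f Q) = @G n (fun i => g (f i)) Q.
Proof.
elim: n' n g f => [|k IHk] n g f g_inj f_inj Q Qs.
  have n0 : n = 0%N by case: n f {f_inj Q Qs} => // n f; case: (f ord0).
  subst n; pose s : 'S_0 := perm f_inj.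
  have -> : f = s by apply/funext => i; rewrite permE.
  by rewrite -perm_block_sel -G_symmetric.
have [nk|n_neq] := eqVneq n k.+1.
  subst n; pose s : 'S_k.+1 := perm f_inj.
  have -> : f = s by apply/funext => i; rewrite permE.
  by rewrite -perm_block_sel -G_symmetric.
have [j jf] : exists j, j \notin codom f.
  apply/existsP; apply: contraNT n_neq; rewrite negb_exists => /forallP all_f.
  have := leq_card f f_inj; rewrite !card_ord eqn_leq => -> /=.
  rewrite -[leqLHS]card_ord -[leqRHS]card_ord -(card_codom f_inj).
  by apply/subset_leq_card/fintype.subsetP => j _; have := all_f j; rewrite negbK.
pose s : 'S_k.+1 := tperm j ord_max; pose w := widen_ord (leqnSn k).
have /choice[f' f'P] i : exists i', s (f i) = w i'.
  have sfi : s (f i) != ord_max.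
    rewrite -[ord_max](tpermL j) (inj_eq perm_inj).
    by apply: contraNneq jf => <-; apply: codom_f.
  have lt_sfi : (s (f i) < k)%N.
    rewrite ltn_neqAle -ltnS ltn_ord andbT; apply: contra_neq sfi => sfi.
    exact: val_inj.
  by exists (Ordinal lt_sfi); apply: val_inj.
have fE : f = s \o (w \o f').
  by apply/funext => i /=; rewrite -f'P /s tpermK.
have w_inj : injective w by move=> i i' /(congr1 val) /= /val_inj.
have f'_inj : injective f'.
  by move=> i i' fi; apply: f_inj; rewrite fE /= fi.
have gs_inj : injective (fun i => g (s i)) by move=> i i' /g_inj /perm_inj.
have gsw_inj : injective (fun i => g (s (w i))) by move=> i i' /gs_inj /w_inj.
have Q's : sel_conj f' Q \is symmetricmx by apply: symmetric_conj.
have -> : sel_conj f Q = perm_block (s^-1)%g (pad_block (sel_conj f' Q)).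
  rewrite perm_block_sel pad_block_sel fE /sel_conj.
  by rewrite -(sel_comp R m (w \o f') s) -(sel_comp R m f' w) !trmx_mul !mulmxA.
rewrite -G_symmetric //; last by rewrite pad_block_sel; apply: symmetric_conj.
rewrite G_compatible // IHk //; congr (@G _ _ _); apply/funext => i.
by rewrite -/w -f'P /s tpermK.
Qed.

End Consistency.

(** * Gaussian fields *)

Section Field.
Variables (R : realType) (Gamma : Type) (m : nat).
Variable G : forall n, ('I_n -> Gamma) -> 'M[R]_(blockdim n m) -> R.
Hypothesis G_sublinear : forall n (g : 'I_n -> Gamma), injective g ->
  monotone_sublinear (@G n g).
Hypothesis G_compatible : forall n (g : 'I_n.+1 -> Gamma), injective g ->
  forall Q : 'M[R]_(blockdim n m), Q \is symmetricmx ->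
    @G n.+1 g (pad_block Q) = @G n (fun i => g (widen_ord (leqnSn n) i)) Q.
Hypothesis G_symmetric : forall n (g : 'I_n -> Gamma), injective g ->
  forall (s : 'S_n) (Q : 'M[R]_(blockdim n m)), Q \is symmetricmx ->
    @G n (fun i => g (s i)) Q = @G n g (perm_block (s^-1)%g Q).

Record index_tuple := IndexTuple {
  tuple_size : nat;
  tuple_map : 'I_tuple_size -> Gamma;
  tuple_inj : injective tuple_map }.
Implicit Types t : index_tuple.

Definition tuple_dim t := blockdim (tuple_size t) m.

Definition tuple_proj t (w : Gamma -> 'cV[R]_m) : 'cV[R]_(tuple_dim t) :=
  @mxcol _ (tuple_size t) (fun=> m) 1 (fun i => w (tuple_map i)).

Definition tuple_law t : ('cV[R]_(tuple_dim t) -> R) -> R :=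
  sval (cid (stable_law_exists (G_sublinear (@tuple_inj t)))).

Lemma tuple_lawP t : [/\ sublin_law (@tuple_law t), stable (@tuple_law t)
  & forall Q, Q \is symmetricmx ->
      tuple_law (fun x => dotv (Q *m x) x) = 2 * G (@tuple_map t) Q].
Proof. exact: svalP (cid (stable_law_exists (G_sublinear (@tuple_inj t)))). Qed.

(** The law of a subfamily is stable with the covariance function that
consistency predicts; by uniqueness it is the chosen one. *)
Lemma tuple_law_sel t t' (f : 'I_(tuple_size t) -> 'I_(tuple_size t')) phi :
  injective f -> (forall i, tuple_map (f i) = tuple_map i) -> C_lLip phi ->
  tuple_law (t := t) phi = tuple_law (t := t') (fun x => phi (block_sel R m f *m x)).
Proof.
move=> f_inj fP phiC; have [LL Ls LQ] := tuple_lawP t.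
have [LL' Ls' LQ'] := tuple_lawP t'.
have BL := law_linear_image (block_sel R m f) LL'.
have Bs := stable_linear_image (block_sel R m f) Ls'.
apply: (stable_unique LL BL Ls Bs) phiC => Q Qs.
have -> : (fun x => dotv (Q *m (block_sel R m f *m x)) (block_sel R m f *m x)) =
    fun x => dotv (sel_conj f Q *m x) x.
  by apply/funext => x; rewrite /sel_conj -!mulmxA [RHS]dotvC -dotv_trmx dotvC.
rewrite LQ // LQ' ?symmetric_conj //; congr (2 * _).
rewrite (cov_consistent G_compatible G_symmetric (@tuple_inj t') f_inj) //.
by congr (@G _ _ _); apply/funext => i; rewrite fP.
Qed.

Lemma tuple_inhabited : inhabited (Gamma -> 'cV[R]_m) /\ inhabited index_tuple.
Proof.
split; first exact: (inhabits (fun=> 0)).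
have g0_inj : injective (fun i : 'I_0 => match i with Ordinal _ lt_i0 =>
    False_rect Gamma (elimF idP (ltn0 _) lt_i0) end) by case.
exact: (inhabits (IndexTuple g0_inj)).
Qed.

Lemma tuple_proj_onto t x : exists w, tuple_proj t w = x.
Proof.
have /choice[w wP] c : exists y, forall i, @tuple_map t i = c ->
    y = @submxcol _ (tuple_size t) (fun=> m) 1 x i.
  have [[i <-]|no_i] := pselect (exists i, @tuple_map t i = c).
    by exists (submxcol x i) => j /tuple_inj ->.
  by exists 0 => i ic; case: no_i; exists i.
exists w; rewrite -[RHS]submxcolK; apply: eq_mxcol => i.
exact: wP.
Qed.

Lemma tuple_directed t1 t2 : exists2 t : index_tuple,
  exists B : 'M[R]_(tuple_dim t1, tuple_dim t),
    (forall w, tuple_proj t1 w = B *m tuple_proj t w) /\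
    (forall phi, C_lLip phi -> tuple_law phi = tuple_law (fun x => phi (B *m x))) &
  exists B : 'M[R]_(tuple_dim t2, tuple_dim t),
    (forall w, tuple_proj t2 w = B *m tuple_proj t w) /\
    (forall phi, C_lLip phi -> tuple_law phi = tuple_law (fun x => phi (B *m x))).
Proof.
pose values t' : seq {classic Gamma} := [seq tuple_map i | i <- enum 'I_(tuple_size t')].
pose s := undup (values t1 ++ values t2).
have s_inj : injective (fun i => tnth (in_tuple s) i : Gamma).
  have /tuple_uniqP : uniq (in_tuple s) by apply: undup_uniq.
  exact.
have ext t' : {subset values t' <= s} ->
    exists B : 'M[R]_(tuple_dim t', tuple_dim (IndexTuple s_inj)),
    (forall w, tuple_proj t' w = B *m tuple_proj (IndexTuple s_inj) w) /\
    (forall phi, C_lLip phi -> tuple_law phi = tuple_law (fun x => phi (B *m x))).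
  move=> sub.
  have /choice[f fP] i : exists j, tnth (in_tuple s) j = @tuple_map t' i :> {classic Gamma}.
    have /sub /(tnthP (in_tuple s))[j ->] : (tuple_map i : {classic Gamma}) \in values t'.
      by apply: map_f; rewrite mem_enum.
    by exists j.
  have f_inj : injective f.
    by move=> i j fij; apply: (@tuple_inj t'); rewrite -!fP fij.
  exists (block_sel R m f); split=> [w|phi phiC]; last exact: tuple_law_sel.
  by rewrite /tuple_proj mul_sel_col; apply: eq_mxcol => i; rewrite /= fP.
by exists (IndexTuple s_inj); apply: ext => c; rewrite mem_undup mem_cat => ->;
  rewrite ?orbT.
Qed.

Definition field_charts : charts R (Gamma -> 'cV[R]_m) :=
  @Charts R _ index_tuple tuple_dim tuple_proj tuple_law tuple_inhabited
    (fun t => let: And3 LL _ _ := tuple_lawP t in LL) tuple_proj_onto tuple_directed.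

End Field.

Theorem theorem17 (R : realType) (Gamma : Type) (m : nat) (m_ge1 : (1 <= m)%N)
  (G : forall n, ('I_n -> Gamma) -> 'M[R]_(blockdim n m) -> R)
  (G_sublinear : forall n (g : 'I_n -> Gamma), injective g ->
    monotone_sublinear (G n g))
  (G_compatible : forall n (g : 'I_n.+1 -> Gamma), injective g ->
    forall Q : 'M[R]_(blockdim n m), Q \is symmetricmx ->
      G n.+1 g (pad_block Q) = G n (fun i => g (widen_ord (leqnSn n) i)) Q)
  (G_symmetric : forall n (g : 'I_n -> Gamma), injective g ->
    forall (s : 'S_n) (Q : 'M[R]_(blockdim n m)), Q \is symmetricmx ->
      G n (fun i => g (s i)) Q = G n g (perm_block (s^-1)%g Q)) :
  exists (S : sublin_space R) (W : Gamma -> Omega S -> 'cV[R]_m),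
    [/\ G_gaussian_field W,
        has_generators W G
      & forall (Sbar : sublin_space R) (Wbar : Gamma -> Omega Sbar -> 'cV[R]_m),
          G_gaussian_field Wbar -> has_generators Wbar G ->
          same_field_dist W Wbar].
Proof.
pose C := field_charts G_sublinear G_compatible G_symmetric.
pose W (c : Gamma) (w : Omega (chart_space C)) : 'cV[R]_m := w c.
have WE n (g : 'I_n -> Gamma) (g_inj : injective g) phi : C_lLip phi ->
    E (fun w => phi (field_vector W g w)) = tuple_law G_sublinear (t := IndexTuple g_inj) phi.
  by move=> phiC; apply: (@chart_EE R _ C (IndexTuple g_inj)).
exists (chart_space C), W; split.
- split=> [c|n g g_inj].
    have g_inj : injective (fun _ : 'I_1 => c) by move=> i j _; rewrite !ord1.
    move=> o; exists (IndexTuple g_inj : idx C).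
    exists (fun x : 'cV[R]_(blockdim 1 m) => @submxcol _ 1 (fun=> m) 1 x ord0 o 0).
      have [o' xE] : exists o', forall x : 'cV[R]_(blockdim 1 m),
          @submxcol _ 1 (fun=> m) 1 x ord0 o 0 = x o' 0 by eexists => x; rewrite mxE.
      by have := C_lLip_coord R o'; congr C_lLip; apply/funext => x; rewrite xE.
    by apply/funext => w; rewrite mxcolK.
  apply: (@chart_G_normal R _ C (IndexTuple g_inj)).
  by have [] := tuple_lawP G_sublinear (IndexTuple g_inj).
- move=> n g g_inj Q Qs; rewrite (WE n g g_inj (fun x => dotv (Q *m x) x)) //.
  have [_ _ ->] := tuple_lawP G_sublinear (IndexTuple g_inj) => //.
  by rewrite mulKf // pnatr_eq0.
- move=> Sbar Wbar [_ Wbar_normal] Wbar_gen n g g_inj phi phiC; rewrite (WE n g g_inj phi phiC).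
  have [LL Ls LQ] := tuple_lawP G_sublinear (IndexTuple g_inj).
  have barN := Wbar_normal n g g_inj.
  apply: (stable_unique LL (random_vector_law barN.1) Ls (G_normal_stable barN)) phiC.
  by move=> Q Qs; rewrite LQ //= -Wbar_gen // mulVKf // pnatr_eq0.
Qed.
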